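(* Let $n,m\ge 1$, and let $U\subset\mathbb{C}^n$ be a connected open set of configurations $(x_1,\dots,x_n)$ of pairwise distinct points. Let $A_1,\dots,A_n$ be $m\times m$ complex matrices depending holomorphically on $(x_1,\dots,x_n)\in U$. Let $Y=Y(x;x_1,\dots,x_n)$ be an invertible matrix solution of $$\frac{\partial Y}{\partial x}=\sum_{k=1}^{n}\frac{A_k}{x-x_k}\,Y ,$$ depending holomorphically on $(x;x_1,\dots,x_n)$ and having the expansions $$Y(x)=Y_j(x)\,(x-x_j)^{L_j}\quad\text{near }x=x_j\ (j=1,\dots,n),\qquad Y(x)=Y_\infty(x)\,x^{-L_\infty}\quad\text{near }x=\infty,$$ where $Y_j$ is holomorphic and invertible at $x=x_j$, and $Y_\infty$ is holomorphic at $x=\infty$ with $Y_\infty(x)=I+O(1/x)$. The branches and the dependence on parameters are as fixed in the context. Suppose that there are scalar functions $f_{jk}$ of $(x_1,\dots,x_n)$ such that the local exponent matrices evolve as $$\frac{\partial L_j}{\partial x_k}=f_{jk}\,I\quad (j,k=1,\dots,n),\qquad \frac{\partial L_\infty}{\partial x_k}=-\sum_{j=1}^n f_{jk}\,I\quad (k=1,\dots,n).$$ Then, for every $k=1,\dots,n$, $Y$ satisfies the deformation equation $$\frac{\partial Y}{\partial x_k}=\left(-\frac{A_k}{x-x_k}+\sum_{j=1}^{n}f_{jk}\,\log(x-x_j)\,I\right)Y .$$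
   Context: $I$ is the $m\times m$ identity matrix. For a matrix $L$ and a chosen branch of $\log u$, $u^{L}:=\exp(L\log u)$. The matrices $L_1,\dots,L_n,L_\infty$ are $m\times m$ matrices that are independent of $x$ and depend holomorphically on $(x_1,\dots,x_n)\in U$. Branches: the statement is local in the parameters. $U$ is taken small enough that for some fixed angle $\theta$ the closed rays $\ell_j=x_j+e^{i\theta}\mathbb{R}_{\ge 0}$, $j=1,\dots,n$, are pairwise disjoint for all $(x_1,\dots,x_n)\in U$. For each configuration, $Y$ is a single-valued holomorphic function of $x$ in the cut plane $\mathbb{C}\setminus\bigcup_j \ell_j$. Branches of $\log(x-x_j)$ are fixed on $\mathbb{C}\setminus \ell_j$, holomorphic in $(x;x_1,\dots,x_n)$. ''Near $x=x_j$'' means on a small disc about $x_j$ with $\ell_j$ removed. ''Near $x=\infty$'' means on $\{|x|>R,\ \mathrm{Re}(e^{-i\theta}x)<0\}$ for large $R$ (chosen locally uniformly in the parameters). There a parameter-independent branch of $\log x$ is used, and the branches are chosen compatibly, so that $\log(x-x_j)-\log x\to 0$ as $x\to\infty$ for every $j$. The factors $Y_j$ and $Y_\infty$ are holomorphic in full neighbourhoods of $x_j$ and $\infty$ respectively, and depend holomorphically on $(x_1,\dots,x_n)$. Since one and the same $Y$ is expanded at every point, the $L_j$ are not assumed to be in any normal form. *)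

(* Defs.v *)
From HB Require Import structures.
From mathcomp Require Import all_boot all_order all_algebra.
From mathcomp Require Import complex.
From mathcomp Require Import all_classical all_reals all_analysis.

Set Implicit Arguments.
Unset Strict Implicit.
Unset Printing Implicit Defensive.

Import Order.TTheory GRing.Theory Num.Theory numFieldNormedType.Exports.

Local Open Scope classical_set_scope.
Local Open Scope ring_scope.
Local Open Scope complex_scope.

(* R[i], packed so that the generic topological and normed-module instances of
   a numClosedFieldType (hence those of products and matrices) are inferred;
   the scalars are complex, so [differentiable] below is Frechet
   differentiability with a C-linear differential. *)
Definition Cplx (R : realType) : numClosedFieldType := R[i].

Definition cis {R : realType} (theta : R) : Cplx R := cos theta +i* sin theta.

Definition cexp {R : realType} (z : Cplx R) : Cplx R :=
  (expR (complex.Re z))%:C * cis (complex.Im z).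

Definition expmx {R : realType} {m : nat} (M : 'M[Cplx R]_m) : 'M[Cplx R]_m :=
  limn (series (fun k : nat => (k`!%:R : Cplx R)^-1 *: M ^+ k)).

(* Only used for open D. On a product C * C^n this is joint holomorphy. *)
Definition holomorphic_on {R : realType} {V W : normedModType (Cplx R)}
  (D : set V) (f : V -> W) : Prop := forall p, D p -> differentiable f p.

Definition holomorphic_near {R : realType} {V W : normedModType (Cplx R)}
  (p0 : V) (f : V -> W) : Prop := \forall p \near p0, differentiable f p.

Definition ray {R : realType} (theta : R) (a : Cplx R) : set (Cplx R) :=
  [set x | exists2 s : R, 0 <= s & x = a + cis theta * s%:C].

(* The part of the plane in which expansions at infinity are taken, before
   restricting to large |x|. *)
Definition back_half_plane {R : realType} (theta : R) : set (Cplx R) :=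
  [set x | complex.Re (cis (- theta) * x) < 0].

(* A point of C * C^n is a pair (x, t), and t ord0 j is the pole x_j. *)
Definition cut_plane_j {R : realType} {n : nat} (theta : R)
    (U : set 'rV[Cplx R]_n) (j : 'I_n) : set (Cplx R * 'rV[Cplx R]_n) :=
  [set p | U p.2 /\ ~ ray theta (p.2 ord0 j) p.1].

Definition cut_plane {R : realType} {n : nat} (theta : R)
    (U : set 'rV[Cplx R]_n) : set (Cplx R * 'rV[Cplx R]_n) :=
  [set p | U p.2 /\ forall j, ~ ray theta (p.2 ord0 j) p.1].

(* F is holomorphic in a full neighbourhood of x = infinity, jointly with the
   parameters near t0: in the chart w = 1/x it extends holomorphically across
   w = 0. The guard w != 0 is needed since 0^-1 = 0. *)
Definition holomorphic_at_infty {R : realType} {n : nat}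
    {W : normedModType (Cplx R)}
    (F : Cplx R * 'rV[Cplx R]_n -> W) (t0 : 'rV[Cplx R]_n) : Prop :=
  exists G : Cplx R * 'rV[Cplx R]_n -> W,
    holomorphic_near ((0, t0) : Cplx R * 'rV[Cplx R]_n) G /\
    (\forall p \near ((0, t0) : Cplx R * 'rV[Cplx R]_n),
       p.1 != 0 -> F (p.1^-1, p.2) = G p).

(* t is fixed; partial derivative along the k-th coordinate of C^n. *)
Definition is_partial {R : realType} {n : nat}
    {W : normedModType (Cplx R)} (k : 'I_n)
    (t : 'rV[Cplx R]_n) (f : 'rV[Cplx R]_n -> W) (df : W) : Prop :=
  is_derive t (delta_mx ord0 k : 'rV[Cplx R]_n) f df.

(* Main.v *)
(** Fix a configuration and let D be the difference of d_k Y Y^-1 and the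
    right-hand side of the deformation equation (without the factor Y).
    Differentiating the system in x_k gives D' = sum_i N_i(D) / (x - x_i), where
    the N_i are affine and, unlike D, free of logarithms.  Along the vector
    that moves x together with x_j the function log (x - x_j) is constant and
    L_j changes by a scalar matrix; the expansion at x_j therefore shows that D
    is continuous at x_j and across the cut near x_j.  The jump of D along the
    cut satisfies a linear differential inequality, so Gronwall makes it vanish
    all along the cut and D is entire.  At infinity D tends to 0 on a
    half-plane; by Gronwall on large circles it is bounded, hence constant by
    Liouville, hence 0.

    Holomorphy is mere differentiability, so Goursat's theorem and Cauchy's
    estimates are needed.  They are obtained without integrals: midpoint sums
    over the boundary of a rectangle are additive under bisection and exact for
    affine functions, which is all that Goursat's argument uses. *)

Require Import Defs.
From HB Require Import structures.
From mathcomp Require Import all_boot all_order all_algebra.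
From mathcomp Require Import complex.
From mathcomp Require Import all_classical all_reals all_analysis.
From mathcomp Require Import ring lra.
Import Order.TTheory GRing.Theory Num.Theory numFieldNormedType.Exports.
Local Open Scope classical_set_scope.
Local Open Scope ring_scope.
Local Open Scope complex_scope.

Set Implicit Arguments.
Unset Strict Implicit.
Unset Printing Implicit Defensive.

(** * Complex derivatives in normed modules *)

Section RealNorm.
Context {R : realType}.
Local Notation K := (Cplx R).

(** The obstacle is the cut: no hypothesis compares its two sides far from the endpoint, and
    continuing [Y] across it would call for an existence theorem for the system. The jump of D is
    therefore treated as an unknown of its own. Both sides obey the same equation with single-valued
    coefficients, so the jump is controlled by its size near the endpoint. This is why the
    logarithms have to leave the equation for D: f_jk log (x - x_j) enters D as a scalar matrix, so
    commutators do not see it, and its derivative in x is rational.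

    The evolution of L_infinity acts at infinity only: there d_k Y Y^-1 behaves like log x times the
    sum of the f_jk, which turns the logarithms of D into the differences log (x - x_j) - log x, and
    these tend to 0.

    At the poles the extended D is only known to be continuous; the means over circles are set up to
    tolerate finitely many such points. The vanishing argument uses of the N_i only a common
    Lipschitz constant, and it is carried out for horizontal cuts, in the coordinate exp (- i theta)
    x. *)

Definition ofR (r : R) : K := r%:C.

Lemma ofRD r s : ofR (r + s) = ofR r + ofR s.
Proof. exact: rmorphD. Qed.

Lemma ofRB r s : ofR (r - s) = ofR r - ofR s.
Proof. exact: rmorphB. Qed.

Lemma ofRM r s : ofR (r * s) = ofR r * ofR s.
Proof. exact: rmorphM. Qed.

Lemma ofR0 : ofR 0 = 0.
Proof. exact: rmorph0. Qed.

Lemma ofR1 : ofR 1 = 1.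
Proof. exact: rmorph1. Qed.

Lemma ofRV r : ofR r^-1 = (ofR r)^-1.
Proof. exact: fmorphV. Qed.

Lemma ofR_nat k : ofR k%:R = k%:R.
Proof. exact: rmorph_nat. Qed.

Lemma ofR_inj : injective ofR.
Proof. by move=> r s []. Qed.

Lemma ofR_eq0 r : (ofR r == 0) = (r == 0).
Proof. by rewrite -ofR0; apply/eqP/eqP => [/ofR_inj|->]. Qed.

Lemma ler_ofR r s : (ofR r <= ofR s) = (r <= s).
Proof. exact: lecR. Qed.

Lemma ltr_ofR r s : (ofR r < ofR s) = (r < s).
Proof. exact: ltcR. Qed.

Lemma ReD (x y : K) : complex.Re (x + y) = complex.Re x + complex.Re y.
Proof. by case: x => ? ?; case: y. Qed.

Lemma ImD (x y : K) : complex.Im (x + y) = complex.Im x + complex.Im y.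
Proof. by case: x => ? ?; case: y. Qed.

Lemma ReN (x : K) : complex.Re (- x) = - complex.Re x.
Proof. by case: x. Qed.

Lemma ImN (x : K) : complex.Im (- x) = - complex.Im x.
Proof. by case: x. Qed.

Lemma ReB (x y : K) : complex.Re (x - y) = complex.Re x - complex.Re y.
Proof. by rewrite ReD ReN. Qed.

Lemma ImB (x y : K) : complex.Im (x - y) = complex.Im x - complex.Im y.
Proof. by rewrite ImD ImN. Qed.

Lemma ReZ r (x : K) : complex.Re (ofR r * x) = r * complex.Re x.
Proof. by case: x => a b /=; rewrite mul0r subr0. Qed.

Lemma ImZ r (x : K) : complex.Im (ofR r * x) = r * complex.Im x.
Proof. by case: x => a b /=; rewrite mul0r addr0. Qed.

Lemma pos_ofR (e : K) : 0 < e -> e = ofR (complex.Re e) /\ 0 < complex.Re e.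
Proof.
move=> e0; have eE : e = ofR (complex.Re e).
  by have := ltW e0; case: (e) => a b; rewrite lecE /= => /andP[/eqP -> _].
by split => //; rewrite -ltr_ofR -eE ofR0.
Qed.

Lemma cplx_eq (x y : K) :
  complex.Re x = complex.Re y -> complex.Im x = complex.Im y -> x = y.
Proof. by case: x => a b; case: y => c d /= -> ->. Qed.

(* The norm of a normed module over C is a nonnegative element of C; rnorm is
   the same norm as a real number. *)
Definition rnorm {W : normedModType K} (w : W) : R := complex.Re `|w|.

Section Generic.
Context {W : normedModType K}.
Implicit Types (v w : W).

Lemma rnormE w : `|w| = ofR (rnorm w).
Proof.
have : 0 <= `|w| by exact: normr_ge0.
by rewrite /rnorm; case: `|w| => a b; rewrite lecE /= => /andP[/eqP -> _].
Qed.

Lemma rnorm_ge0 w : 0 <= rnorm w.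
Proof. by rewrite -ler_ofR -rnormE ofR0. Qed.

Lemma rnormD v w : rnorm (v + w) <= rnorm v + rnorm w.
Proof. by rewrite -ler_ofR ofRD -!rnormE ler_normD. Qed.

Lemma rnormN w : rnorm (- w) = rnorm w.
Proof. by rewrite /rnorm normrN. Qed.

Lemma rnormB v w : rnorm (v - w) <= rnorm v + rnorm w.
Proof. by rewrite -(rnormN w) rnormD. Qed.

Lemma rnormC v w : rnorm (v - w) = rnorm (w - v).
Proof. by rewrite -rnormN opprB. Qed.

Lemma rnorm0 : rnorm (0 : W) = 0.
Proof. by rewrite /rnorm normr0. Qed.

Lemma rnorm_eq0 w : (rnorm w == 0) = (w == 0).
Proof. by rewrite -ofR_eq0 -rnormE normr_eq0. Qed.

Lemma rnorm_gt0 w : (0 < rnorm w) = (w != 0).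
Proof. by rewrite lt0r rnorm_eq0 rnorm_ge0 andbT. Qed.

Lemma rnorm_le0 w : rnorm w <= 0 -> w = 0.
Proof. by move=> h; apply/eqP; rewrite -rnorm_eq0 eq_le h rnorm_ge0. Qed.

Lemma rnormZ (a : K) w : rnorm (a *: w) = rnorm a * rnorm w.
Proof. by apply: ofR_inj; rewrite ofRM -!rnormE normrZ. Qed.

Lemma rnorm_sum (I : Type) (r : seq I) (P : pred I) (F : I -> W) :
  rnorm (\sum_(i <- r | P i) F i) <= \sum_(i <- r | P i) rnorm (F i).
Proof.
elim/big_ind2: _ => [|? ? ? ? h1 h2|//]; first by rewrite rnorm0.
exact: le_trans (rnormD _ _) (lerD h1 h2).
Qed.

Lemma rnorm_tri u v w : rnorm (v - w) <= rnorm (v - u) + rnorm (u - w).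
Proof. by rewrite -[v - w](subrKA u) rnormD. Qed.

Lemma rnorm_sub v w : rnorm v <= rnorm w + rnorm (v - w).
Proof. by rewrite -{1}[v](subrK w) addrC rnormD. Qed.

Lemma rnorm_small0 w : (forall e : R, 0 < e -> rnorm w <= e) -> w = 0.
Proof. by move=> h; apply: rnorm_le0; apply/ler_addgt0Pl => e /h; rewrite addr0. Qed.

End Generic.

Lemma rnormM (x y : K) : rnorm (x * y) = rnorm x * rnorm y.
Proof. by apply: ofR_inj; rewrite ofRM -!rnormE normrM. Qed.

Lemma rnorm1 : rnorm (1 : K) = 1.
Proof. by rewrite /rnorm normr1. Qed.

Lemma rnormV (x : K) : rnorm x^-1 = (rnorm x)^-1.
Proof. by apply: ofR_inj; rewrite ofRV -!rnormE normfV. Qed.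

Lemma rnorm_ofR r : rnorm (ofR r) = `|r|.
Proof.
apply: ofR_inj; rewrite -rnormE /ofR normc_def /= expr0n addr0 sqrtr_sqr.
by [].
Qed.

Lemma rnorm_pos r : 0 <= r -> rnorm (ofR r) = r.
Proof. by move=> h; rewrite rnorm_ofR ger0_norm. Qed.

Lemma rnorm_complex (x : K) :
  rnorm x = Num.sqrt (complex.Re x ^+ 2 + complex.Im x ^+ 2).
Proof. by case: x => a b; rewrite /rnorm normc_def. Qed.

Lemma Re_rnorm (x : K) : `|complex.Re x| <= rnorm x.
Proof.
rewrite rnorm_complex -sqrtr_sqr; apply: ler_wsqrtr.
by rewrite lerDl sqr_ge0.
Qed.

Lemma Im_rnorm (x : K) : `|complex.Im x| <= rnorm x.
Proof.
rewrite rnorm_complex -sqrtr_sqr; apply: ler_wsqrtr.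
by rewrite lerDr sqr_ge0.
Qed.

Lemma rnorm_ReIm (x : K) : rnorm x <= `|complex.Re x| + `|complex.Im x|.
Proof.
rewrite rnorm_complex -[leRHS]ger0_norm ?addr_ge0 // -[leRHS]sqrtr_sqr.
apply: ler_wsqrtr; by rewrite sqrrD !real_normK ?num_real // -addrA lerD2l lerDr mulrn_wge0 ?mulr_ge0.
Qed.

Lemma rnorm_cis (th : R) : rnorm (cis th) = 1.
Proof. by rewrite rnorm_complex /= cos2Dsin2 sqrtr1. Qed.

End RealNorm.

Section ComplexDerivative.
Context {R : realType}.
Local Notation K := (Cplx R).

Definition ccont {V W : normedModType K} (f : V -> W) (x : V) : Prop :=
  forall e : R, 0 < e -> exists2 d : R, 0 < d &
    forall y, rnorm (y - x) < d -> rnorm (f y - f x) <= e.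

(** Stated as a bound on the remainder, with real epsilon and radius: the point y = x needs no
    exception, and all estimates are linear inequalities in an ordered real field. *)
Definition cder {W : normedModType K} (f : K -> W) (x : K) (d : W) : Prop :=
  forall e : R, 0 < e -> exists2 r : R, 0 < r &
    forall y, rnorm (y - x) < r ->
      rnorm (f y - f x - (y - x) *: d) <= e * rnorm (y - x).

Context {W : normedModType K}.
Implicit Types (f g : K -> W) (x : K) (d : W).

Lemma cder_slope f x d : cder f x d -> forall e : R, 0 < e ->
  exists2 r : R, 0 < r & forall y, rnorm (y - x) < r ->
    rnorm (f y - f x) <= (rnorm d + e) * rnorm (y - x).
Proof.
move=> h e /h[r r0 hr]; exists r => // y /hr h1.
have := rnorm_sub (f y - f x) ((y - x) *: d); rewrite rnormZ => h2.
apply: le_trans h2 _; rewrite mulrDl [rnorm (y - x) * _]mulrC.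
by rewrite lerD2l.
Qed.

Lemma cder_ccont f x d : cder f x d -> ccont f x.
Proof.
move=> /cder_slope /(_ 1 ltr01)[r r0 hr] e e0.
have p : 0 < rnorm d + 1 by rewrite ltr_wpDl ?rnorm_ge0.
exists (Num.min r (e / (rnorm d + 1))); first by rewrite lt_min r0 divr_gt0.
move=> y; rewrite lt_min => /andP[/hr h1 h2]; apply: le_trans h1 _.
by rewrite mulrC -ler_pdivlMr // ltW.
Qed.

Lemma cder_eq f g x d : (exists2 r : R, 0 < r & forall y, rnorm (y - x) < r -> f y = g y) ->
  cder f x d -> cder g x d.
Proof.
move=> [r r0 hr] h e /h[s s0 hs]; exists (Num.min r s); first by rewrite lt_min r0.
move=> y; rewrite lt_min => /andP[h1 h2]; rewrite -!hr ?subrr ?rnorm0 //.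
exact: hs.
Qed.

Lemma ccont_eq (V : normedModType K) (f g : V -> W) (x : V) : (exists2 r : R, 0 < r & forall y, rnorm (y - x) < r -> f y = g y) ->
  ccont f x -> ccont g x.
Proof.
move=> [r r0 hr] h e /h[s s0 hs]; exists (Num.min r s); first by rewrite lt_min r0.
move=> y; rewrite lt_min => /andP[h1 h2]; rewrite -!hr ?subrr ?rnorm0 //.
exact: hs.
Qed.

Lemma cder_cst d0 x : cder (fun=> d0) x 0.
Proof.
move=> e e0; exists 1 => // y _.
by rewrite subrr scaler0 subrr rnorm0 mulr_ge0 ?rnorm_ge0 ?ltW.
Qed.

Lemma cderD f g x d d' : cder f x d -> cder g x d' -> cder (fun y => f y + g y) x (d + d').
Proof.
move=> hf hg e e0; have e2 : 0 < e / 2 by rewrite divr_gt0.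
have [r r0 hr] := hf _ e2; have [s s0 hs] := hg _ e2.
exists (Num.min r s); first by rewrite lt_min r0.
move=> y; rewrite lt_min => /andP[/hr h1 /hs h2].
rewrite (_ : _ - _ - _ = (f y - f x - (y - x) *: d) + (g y - g x - (y - x) *: d')); last first.
  by rewrite scalerDr !opprD (addrACA (f y)) (addrACA (f y - f x)).
apply: le_trans (rnormD _ _) _; apply: le_trans (lerD h1 h2) _.
by rewrite -mulrDl -splitr.
Qed.

Lemma cderN f x d : cder f x d -> cder (fun y => - f y) x (- d).
Proof.
move=> h e /h[r r0 hr]; exists r => // y /hr h1.
by rewrite scalerN -!opprD rnormN.
Qed.

Lemma cderB f g x d d' : cder f x d -> cder g x d' -> cder (fun y => f y - g y) x (d - d').
Proof. by move=> h /cderN; apply: cderD. Qed.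

Lemma cder_sum (I : Type) (s : seq I) (F : I -> K -> W) (D : I -> W) x :
  (forall i, cder (F i) x (D i)) ->
  cder (fun y => \sum_(i <- s) F i y) x (\sum_(i <- s) D i).
Proof.
move=> h; elim: s => [|i s ih].
  rewrite big_nil (_ : (fun _ => _) = fun=> 0); first exact: cder_cst.
  by apply/funext => y; rewrite big_nil.
rewrite big_cons (_ : (fun _ => _) = fun y => F i y + \sum_(j <- s) F j y).
  exact: cderD.
by apply/funext => y; rewrite big_cons.
Qed.

End ComplexDerivative.

Section ContinuityOfProducts.
Context {R : realType}.
Local Notation K := (Cplx R).
Context {V W : normedModType K}.
Implicit Types (f g : V -> W) (x : V).

Lemma ccont_cst (w : W) x : ccont (fun=> w) x.
Proof. by move=> e e0; exists 1 => // y _; rewrite subrr rnorm0 ltW. Qed.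

Lemma ccontD f g x : ccont f x -> ccont g x -> ccont (fun y => f y + g y) x.
Proof.
move=> hf hg e e0; have e2 : 0 < e / 2 by rewrite divr_gt0.
have [r r0 hr] := hf _ e2; have [s s0 hs] := hg _ e2.
exists (Num.min r s); first by rewrite lt_min r0.
move=> y; rewrite lt_min => /andP[/hr h1 /hs h2].
by rewrite opprD addrACA [e]splitr (le_trans (rnormD _ _)) ?lerD.
Qed.

Lemma ccontN f x : ccont f x -> ccont (fun y => - f y) x.
Proof. by move=> hf e /hf[r r0 hr]; exists r => // y /hr; rewrite -opprD rnormN. Qed.

Lemma ccontB f g x : ccont f x -> ccont g x -> ccont (fun y => f y - g y) x.
Proof. by move=> h /ccontN; apply: ccontD. Qed.

Lemma ccont_sum (I : Type) (s : seq I) (P : pred I) (F : I -> V -> W) x :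
  (forall i, P i -> ccont (F i) x) -> ccont (fun y => \sum_(i <- s | P i) F i y) x.
Proof.
move=> h; elim: s => [|i s ih].
  rewrite (_ : (fun _ => _) = fun=> 0); first exact: ccont_cst.
  by apply/funext => y; rewrite big_nil.
rewrite (_ : (fun _ => _) =
    fun y => (if P i then F i y else 0) + \sum_(j <- s | P j) F j y).
  by apply: ccontD => //; case: (boolP (P i)) => [/h//|_]; exact: ccont_cst.
by apply/funext => y; rewrite big_cons; case: ifP; rewrite ?add0r.
Qed.

Lemma ccont_comp (U : normedModType K) (h : U -> V) f u :
  ccont h u -> ccont f (h u) -> ccont (fun y => f (h y)) u.
Proof.
move=> hh hf e /hf[r r0 hr]; have r20 : 0 < r / 2 by rewrite divr_gt0.
have [s s0 hs] := hh _ r20; exists s => // y /hs k.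
by apply: hr; apply: le_lt_trans k _; lra.
Qed.

(** Serves both scalar multiplication, with c = 1, and the matrix product, whose constant is the
    inner dimension. *)
Lemma ccont_bilinear {V1 V2 : normedModType K} (B : V1 -> V2 -> W) (c : R)
    (u : V -> V1) (v : V -> V2) x :
  0 <= c -> (forall a b, rnorm (B a b) <= c * rnorm a * rnorm b) ->
  (forall a b b', B a (b - b') = B a b - B a b') ->
  (forall a a' b, B (a - a') b = B a b - B a' b) ->
  ccont u x -> ccont v x -> ccont (fun y => B (u y) (v y)) x.
Proof.
move=> c0 Bn Br Bl hu hv e e0.
have q1 := rnorm_ge0 (v x); have q2 := rnorm_ge0 (u x).
pose M := c * (rnorm (v x) + 1) + c * rnorm (u x) + 1.
have m1 : 0 <= c * (rnorm (v x) + 1) by rewrite mulr_ge0 //; lra.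
have m2 : 0 <= c * rnorm (u x) by rewrite mulr_ge0.
have M0 : 0 < M by rewrite /M; lra.
have e10 : 0 < e / M by rewrite divr_gt0.
have [r r0 hr] := hu _ e10; have [s s0 hs] := hv _ e10; have [t t0 ht] := hv _ ltr01.
exists (Num.min r (Num.min s t)); first by rewrite !lt_min r0 s0.
move=> y; rewrite !lt_min => /and3P[/hr k1 /hs k2 /ht k3].
have -> : B (u y) (v y) - B (u x) (v x) = B (u y - u x) (v y) + B (u x) (v y - v x).
  by rewrite Bl Br addrA subrK.
have k4 : rnorm (v y) <= rnorm (v x) + 1.
  by apply: le_trans (rnorm_sub _ (v x)) _; rewrite lerD2l.
apply: le_trans (rnormD _ _) _.
apply: le_trans (lerD (Bn _ _) (Bn _ _)) _.
apply: le_trans (_ : c * (e / M) * (rnorm (v x) + 1) + c * rnorm (u x) * (e / M) <= _).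
  apply: lerD; last by rewrite ler_wpM2l.
  apply: ler_pM => //; rewrite ?mulr_ge0 ?rnorm_ge0 //.
  exact: ler_wpM2l.
have -> : c * (e / M) * (rnorm (v x) + 1) + c * rnorm (u x) * (e / M) = e / M * (M - 1).
  by rewrite /M; ring.
rewrite -[leRHS](divfK (lt0r_neq0 M0)) ler_wpM2l ?(ltW e10) //; lra.
Qed.

Lemma ccont_scale (a : V -> K) f x : ccont a x -> ccont f x -> ccont (fun y => a y *: f y) x.
Proof.
apply: (ccont_bilinear (B := fun (b : K) (w : W) => b *: w) (c := 1)) => //.
- by move=> k w; rewrite rnormZ mul1r.
- by move=> k w w'; rewrite scalerBr.
- by move=> k k' w; rewrite scalerBl.
Qed.

End ContinuityOfProducts.

Section DerivativeOfProducts.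
Context {R : realType}.
Local Notation K := (Cplx R).
Context {W : normedModType K}.
Implicit Types (f : K -> W) (x : K) (d : W).

Lemma cder_bilinear {V1 V2 : normedModType K} (B : V1 -> V2 -> W) (c : R)
    (u : K -> V1) (v : K -> V2) x du dv :
  0 <= c -> (forall a b, rnorm (B a b) <= c * rnorm a * rnorm b) ->
  (forall a b b', B a (b - b') = B a b - B a b') ->
  (forall a a' b, B (a - a') b = B a b - B a' b) ->
  (forall k a b, B (k *: a) b = k *: B a b) ->
  (forall k a b, B a (k *: b) = k *: B a b) ->
  cder u x du -> cder v x dv ->
  cder (fun y => B (u y) (v y)) x (B du (v x) + B (u x) dv).
Proof.
move=> c0 Bn Br Bl Zl Zr hu hv e e0.
pose M := c * (rnorm (v x) + 1) + c * rnorm (u x) + c * (rnorm du) + 1.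
have M0 : 0 < M by rewrite ltr_wpDl // !addr_ge0 ?mulr_ge0 ?addr_ge0 ?rnorm_ge0.
pose e1 := e / M.
have e10 : 0 < e1 by rewrite divr_gt0.
have [r1 r10 h1] := hu _ e10; have [r2 r20 h2] := hv _ e10.
have m0 : 0 < Num.min e1 1 by rewrite lt_min e10 ltr01.
have [r3 r30 h3] := cder_ccont hv m0.
exists (Num.min r1 (Num.min r2 r3)); first by rewrite !lt_min r10 r20.
move=> y; rewrite !lt_min => /and3P[/h1 k1 /h2 k2 /h3].
rewrite le_min => /andP[k3 k4].
(* The remainder of the product is the remainder of u against v y, a cross term, and the remainder
   of v against u x; the summands of [M] are the bounds of these three. *)
have -> : B (u y) (v y) - B (u x) (v x) - (y - x) *: (B du (v x) + B (u x) dv) =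
    B (u y - u x - (y - x) *: du) (v y) + (y - x) *: B du (v y - v x) +
    B (u x) (v y - v x - (y - x) *: dv).
  rewrite !Bl !Br Zl Zr scalerDr scalerBr opprD !addrA.
  have E : forall p q r s t w : W, p - q - s - t = p - r - w + w - s + r - q - t.
    move=> p q r0 s t w.
    by rewrite subrK [_ - s + r0]addrAC subrK [p - s - q]addrAC.
  exact: E.
have q1 := rnorm_ge0 (v x); have q2 := rnorm_ge0 (u x); have q3 := rnorm_ge0 du.
have q4 := rnorm_ge0 (y - x).
have k5 : rnorm (v y) <= rnorm (v x) + 1.
  by apply: le_trans (rnorm_sub _ (v x)) _; rewrite lerD2l.
apply: le_trans (rnormD _ _) _.
have -> : e * rnorm (y - x) = (c * (e1 * rnorm (y - x)) * (rnorm (v x) + 1) +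
   rnorm (y - x) * (c * rnorm du * e1)) + c * rnorm (u x) * (e1 * rnorm (y - x)) + e1 * rnorm (y - x).
  have -> : e = e1 * M by rewrite divfK ?gt_eqF.
  by rewrite /M; ring.
rewrite -[leLHS]addr0; apply: lerD; last by rewrite mulr_ge0 // ltW.
apply: lerD.
  apply: le_trans (rnormD _ _) _; apply: lerD.
    apply: le_trans (Bn _ _) _; apply: ler_pM => //; rewrite ?mulr_ge0 ?rnorm_ge0 //.
    exact: ler_wpM2l.
  rewrite rnormZ ler_wpM2l //; apply: le_trans (Bn _ _) _.
  by rewrite ler_wpM2l ?mulr_ge0.
by apply: le_trans (Bn _ _) _; rewrite ler_wpM2l ?mulr_ge0.
Qed.

Lemma cder_scale (a : K -> K) f x da d : cder a x da -> cder f x d ->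
  cder (fun y => a y *: f y) x (da *: f x + a x *: d).
Proof.
move=> ha hf; apply: (cder_bilinear (B := fun (b : K) (w : W) => b *: w) (c := 1)) => //.
- by move=> k w; rewrite rnormZ mul1r.
- by move=> k w w'; rewrite scalerBr.
- by move=> k k' w; rewrite scalerBl.
- by move=> k k' w; rewrite scalerA.
- by move=> k k' w; rewrite !scalerA mulrC.
Qed.

Lemma cder_comp (a : K -> K) f x da d : cder a x da -> cder f (a x) d ->
  cder (fun y => f (a y)) x (da *: d).
Proof.
move=> ha hf e e0.
have p1 := rnorm_ge0 d; have p2 := rnorm_ge0 da.
have n1 : 0 < rnorm d + 1 by lra.
have n2 : 0 < rnorm da + 1 by lra.
pose e1 := e / 2 / (rnorm d + 1); pose e2 := e / 2 / (rnorm da + 1).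
have e10 : 0 < e1 by rewrite !divr_gt0.
have e20 : 0 < e2 by rewrite !divr_gt0.
have [r1 r10 h1] := ha _ e10; have [r2 r20 h2] := hf _ e20.
have [r3 r30 h3] := cder_slope ha ltr01.
exists (Num.min r1 (Num.min r3 (r2 / (rnorm da + 1)))).
  by rewrite !lt_min r10 r30 divr_gt0.
move=> y; rewrite !lt_min => /and3P[/h1 k1 /h3 k3 k4].
have k5 : rnorm (a y - a x) < r2.
  by apply: le_lt_trans k3 _; rewrite mulrC -ltr_pdivlMr.
have {}k5 := h2 _ k5.
have q := rnorm_ge0 (y - x).
rewrite -[f (a y) - _](subrK ((a y - a x) *: d)) -addrA.
apply: le_trans (rnormD _ _) _; rewrite [e in leRHS]splitr mulrDl; apply: lerD.
  apply: le_trans k5 _; apply: le_trans (ler_wpM2l (ltW e20) k3) _.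
  by rewrite /e2 mulrA divfK // gt_eqF.
rewrite scalerA -scalerBl rnormZ.
apply: le_trans (ler_wpM2r p1 k1) _.
rewrite mulrAC ler_wpM2r // /e1 mulrAC ler_pdivrMr //.
by rewrite ler_wpM2l ?divr_ge0 ?ltW //; lra.
Qed.

End DerivativeOfProducts.

Section ScalarDerivatives.
Context {R : realType}.
Local Notation K := (Cplx R).
Implicit Types (x a b c : K).

Lemma cder_id x : cder (fun y => y) x 1.
Proof.
move=> e e0; exists 1 => // y _.
by rewrite scaler1 subrr rnorm0 mulr_ge0 ?rnorm_ge0 // ltW.
Qed.

Lemma cder_affine {W : normedModType K} (v w : W) x : cder (fun y => v + y *: w) x w.
Proof.
move=> e e0; exists 1 => // y _.
by rewrite scalerBl opprD addrACA subrr add0r subrr rnorm0 mulr_ge0 ?rnorm_ge0 // ltW.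
Qed.

Lemma cderV x : x != 0 -> cder (fun y => y^-1) x (- (x ^- 2)).
Proof.
move=> x0 e e0.
have X : 0 < rnorm x by rewrite rnorm_gt0.
(* The first bound keeps |y| above |x| / 2; with it the second makes |y - x| / (|x|^2 |y|) at most
   e, and the remainder is (y - x)^2 / (x^2 y). *)
exists (Num.min (rnorm x / 2) (e * rnorm x ^+ 3 / 2)).
  by rewrite lt_min !divr_gt0 ?mulr_gt0 ?exprn_gt0.
move=> y; rewrite lt_min => /andP[h1 h2].
have Y : rnorm x / 2 < rnorm y.
  have := rnorm_sub x y; rewrite rnormC => h3; lra.
have Y0 : 0 < rnorm y by apply: lt_trans Y; rewrite divr_gt0.
have y0 : y != 0 by rewrite -rnorm_gt0.
have -> : y^-1 - x^-1 - (y - x) *: (- x ^- 2) = (y - x) ^+ 2 * (x ^- 2 * y^-1).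
  rewrite /GRing.scale /=; field; by rewrite x0 y0.
have k : rnorm (y - x) <= e * (rnorm x * rnorm x * rnorm y).
  apply: le_trans (ltW h2) _.
  rewrite (_ : _ / 2 = e * (rnorm x * rnorm x * (rnorm x / 2))); last by ring.
  by rewrite !ler_wpM2l ?mulr_ge0 // ltW.
rewrite !expr2 !(rnormM, rnormV) mulrAC.
by rewrite ler_wpM2r ?rnorm_ge0 // -invfM ler_pdivrMr ?mulr_gt0.
Qed.

Lemma cder_pole x a : x != a -> cder (fun y => (y - a)^-1) x (- ((x - a) ^- 2)).
Proof.
move=> xa; have := @cder_comp _ _ (fun y => y - a) (fun y => y^-1) x 1.
rewrite /= => /(_ (- ((x - a) ^- 2))); rewrite scale1r; apply.
  by rewrite -[1]subr0; apply: cderB (cder_id _) (cder_cst _ _).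
by apply: cderV; rewrite subr_eq0.
Qed.

End ScalarDerivatives.

(** * Bisection, mean value and Gronwall inequalities *)

Section Bisection.
Context {R : realType}.

Lemma nested_intervals (u v : nat -> R) :
  (forall k, u k <= v k) -> (forall k, u k <= u k.+1) -> (forall k, v k.+1 <= v k) ->
  exists x, forall k, u k <= x <= v k.
Proof.
move=> uv uS vS.
have um i k : u i <= u (i + k)%N.
  by elim: k => [|k ih]; rewrite ?addn0 // addnS (le_trans ih).
have vm i k : v (i + k)%N <= v i.
  by elim: k => [|k ih]; rewrite ?addn0 // addnS; apply: le_trans (vS _) ih.
have uvm i k : u i <= v k.
  by apply: le_trans (um i k) _; apply: le_trans (uv _) _; rewrite addnC.
have S : has_sup (range u).
  by split; [exists (u 0%N), 0%N|exists (v 0%N) => _ [k _ <-]].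
exists (sup (range u)) => k; apply/andP; split.
  by apply: ub_le_sup; [exact: S.2|exists k].
by apply: ge_sup; [exact: S.1|move=> _ [i _ <-]].
Qed.

Lemma dyadic_small (w e : R) : 0 < e -> exists k : nat, w / 2 ^+ k < e.
Proof.
move=> e0; exists (Num.truncn (w / e)).+1.
rewrite ltr_pdivrMr ?exprn_gt0 // mulrC -ltr_pdivrMr //.
apply: lt_trans (truncnS_gt _) _.
by rewrite -natrX ltr_nat ltn_expl.
Qed.

Variable Q : R -> R -> R -> R -> Prop.

(** The last quarter is the default: when Q fails on the whole and holds on three quarters,
    additivity makes it fail on the fourth. *)
Definition quarter (s : R * R * (R * R)) : R * R * (R * R) :=
  let: ((a, b), (c, d)) := s in
  let m := (a + b) / 2 in let l := (c + d) / 2 in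
  if `[< ~ Q a m c l >] then ((a, m), (c, l)) else
  if `[< ~ Q m b c l >] then ((m, b), (c, l)) else
  if `[< ~ Q a m l d >] then ((a, m), (l, d)) else ((m, b), (l, d)).

(** Cousin's lemma, the form of compactness used throughout. If Q failed, it would fail on nested
    rectangles halved at each step; they shrink to a point (x, y), where the local hypothesis is
    contradicted. *)
Lemma bisection (a0 b0 c0 d0 : R) : a0 <= b0 -> c0 <= d0 ->
  (forall a b c d, Q a ((a + b) / 2) c ((c + d) / 2) -> Q ((a + b) / 2) b c ((c + d) / 2) ->
     Q a ((a + b) / 2) ((c + d) / 2) d -> Q ((a + b) / 2) b ((c + d) / 2) d -> Q a b c d) ->
  (forall x y, a0 <= x <= b0 -> c0 <= y <= d0 -> exists2 e : R, 0 < e &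
     forall a b c d, a0 <= a <= x -> x <= b <= b0 -> c0 <= c <= y -> y <= d <= d0 ->
       b - a < e -> d - c < e -> Q a b c d) ->
  Q a0 b0 c0 d0.
Proof.
move=> ab0 cd0 Qadd Qloc; apply: contrapT => nQ.
pose s k := iter k quarter ((a0, b0), (c0, d0)).
pose a k := (s k).1.1; pose b k := (s k).1.2; pose c k := (s k).2.1; pose d k := (s k).2.2.
have H k : ~ Q (a k) (b k) (c k) (d k).
  elim: k => // k; rewrite /a /b /c /d /s iterS.
  case: (iter k _ _) => [[u v] [w z]] /= ih.
  case: asboolP => //= h1; case: asboolP => //= h2; case: asboolP => //= h3 h4.
  by apply: ih; apply: Qadd => //; exact: contrapT.
have HS k : [\/ a k.+1 = a k /\ b k.+1 = (a k + b k) / 2 |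
                a k.+1 = (a k + b k) / 2 /\ b k.+1 = b k] /\
            [\/ c k.+1 = c k /\ d k.+1 = (c k + d k) / 2 |
                c k.+1 = (c k + d k) / 2 /\ d k.+1 = d k].
  rewrite /a /b /c /d /s iterS; case: (iter k _ _) => [[u v] [w z]] /=.
  by do ![case: ifP => _ /=]; split; by [left|right].
have ab k : a k <= b k /\ c k <= d k.
  elim: k => [|k [h1 h2]] //.
  by have [[[-> ->]|[-> ->]] [[-> ->]|[-> ->]]] := HS k; split; lra.
have wd k : b k - a k = (b0 - a0) / 2 ^+ k /\ d k - c k = (d0 - c0) / 2 ^+ k.
  elim: k => [|k [h1 h2]]; first by rewrite expr0 !divr1.
  rewrite exprSr invfM !mulrA -h1 -h2.
  by have [[[-> ->]|[-> ->]] [[-> ->]|[-> ->]]] := HS k; split; lra.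
have mono k : a k <= a k.+1 /\ b k.+1 <= b k /\ c k <= c k.+1 /\ d k.+1 <= d k.
  have [h1 h2] := ab k.
  by have [[[-> ->]|[-> ->]] [[-> ->]|[-> ->]]] := HS k; split => //; lra.
have [x hx] : exists x, forall k, a k <= x <= b k.
  by apply: nested_intervals => k; [have [] := ab k|have [] := mono k|have [_ []] := mono k].
have [y hy] : exists x, forall k, c k <= x <= d k.
  apply: nested_intervals => k; first by have [] := ab k.
    by have [_ [_ []]] := mono k.
  by have [_ [_ []]] := mono k.
have bds k : [/\ a0 <= a k, b k <= b0, c0 <= c k & d k <= d0].
  elim: k => [|k [h1 h2 h3 h4]]; first by split.
  by have [k1 [k2 [k3 k4]]] := mono k; split; lra.
have [e e0 he] := Qloc x y (hx 0%N) (hy 0%N).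
have [k1 hk1] := dyadic_small (b0 - a0) e0.
have [k2 hk2] := dyadic_small (d0 - c0) e0.
have le2 (w : R) i j : 0 <= w -> w / 2 ^+ (i + j) <= w / 2 ^+ i.
  move=> w0; rewrite ler_wpM2l // lef_pV2 ?posrE ?exprn_gt0 //.
  by rewrite exprD ler_peMr ?exprn_ge0 // exprn_ege1 // ler1n.
have [h1 h2 h3 h4] := bds (k1 + k2)%N; have [h5 h6] := wd (k1 + k2)%N.
apply: (H (k1 + k2)%N); apply: he.
- by rewrite h1; case/andP: (hx (k1 + k2)%N).
- by rewrite h2 andbT; case/andP: (hx (k1 + k2)%N).
- by rewrite h3; case/andP: (hy (k1 + k2)%N).
- by rewrite h4 andbT; case/andP: (hy (k1 + k2)%N).
- by rewrite h5; apply: le_lt_trans hk1; apply: le2; lra.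
- by rewrite h6 addnC; apply: le_lt_trans hk2; apply: le2; lra.
Qed.

End Bisection.

Section IntervalBisection.
Context {R : realType}.

Lemma interval_bisection (Q : R -> R -> Prop) (a0 b0 : R) : a0 <= b0 ->
  (forall a m b, a <= m -> m <= b -> Q a m -> Q m b -> Q a b) ->
  (forall x, a0 <= x <= b0 -> exists2 e : R, 0 < e &
     forall a b, a0 <= a <= x -> x <= b <= b0 -> b - a < e -> Q a b) ->
  Q a0 b0.
Proof.
move=> ab0 Qadd Qloc.
(* The rectangle is degenerate, with second side [0, 0]; the guard restores the order of endpoints
   that the one-dimensional additivity asks for. *)
have := @bisection R (fun a b _ _ => a <= b -> Q a b) a0 b0 0 0 ab0 (lexx _).
apply => //.
  move=> a b c d h1 h2 _ _ h3; apply: (Qadd _ ((a + b) / 2)); rewrite ?h1 ?h2 //; try lra.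
    by apply: h1; lra.
  by apply: h2; lra.
move=> x y hx _; have [e e0 he] := Qloc x hx.
by exists e => // a b _ _ h1 h2 _ _ h3 _ _; apply: he.
Qed.

Local Notation K := (Cplx R).
Context {W : normedModType K}.
Implicit Types (f : K -> W) (z w : K).

Definition segpt z w (s : R) : K := z + ofR s * (w - z).

Lemma segpt_dist z w a b : rnorm (segpt z w b - segpt z w a) = `|b - a| * rnorm (w - z).
Proof. by rewrite /segpt opprD addrACA subrr add0r -mulrBl rnormM -ofRB rnorm_ofR. Qed.

Lemma segpt0 z w : segpt z w 0 = z.
Proof. by rewrite /segpt ofR0 mul0r addr0. Qed.

Lemma segpt1 z w : segpt z w 1 = w.
Proof. by rewrite /segpt ofR1 mul1r subrKC. Qed.

(* The slope over [a, b], a <= s <= b, is read off the two increments from s. *)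
Lemma segpt_slope f z w s d e : cder f (segpt z w s) d -> 0 < e ->
  exists2 r : R, 0 < r & forall a b, a <= s -> s <= b -> b - a < r ->
    rnorm (f (segpt z w b) - f (segpt z w a)) <= (rnorm d + e) * rnorm (w - z) * (b - a).
Proof.
move=> h e0; have [r r0 hr] := cder_slope h e0.
have n0 := rnorm_ge0 (w - z); have n1 : 0 < rnorm (w - z) + 1 by lra.
exists (r / (rnorm (w - z) + 1)); first by rewrite divr_gt0.
move=> a b sa sb; rewrite ltr_pdivlMr // => hab.
have k u : a <= u <= b -> rnorm (segpt z w u - segpt z w s) < r.
  move=> /andP[h1 h2]; rewrite segpt_dist; apply: le_lt_trans hab.
  by apply: ler_pM => //; [rewrite ler_norml|]; lra.
apply: le_trans (rnorm_tri (f (segpt z w s)) _ _) _; rewrite [X in _ + X]rnormC.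
have := hr _ (k b _); have := hr _ (k a _); rewrite !segpt_dist.
rewrite !lexx (le_trans sa sb) (ger0_norm (_ : 0 <= b - s)); last by lra.
rewrite (ler0_norm (_ : a - s <= 0)); last by lra.
move=> /(_ isT) h1 /(_ isT) h2.
rewrite (_ : _ * (b - a) = (rnorm d + e) * ((b - s) * rnorm (w - z)) +
   (rnorm d + e) * (- (a - s) * rnorm (w - z))); last by ring.
exact: lerD.
Qed.

(** The values are vectors, so there is no intermediate slope to pick. With the constant M + e1 the
    inequality holds on short intervals around each parameter and adds up over subdivisions; e1 is
    then let go to 0. *)
Lemma mean_value_ineq f z w (M : R) :
  (forall s, 0 <= s <= 1 -> exists2 d, cder f (segpt z w s) d & rnorm d <= M) ->
  rnorm (f w - f z) <= M * rnorm (w - z).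
Proof.
move=> h; apply/ler_addgt0Pr => e e0.
have n0 := rnorm_ge0 (w - z).
pose e1 := e / (rnorm (w - z) + 1).
have e10 : 0 < e1 by rewrite divr_gt0 //; lra.
have := @interval_bisection (fun a b =>
  rnorm (f (segpt z w b) - f (segpt z w a)) <= (M + e1) * rnorm (w - z) * (b - a)) 0 1 ler01.
rewrite segpt0 segpt1 subr0 mulr1 => hb.
apply: le_trans (hb _ _) _ => {hb}.
- move=> a m b _ _ h1 h2; apply: le_trans (rnorm_tri (f (segpt z w m)) _ _) _.
  by apply: le_trans (lerD h2 h1) _; lra.
- move=> s /h [d hd dM]; have [r r0 hr] := segpt_slope hd e10.
  exists r => // a b /andP[_ h1] /andP[h2 _] h3; apply: le_trans (hr _ _ h1 h2 h3) _.
  apply: ler_wpM2r; first by lra.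
  by apply: ler_wpM2r; rewrite ?lerD2r.
rewrite mulrDl lerD2l /e1 mulrAC ler_pdivrMr; last by lra.
by rewrite ler_wpM2l //; lra.
Qed.

(** The growth factor exp (2 k |w - z| (b - a)) multiplies under subdivision, so a local estimate
    suffices. The spare factor 2 pays for the error of the slope and for replacing f at the tag by f
    at the left end; c > 0 leaves this room even where f vanishes. The local step ends with 1 + u <=
    exp u. *)
Lemma gronwall f z w (k c : R) : 0 < k -> 0 < c ->
  (forall s, 0 <= s <= 1 -> exists2 d, cder f (segpt z w s) d &
     rnorm d <= k * (rnorm (f (segpt z w s)) + c)) ->
  rnorm (f w) + c <= (rnorm (f z) + c) * expR (2 * k * rnorm (w - z)).
Proof.
move=> k0 c0 h; have n0 := rnorm_ge0 (w - z).
have := @interval_bisection (fun a b => rnorm (f (segpt z w b)) + c <=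
  (rnorm (f (segpt z w a)) + c) * expR (2 * k * rnorm (w - z) * (b - a))) 0 1 ler01.
rewrite segpt0 segpt1 subr0 mulr1; apply.
- move=> a m b am mb h1 h2; apply: le_trans h2 _.
  rewrite (_ : _ * (b - a) = 2 * k * rnorm (w - z) * (m - a) + 2 * k * rnorm (w - z) * (b - m)); last by ring.
  by rewrite expRD mulrA ler_wpM2r ?expR_ge0.
- move=> s /h [d hd dM].
  have e10 : 0 < k * c / 2 by rewrite divr_gt0 ?mulr_gt0.
  have e20 : 0 < c / 4 by rewrite divr_gt0.
  have [r r0 hr] := segpt_slope hd e10.
  have [r2 r20 hr2] := cder_ccont hd e20.
  exists (Num.min r (r2 / (rnorm (w - z) + 1))); first by rewrite lt_min r0 divr_gt0 //; lra.
  move=> a b /andP[_ h1] /andP[h2 _]; rewrite lt_min => /andP[h3].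
  rewrite ltr_pdivlMr; last by lra.
  move=> h4; have {}hr := hr _ _ h1 h2 h3.
  have ka : rnorm (f (segpt z w s)) <= rnorm (f (segpt z w a)) + c / 4.
    apply: le_trans (rnorm_sub _ (f (segpt z w a))) _; rewrite lerD2l rnormC.
    apply: hr2; rewrite segpt_dist; apply: le_lt_trans h4.
    by apply: ler_pM => //; [rewrite ler_norml|]; lra.
  have kb := rnorm_sub (f (segpt z w b)) (f (segpt z w a)).
  have ex := expR_ge1Dx (2 * k * rnorm (w - z) * (b - a)).
  have p := rnorm_ge0 (f (segpt z w a)).
  apply: le_trans (ler_wpM2l _ ex); last by lra.
  have q : rnorm d + k * c / 2 <= 2 * k * (rnorm (f (segpt z w a)) + c).
    apply: le_trans (_ : k * (rnorm (f (segpt z w a)) + c / 4 + c) + k * c / 2 <= _).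
      by rewrite lerD2r; apply: le_trans dM _; rewrite ler_wpM2l ?(ltW k0) // lerD2r.
    have : 0 <= k * rnorm (f (segpt z w a)) by rewrite mulr_ge0 // ltW.
    have : 0 < k * c by rewrite mulr_gt0.
    by lra.
  have q2 : (rnorm d + k * c / 2) * rnorm (w - z) * (b - a) <=
     2 * k * (rnorm (f (segpt z w a)) + c) * rnorm (w - z) * (b - a).
    apply: ler_wpM2r; first by lra.
    exact: ler_wpM2r.
  by lra.
Qed.

End IntervalBisection.

(** * Goursat's theorem and means over circles *)

Section ComplexExponential.
Context {R : realType}.
Local Notation K := (Cplx R).
Implicit Types (z w : K).

Lemma real_slope (f : R -> R) (x d : R) : is_derive x 1 f d ->
  forall e : R, 0 < e -> exists2 r : R, 0 < r &
    forall u : R, `|u| < r -> `|f (x + u) - f x - u * d| <= e * `|u|.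
Proof.
move=> [df dfd] e e0.
have : h^-1 *: ((f \o shift x) (h *: (1 : R)) - f x) @[h --> 0^'] --> d.
  by rewrite -dfd; exact: df.
move=> /cvgrPdist_le /(_ e e0); rewrite near_withinE => /nbhs_normP[r /= r0 hr].
exists r => // h hh; have [->|h0] := eqVneq h 0.
  by rewrite addr0 subrr mul0r subrr normr0 mulr0.
have := hr h; rewrite /= sub0r normrN => /(_ hh h0).
rewrite distrC /= => k.
have -> : f (x + h) - f x - h * d = h * (h^-1 *: (f (h *: (1 : R) + x) - f x) - d).
  by rewrite /GRing.scale /= mulr1 mulrBr mulVKf // (addrC x).
by rewrite normrM mulrC ler_wpM2r.
Qed.

Lemma cexpD z w : cexp (z + w) = cexp z * cexp w.
Proof.
rewrite /cexp ReD ImD expRD /cis cosD sinD.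
by apply: cplx_eq => /=; ring.
Qed.

Lemma cexp0 : cexp (0 : K) = 1.
Proof. by rewrite /cexp /cis /= expR0 cos0 sin0 mul1r. Qed.

Lemma cder_cexp0 : cder (@cexp R) 0 1.
Proof.
move=> e e0; have [e1 e10 [e11 e1e]] : exists2 e1 : R, 0 < e1 & e1 <= 1 /\ 9 * e1 <= e.
  exists (Num.min 1 (e / 9)); first by rewrite lt_min ltr01 divr_gt0.
  by rewrite -ler_pdivlMl // [9^-1 * _]mulrC !ge_min !lexx orbT.
have [r1 r10 h1] := real_slope (is_derive_expR 0) e10.
have [r2 r20 h2] := real_slope (is_derive_cos 0) e10.
have [r3 r30 h3] := real_slope (is_derive_sin 0) e10.
exists (Num.min e1 (Num.min r1 (Num.min r2 r3))); first by rewrite !lt_min e10 r10 r20.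
move=> z; rewrite !subr0 !lt_min cexp0 => /and4P[k k1 k2 k3].
have Rz := Re_rnorm z; have Iz := Im_rnorm z.
have {h1} := h1 _ (le_lt_trans Rz k1); have {h2} := h2 _ (le_lt_trans Iz k2).
have {h3} := h3 _ (le_lt_trans Iz k3).
rewrite !add0r expR0 cos0 sin0 oppr0 mulr0 !mulr1 !subr0 !addr0 => h3 h2 h1.
set a := complex.Re z in Rz h1 *; set b := complex.Im z in Iz h2 h3 *.
have n0 := rnorm_ge0 z.
have Rz1 : `|a| <= e1 by apply: le_trans Rz _; rewrite ltW.
have c1 : `|cos b - 1| <= e1 * rnorm z by apply: le_trans h2 _; rewrite ler_wpM2l // ltW.
have c2 : `|sin b - b| <= e1 * rnorm z by apply: le_trans h3 _; rewrite ler_wpM2l // ltW.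
have c3 : `|expR a - 1 - a| <= e1 * rnorm z by apply: le_trans h1 _; rewrite ler_wpM2l // ltW.
have c4 : `|expR a| <= 3.
  rewrite -[expR a](subrK 1) -[expR a - 1](subrK a).
  have := ler_normD (expR a - 1 - a + a) 1; have := ler_normD (expR a - 1 - a) a.
  have : e1 * rnorm z <= 1.
    by rewrite mulr_ile1 // ?(ltW e10) //; apply: le_trans (ltW k) e11.
  by rewrite normr1; lra.
have c5 : `|expR a - 1| <= 2 * e1.
  have := ler_normD (expR a - 1 - a) a; rewrite subrK.
  have : e1 * rnorm z <= e1 * 1.
    by rewrite ler_wpM2l ?(ltW e10) //; apply: le_trans (ltW k) e11.
  lra.
apply: le_trans (rnorm_ReIm _) _; rewrite scaler1.
have -> : complex.Re (cexp z - 1 - z) = expR a * (cos b - 1) + (expR a - 1 - a).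
  by rewrite !ReB /cexp /cis /= -/a -/b; ring.
have -> : complex.Im (cexp z - 1 - z) = expR a * (sin b - b) + (expR a - 1) * b.
  by rewrite !ImB /cexp /cis /= -/a -/b; ring.
apply: le_trans (lerD (ler_normD _ _) (ler_normD _ _)) _; rewrite !normrM.
have E0 : 0 <= e1 * rnorm z by rewrite mulr_ge0 // ltW.
have d1 : `|expR a| * `|cos b - 1| <= 3 * (e1 * rnorm z) by apply: ler_pM.
have d2 : `|expR a| * `|sin b - b| <= 3 * (e1 * rnorm z) by apply: ler_pM.
have d3 : `|expR a - 1| * `|b| <= 2 * e1 * rnorm z by apply: ler_pM.
have : 9 * e1 * rnorm z <= e * rnorm z by rewrite ler_wpM2r.
by lra.
Qed.

Lemma cder_cexp z : cder (@cexp R) z (cexp z).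
Proof.
have := cder_comp (cderB (cder_id z) (cder_cst z z)) (_ : cder (@cexp R) (z - z) 1).
rewrite subrr subr0 scale1r => /(_ cder_cexp0) h.
have := cder_scale (cder_cst (cexp z) z) h; rewrite scale0r add0r.
rewrite /GRing.scale /= mulr1; apply: cder_eq; exists 1 => // y _.
by rewrite -cexpD addrC subrK.
Qed.

Lemma rnorm_cexp z : rnorm (cexp z) = expR (complex.Re z).
Proof.
by rewrite /cexp rnormM rnorm_cis mulr1 (rnorm_ofR (expR _)) ger0_norm ?expR_ge0.
Qed.

End ComplexExponential.

(** * Midpoint sums as discrete contour integrals *)

Section MidpointSums.
Context {R : realType}.
Local Notation K := (Cplx R).
Context {W : normedModType K}.
Implicit Types (phi psi : R -> W) (h : K -> W).

(* Riemann sum of phi over [a, b] with 2 ^ p equal steps, sampled at their midpoints. *)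
Fixpoint midsum (p : nat) phi (a b : R) : W :=
  if p is p'.+1 then midsum p' phi a ((a + b) / 2) + midsum p' phi ((a + b) / 2) b
  else ofR (b - a) *: phi ((a + b) / 2).

Lemma midsumB p phi psi a b :
  midsum p (fun s => phi s - psi s) a b = midsum p phi a b - midsum p psi a b.
Proof.
elim: p a b => [|p ih] a b /=; first by rewrite scalerBr.
by rewrite !ih opprD addrACA.
Qed.

Lemma midsum_affine p (v w : W) a b :
  midsum p (fun s => v + ofR s *: w) a b = ofR (b - a) *: v + ofR ((b ^+ 2 - a ^+ 2) / 2) *: w.
Proof.
elim: p a b => [|p ih] a b /=.
  by rewrite scalerDr scalerA -ofRM; congr (_ + ofR _ *: _); field.
by rewrite !ih addrACA -!scalerDl -!ofRD; congr (ofR _ *: _ + ofR _ *: _); field.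
Qed.

Lemma midsum_bound p phi a b B : a <= b -> (forall s, a <= s <= b -> rnorm (phi s) <= B) ->
  rnorm (midsum p phi a b) <= (b - a) * B.
Proof.
elim: p a b => [|p ih] a b ab hB /=.
  by rewrite rnormZ rnorm_pos ?subr_ge0 // ler_wpM2l ?subr_ge0 // hB //; lra.
apply: le_trans (rnormD _ _) _.
rewrite (_ : (b - a) * B = ((a + b) / 2 - a) * B + (b - (a + b) / 2) * B); last by field.
by apply: lerD; apply: ih; try lra; move=> s hs; apply: hB; lra.
Qed.

Definition pt (s t : R) : K := s +i* t.

(** The contour integral of h dz taken counterclockwise, discretised; [pt 0 1] is the i in dz = i dt
    on the vertical sides. *)
Definition boundary_sum p h (a b c d : R) : W :=
  midsum p (fun s => h (pt s c)) a b + pt 0 1 *: midsum p (fun t => h (pt b t)) c d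
  - midsum p (fun s => h (pt s d)) a b - pt 0 1 *: midsum p (fun t => h (pt a t)) c d.

Lemma ptE s t : pt s t = ofR s + pt 0 1 * ofR t.
Proof. by apply: cplx_eq => /=; ring. Qed.

Lemma boundary_sum_affine p (v w : W) a b c d :
  boundary_sum p (fun z => v + z *: w) a b c d = 0.
Proof.
rewrite /boundary_sum.
have Hh e : (fun s => v + pt s e *: w) = (fun s => (v + (pt 0 1 * ofR e) *: w) + ofR s *: w).
  by apply/funext => s; rewrite ptE addrAC -addrA scalerDl.
have Hv e : (fun s => v + pt e s *: w) = (fun s => (v + ofR e *: w) + ofR s *: (pt 0 1 *: w)).
  by apply/funext => s; rewrite ptE scalerDl addrA scalerA [_ * pt 0 1]mulrC.
rewrite !Hh !Hv !midsum_affine !scalerDr !scalerA -!addrA.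
have E (k1 k2 k3 k4 l1 l2 l3 l4 l5 l6 l7 l8 : K) : k1 + k2 - k3 - k4 = 0 ->
   l1 + l2 + l3 + l4 - l5 - l6 - l7 - l8 = 0 ->
   k1 *: v + (l1 *: w + (l2 *: w + (k2 *: v + (l3 *: w + (l4 *: w +
    (- (k3 *: v + (l5 *: w + l6 *: w)) - (k4 *: v + (l7 *: w + l8 *: w)))))))) = 0.
  move=> kE lE.
  transitivity ((k1 + k2 - k3 - k4) *: v + (l1 + l2 + l3 + l4 - l5 - l6 - l7 - l8) *: w).
    rewrite !(scalerBl, scalerDl) !opprD !addrA.
    by rewrite [LHS](ACl (1*4*7*10*2*3*5*6*8*9*11*12)).
  by rewrite kE lE !scale0r addr0.
apply: E; rewrite ?(ofRM, ofRB, expr2).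
  by ring.
by ring.
Qed.

Lemma boundary_sumB p h1 h2 a b c d : boundary_sum p (fun z => h1 z - h2 z) a b c d =
  boundary_sum p h1 a b c d - boundary_sum p h2 a b c d.
Proof.
rewrite /boundary_sum !midsumB !scalerBr !(opprD, opprK) !addrA.
by rewrite [LHS](ACl (1*3*5*7*2*4*6*8)).
Qed.

(** The identity is exact: an inner side is sampled at the same points by the two quarters that
    share it, with opposite signs. The depth drops by one because a half side carries half of the
    samples. *)
Lemma boundary_sum_quarters p h a b c d :
  let m := (a + b) / 2 in let l := (c + d) / 2 in
  boundary_sum p.+1 h a b c d =
  boundary_sum p h a m c l + boundary_sum p h m b c l +
  boundary_sum p h a m l d + boundary_sum p h m b l d.
Proof.
move=> m l; rewrite /boundary_sum /= -/m -/l !scalerDr !(opprD, opprK) !addrA.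
by rewrite [RHS](ACl (1*5*6*14*11*15*4*12*2*8*9*3*13*7*10*16)) /= !addrK.
Qed.

Lemma boundary_sum_bound p h a b c d B : a <= b -> c <= d ->
  (forall s t, a <= s <= b -> c <= t <= d -> rnorm (h (pt s t)) <= B) ->
  rnorm (boundary_sum p h a b c d) <= 2 * ((b - a) + (d - c)) * B.
Proof.
move=> ab cd hB; rewrite /boundary_sum.
have i1 : rnorm (pt 0 1) = 1 by rewrite rnorm_complex /= expr0n expr1n add0r sqrtr1.
apply: le_trans (rnormB _ _) _; rewrite rnormZ i1 mul1r.
rewrite (_ : 2 * _ * B = (b - a) * B + (d - c) * B + (b - a) * B + (d - c) * B); last by ring.
apply: lerD; last by apply: midsum_bound => // s hs; apply: hB; rewrite ?lexx.
apply: le_trans (rnormB _ _) _.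
apply: lerD; last by apply: midsum_bound => // s hs; apply: hB; rewrite ?lexx ?cd.
apply: le_trans (rnormD _ _) _; rewrite rnormZ i1 mul1r.
by apply: lerD; apply: midsum_bound => // s hs; apply: hB; rewrite ?lexx ?ab.
Qed.

End MidpointSums.

Section Goursat.
Context {R : realType}.
Local Notation K := (Cplx R).
Context {W : normedModType K}.
Implicit Types (h g : K -> W).

Lemma rnorm_pt (s t u v : R) : rnorm (pt s t - pt u v) <= `|s - u| + `|t - v|.
Proof. exact: rnorm_ReIm. Qed.

(** The invariant is a bound by e1 D^2, with D half the perimeter. Near a point it holds because the
    affine tangent contributes 0; it passes from quarters to the whole because 4 (D / 2)^2 = D^2.
    The threshold N absorbs the depth lost at each bisection, and no limit of the sums is ever
    formed. *)
Lemma goursat h (a0 b0 c0 d0 : R) : a0 <= b0 -> c0 <= d0 ->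
  (forall s t, a0 <= s <= b0 -> c0 <= t <= d0 -> exists d, cder h (pt s t) d) ->
  forall e : R, 0 < e -> exists N, forall p, (N <= p)%N ->
    rnorm (boundary_sum p h a0 b0 c0 d0) <= e.
Proof.
move=> ab cd dh e e0.
(* The added 1 keeps S positive for a degenerate rectangle. *)
pose S := (b0 - a0) + (d0 - c0) + 1.
have S0 : 0 < S by rewrite /S; lra.
pose e1 := e / S ^+ 2.
have e10 : 0 < e1 by rewrite divr_gt0 ?exprn_gt0.
have [N hN] : exists N, forall p, (N <= p)%N ->
    rnorm (boundary_sum p h a0 b0 c0 d0) <= e1 * ((b0 - a0) + (d0 - c0)) ^+ 2.
  apply: (bisection (Q := fun a b c d => exists N, forall p, (N <= p)%N ->
    rnorm (boundary_sum p h a b c d) <= e1 * ((b - a) + (d - c)) ^+ 2)) => //.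
  - move=> a b c d [N1 h1] [N2 h2] [N3 h3] [N4 h4].
    exists (maxn N1 (maxn N2 (maxn N3 N4))).+1 => -[//|p].
    rewrite ltnS !geq_max => /and4P[/h1 k1 /h2 k2 /h3 k3 /h4 k4].
    rewrite boundary_sum_quarters.
    apply: le_trans (rnormD _ _) _; apply: le_trans (lerD (rnormD _ _) k4) _.
    apply: le_trans (lerD (lerD (rnormD _ _) k3) (lexx _)) _.
    apply: le_trans (lerD (lerD (lerD k1 k2) (lexx _)) (lexx _)) _.
    rewrite le_eqVlt; apply/orP; left; apply/eqP; by field.
  - move=> x y hx hy; have [d hd] := dh x y hx hy.
    have e20 : 0 < e1 / 2 by rewrite divr_gt0.
    have [r r0 hr] := hd _ e20; exists (r / 2); first by rewrite divr_gt0.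
    move=> a b c d' /andP[_ h1] /andP[h2 _] /andP[_ h3] /andP[h4 _] h5 h6.
    exists 0%N => p _.
    have -> : boundary_sum p h a b c d' = boundary_sum p
        (fun z => h z - ((h (pt x y) - pt x y *: d) + z *: d)) a b c d'.
      by rewrite boundary_sumB boundary_sum_affine subr0.
    set D := (b - a) + (d' - c).
    rewrite (_ : e1 * D ^+ 2 = 2 * D * (e1 / 2 * D)); last by field.
    apply: boundary_sum_bound; try lra.
    move=> s t hs ht.
    have k : rnorm (pt s t - pt x y) <= D.
      apply: le_trans (rnorm_pt _ _ _ _) _; apply: lerD; rewrite ler_norml; lra.
    have kr : rnorm (pt s t - pt x y) < r by apply: le_lt_trans k _; rewrite /D; lra.
    rewrite (_ : _ - _ = h (pt s t) - h (pt x y) - (pt s t - pt x y) *: d).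
      by apply: le_trans (hr _ kr) _; rewrite ler_wpM2l // ltW.
    by rewrite scalerBl !(opprD, opprK) !addrA addrAC.
exists N => p /hN h1; apply: le_trans h1 _.
rewrite /e1 mulrAC ler_pdivrMr ?exprn_gt0 // ler_wpM2l ?(ltW e0) //.
by rewrite lerXn2r ?nnegrE /S //; lra.
Qed.

(** Not divided by 2 pi: on a constant v it equals 2 pi v. *)
Definition circle_mean (p : nat) g (r : R) : W :=
  midsum p (fun t => g (ofR r * cis t)) 0 (2 * pi).

Lemma cexp_pt (s t : R) : cexp (pt s t) = ofR (expR s) * cis t.
Proof. by []. Qed.

Lemma cis_2pi : cis (2 * pi : R) = cis 0.
Proof. by rewrite /cis mulrC mulr_natr cos2pi sin2pi cos0 sin0. Qed.

Lemma pi2_ge0 : 0 <= 2 * pi :> R.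
Proof. by rewrite mulr_ge0 // pi_ge0. Qed.

(** Goursat's theorem for g composed with exp on [ln r0, ln r1] x [0, 2 pi]: the horizontal sides
    cancel by periodicity and the vertical sides become the two circles. *)
Lemma annulus_means g (r0 r1 : R) : 0 < r0 -> r0 <= r1 ->
  (forall z, r0 <= rnorm z <= r1 -> exists d, cder g z d) ->
  forall e : R, 0 < e -> exists N, forall p, (N <= p)%N ->
    rnorm (circle_mean p g r1 - circle_mean p g r0) <= e.
Proof.
move=> r00 r01 dg e e0.
have r10 : 0 < r1 by lra.
have [||s t hs ht|N hN] := @goursat (fun z => g (cexp z)) (ln r0) (ln r1) 0 (2 * pi) _ _ _ e e0.
- by rewrite ler_ln ?posrE.
- exact: pi2_ge0.
- have [|d hd] := dg (cexp (pt s t)).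
    case/andP: hs => h1 h2; rewrite rnorm_cexp /=; apply/andP; split.
      by rewrite -[r0]lnK ?posrE // ler_expR.
    by rewrite -[r1]lnK ?posrE // ler_expR.
  by exists (cexp (pt s t) *: d); apply: cder_comp hd; exact: cder_cexp.
exists N => p /hN; rewrite /boundary_sum.
have -> : (fun s => g (cexp (pt s (2 * pi)))) = (fun s => g (cexp (pt s 0))).
  by apply/funext => s; rewrite !cexp_pt cis_2pi.
have E r : 0 < r -> (fun t => g (cexp (pt (ln r) t))) = (fun t => g (ofR r * cis t)).
  by move=> r_gt0; apply/funext => t; rewrite cexp_pt lnK ?posrE.
rewrite (addrC (midsum p _ (ln r0) _)) addrK -scalerBr rnormZ rnorm_complex /=.
by rewrite expr0n expr1n add0r sqrtr1 mul1r !E.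
Qed.

Lemma circle_mean_bound p g r B :
  (forall t, 0 <= t <= 2 * pi -> rnorm (g (ofR r * cis t)) <= B) ->
  rnorm (circle_mean p g r) <= 2 * pi * B.
Proof.
move=> h; rewrite /circle_mean -[X in X * B]subr0.
by apply: midsum_bound => //; exact: pi2_ge0.
Qed.

Lemma circle_mean_near p g r v B : (forall t, rnorm (g (ofR r * cis t) - v) <= B) ->
  rnorm (circle_mean p g r - ofR (2 * pi) *: v) <= 2 * pi * B.
Proof.
move=> h; rewrite (_ : _ - _ = circle_mean p (fun z => g z - v) r).
  by apply: circle_mean_bound => t _.
rewrite /circle_mean midsumB; congr (_ - _).
have := midsum_affine p v 0 0 (2 * pi); rewrite scaler0 addr0 subr0 => <-.
by congr midsum; apply/funext => t; rewrite scaler0 addr0.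
Qed.

(** Compactness of the circle, through bisection of the interval of angles. *)
Lemma circle_uniform_cont g r : (forall z, rnorm z = r -> ccont g z) -> 0 <= r ->
  forall e : R, 0 < e -> exists2 d : R, 0 < d & forall s, `|s - r| < d ->
    forall t, 0 <= t <= 2 * pi -> rnorm (g (ofR s * cis t) - g (ofR r * cis t)) <= e.
Proof.
move=> cg r0 e e0.
apply: (interval_bisection (Q := fun a b => exists2 d : R, 0 < d & forall s, `|s - r| < d ->
    forall t, a <= t <= b -> rnorm (g (ofR s * cis t) - g (ofR r * cis t)) <= e)).
- exact: pi2_ge0.
- move=> a m b am mb [d1 d10 h1] [d2 d20 h2].
  exists (Num.min d1 d2); first by rewrite lt_min d10.
  move=> s; rewrite lt_min => /andP[k1 k2] t /andP[at_ tb].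
  by have [tm|mt] := leP t m; [apply: h1|apply: h2] => //; apply/andP; split => //; exact: ltW.
- move=> t0 _.
  have n0 : rnorm (ofR r * cis t0) = r by rewrite rnormM rnorm_cis mulr1 rnorm_pos.
  have e20 : 0 < e / 2 by rewrite divr_gt0.
  have [d d0 hd] := cg _ n0 _ e20.
  have d20 : 0 < d / 2 / (r + 1) by rewrite !divr_gt0 //; lra.
  have [d3 d30 hd3] := cder_ccont (cder_cexp (pt 0 t0)) d20.
  exists d3 => // a b /andP[_ h1] /andP[h2 _] h3.
  exists (d / 2); first by rewrite divr_gt0.
  move=> s hs t ht.
  have cisE u : cis u = cexp (pt 0 u) :> K by rewrite cexp_pt expR0 ofR1 mul1r.
  have kc : rnorm (cis t - cis t0 : K) <= d / 2 / (r + 1).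
    rewrite !cisE; apply: hd3; apply: le_lt_trans (rnorm_pt _ _ _ _) _.
    by rewrite subrr normr0 add0r; apply: le_lt_trans h3; rewrite ler_norml; lra.
  have kr : r * rnorm (cis t - cis t0 : K) < d / 2.
    apply: le_lt_trans (ler_wpM2l r0 kc) _.
    rewrite mulrC mulrAC ltr_pdivrMr; last by lra.
    by rewrite ltr_pM2l ?divr_gt0 //; lra.
  have k1 : rnorm (ofR r * cis t - ofR r * cis t0) < d / 2.
    by rewrite -mulrBr rnormM rnorm_pos.
  have k2 : rnorm (ofR s * cis t - ofR r * cis t) < d / 2.
    by rewrite -mulrBl -ofRB rnormM rnorm_cis mulr1 rnorm_ofR.
  apply: le_trans (rnorm_tri (g (ofR r * cis t0)) _ _) _; rewrite [e]splitr.
  apply: lerD; last by rewrite rnormC; apply: hd; lra.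
  apply: hd; apply: le_lt_trans (rnorm_tri (ofR r * cis t) _ _) _; lra.
Qed.

(* Circles through the exceptional points are reached by continuity of the
   means in the radius. *)
Lemma circle_means_const g (E : seq K) (r0 r1 : R) : 0 < r0 -> r0 <= r1 ->
  (forall z, r0 <= rnorm z <= r1 -> ccont g z) ->
  (forall z, r0 <= rnorm z <= r1 -> z \notin E -> exists d, cder g z d) ->
  forall e : R, 0 < e -> exists N, forall p, (N <= p)%N ->
    rnorm (circle_mean p g r1 - circle_mean p g r0) <= e.
Proof.
move=> r00 r01 cg dg.
pose Q a b := forall e : R, 0 < e -> exists N, forall p, (N <= p)%N ->
    rnorm (circle_mean p g b - circle_mean p g a) <= e.
have Qadd a m b : Q a m -> Q m b -> Q a b.
  move=> h1 h2 e e0; have e20 : 0 < e / 2 by rewrite divr_gt0.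
  have [N1 {}h1] := h1 _ e20; have [N2 {}h2] := h2 _ e20.
  exists (maxn N1 N2) => p; rewrite geq_max => /andP[/h1 k1 /h2 k2].
  by apply: le_trans (rnorm_tri (circle_mean p g m) _ _) _; rewrite [e]splitr lerD.
have Qsym a b : Q a b -> Q b a.
  by move=> h e /h[N hN]; exists N => p /hN; rewrite rnormC.
have Qlim s b : r0 <= s <= r1 ->
    (forall d : R, 0 < d -> exists2 u, `|u - s| < d & Q u b) -> Q s b.
  move=> hs h e e0.
  have e20 : 0 < e / 2 by rewrite divr_gt0.
  have e30 : 0 < e / 2 / (2 * pi) by rewrite !divr_gt0 ?mulr_gt0 ?pi_gt0.
  have [||d d0 hd] := @circle_uniform_cont g s _ _ _ e30.
  - by move=> z zs; apply: cg; rewrite zs.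
  - by lra.
  have [u us /(_ _ e20)[N hN]] := h _ d0.
  exists N => p /hN k.
  apply: le_trans (rnorm_tri (circle_mean p g u) _ _) _; rewrite [e]splitr lerD //.
  rewrite /circle_mean -midsumB.
  have -> : e / 2 = (2 * pi - 0) * (e / 2 / (2 * pi)).
    by rewrite subr0 mulrCA mulfV ?mulr1 // gt_eqF // mulr_gt0 ?pi_gt0.
  by apply: midsum_bound => [|t ht]; [exact: pi2_ge0|exact: hd].
(* Near a radius s no exceptional point has a modulus other than s itself. An interval of radii
   around s is therefore cut at s, and each half is handled by annuli that stop short of s. *)
have Efree s : exists2 d : R, 0 < d & forall z, z \in E -> rnorm z != s -> d <= `|rnorm z - s|.
  elim: (E) => [|z l [d d0 hd]]; first by exists 1.
  exists (if rnorm z == s then d else Num.min d `|rnorm z - s|).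
    by case: eqVneq => // h; rewrite lt_min d0 normr_gt0 subr_eq0.
  move=> y; rewrite inE => /predU1P[->|/hd k] ys.
    by rewrite (negbTE ys) ge_min lexx orbT.
  by case: ifP => _; rewrite ?ge_min k.
apply: (interval_bisection (Q := Q)) => //.
  by move=> a m b _ _; exact: Qadd.
move=> s hs; have [d d0 hd] := Efree s.
have free u v : r0 <= u -> u <= v -> v <= r1 -> `|u - s| < d -> `|v - s| < d ->
    (s < u) || (v < s) -> Q u v.
  move=> h1 h2 h3; rewrite !ltr_norml => h4 h5 h6; apply: annulus_means => //; first by lra.
  move=> z hz; apply: dg; first by lra.
  apply/negP => zE; have zs : rnorm z != s by apply/eqP => zs; case/orP: h6; lra.
  have := hd _ zE zs; rewrite leNgt => /negP; apply; rewrite ltr_norml; lra.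
have half x y : 0 < x -> 0 < y -> exists2 u : R, 0 < u & u < x /\ u < y.
  move=> x0 y0; exists (Num.min x y / 2); first by rewrite divr_gt0 // lt_min x0.
  split; rewrite ltr_pdivrMr //; [apply: le_lt_trans (_ : x < _)|apply: le_lt_trans (_ : y < _)];
    rewrite ?ge_min ?lexx ?orbT //; lra.
exists d => // a b /andP[a0 as_] /andP[sb b1] abd.
apply: (Qadd _ s).
  move: as_; rewrite le_eqVlt => /predU1P[->|as_].
    by move=> e e0; exists 0%N => p _; rewrite subrr rnorm0 ltW.
  apply: (Qsym); apply: (Qlim) => // d' d'0.
  have sa : 0 < s - a by lra.
  have [u u0 [u1 u2]] := half _ _ d'0 sa.
  exists (s - u); first by rewrite ltr_norml; lra.
  apply: (Qsym); apply: free; rewrite ?ltr_norml; lra.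
move: sb; rewrite le_eqVlt => /predU1P[->|sb].
  by move=> e e0; exists 0%N => p _; rewrite subrr rnorm0 ltW.
apply: (Qlim) => // d' d'0.
have bs : 0 < b - s by lra.
have [u u0 [u1 u2]] := half _ _ d'0 bs.
exists (s + u); first by rewrite ltr_norml; lra.
by apply: free; rewrite ?ltr_norml; lra.
Qed.

(* The means of (f z - f c) / (z - c) do not depend on the radius and tend to
   f'(c) as it shrinks. *)
Lemma derivative_bound g (E : seq K) c d (r B : R) : 0 < r ->
  cder g c d ->
  (forall z, rnorm (z - c) <= r -> ccont g z) ->
  (forall z, rnorm (z - c) <= r -> z \notin E -> exists d', cder g z d') ->
  (forall t, 0 <= t <= 2 * pi -> rnorm (g (c + ofR r * cis t)) <= B) -> rnorm (g c) <= B ->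
  rnorm d <= 2 * B / r.
Proof.
move=> r0 gcd gc gd gB gcB; apply/ler_addgt0Pr => e e0.
have pi2 : 0 < 2 * pi :> R by rewrite mulr_gt0 ?pi_gt0.
pose q z := z^-1 *: (g (c + z) - g c).
pose e1 := e / 2.
have e10 : 0 < e1 by rewrite divr_gt0.
have e20 : 0 < 2 * pi * e1 by rewrite mulr_gt0.
have [s s0 hs] := gcd _ e10.
have [t t0 [ts tr]] : exists2 t : R, 0 < t & t < s /\ t <= r.
  exists (Num.min (s / 2) r); first by rewrite lt_min r0 divr_gt0.
  by split; [apply: le_lt_trans (_ : s / 2 < s); rewrite ?ge_min ?lexx // ; lra|rewrite ge_min lexx orbT].
have shift z : rnorm (c + z - c) = rnorm z by rewrite addrAC subrr add0r.
have cc z : cder (fun z => c + z) z 1.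
  by have := cder_affine c (1 : K) z; apply: cder_eq; exists 1 => // y _; rewrite /GRing.scale /= mulr1.
have cq z : t <= rnorm z <= r -> ccont q z.
  move=> /andP[h1 h2]; have z0 : z != 0 by rewrite -rnorm_gt0; lra.
  apply: ccont_scale; first exact: cder_ccont (cderV z0).
  apply: ccontB; last exact: ccont_cst.
  by apply: ccont_comp (cder_ccont (cc z)) _; apply: gc; rewrite shift.
have dq z : t <= rnorm z <= r -> z \notin [seq x - c | x <- E] -> exists d', cder q z d'.
  move=> /andP[h1 h2] zE; have z0 : z != 0 by rewrite -rnorm_gt0; lra.
  have [||d' hd'] := gd (c + z); first by rewrite shift.
    apply: contra zE => zE; apply/mapP; exists (c + z) => //.
    by rewrite addrAC subrr add0r.
  eexists; apply: cder_scale (cderV z0) (cderB (cder_comp (cc z) hd') (cder_cst _ _)).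
have [N hN] := circle_means_const t0 tr cq dq e20.
have {}hN := hN _ (leqnn N).
have n1 : rnorm (circle_mean N q t - ofR (2 * pi) *: d) <= 2 * pi * e1.
  apply: circle_mean_near => u.
  have zt : rnorm (ofR t * cis u) = t by rewrite rnormM rnorm_cis mulr1 rnorm_pos // ltW.
  set z := ofR t * cis u in zt *; have z0 : z != 0 by rewrite -rnorm_gt0 zt.
  have := hs (c + z); rewrite shift zt => /(_ ts) k.
  have -> : q z - d = z^-1 *: (g (c + z) - g c - (c + z - c) *: d).
    by rewrite (addrAC c z) subrr add0r scalerBr scalerA mulVf // scale1r.
  by rewrite rnormZ rnormV zt -ler_pdivlMl ?invr_gt0 // invrK mulrC.
have n2 : rnorm (circle_mean N q r) <= 2 * pi * (2 * B / r).
  apply: circle_mean_bound => u hu.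
  have zr : rnorm (ofR r * cis u) = r by rewrite rnormM rnorm_cis mulr1 rnorm_pos // ltW.
  rewrite /q rnormZ rnormV zr mulrC ler_pM2r ?invr_gt0 //.
  apply: le_trans (rnormB _ _) _; rewrite mulr_natl mulr2n lerD //.
  exact: gB.
have := rnorm_tri (circle_mean N q r) (circle_mean N q t) 0; rewrite !subr0 [X in _ <= X + _]rnormC => n3.
have := rnorm_sub (ofR (2 * pi) *: d) (circle_mean N q t).
rewrite rnormC rnormZ rnorm_pos ?pi2_ge0 // => n4.
rewrite -(ler_pM2l pi2).
have -> : 2 * pi * (2 * B / r + e) = 2 * pi * (2 * B / r) + (2 * pi * e1 + 2 * pi * e1).
  by rewrite /e1; field; rewrite gt_eqF.
lra.
Qed.

End Goursat.

(** * Cauchy estimates *)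

Section CauchyEstimates.
Context {R : realType}.
Local Notation K := (Cplx R).
Context {W : normedModType K}.
Implicit Types (f D : K -> W) (c z w : K).

Lemma cauchy_estimate f D c (r B : R) : 0 < r ->
  (forall z, rnorm (z - c) < r -> cder f z (D z)) ->
  (forall z, rnorm (z - c) < r -> rnorm (f z) <= B) ->
  forall z, rnorm (z - c) <= r / 2 -> rnorm (D z) <= 8 * B / r.
Proof.
move=> r0 df fB z hz.
have near y : rnorm (y - z) <= r / 4 -> rnorm (y - c) < r.
  by move=> hy; apply: le_lt_trans (rnorm_tri z _ _) _; lra.
(* A closed disc of radius r / 4 about z stays inside the open disc of radius r about c. *)
rewrite (_ : 8 * B / r = 2 * B / (r / 4)); last by field; rewrite gt_eqF.
apply: (@derivative_bound _ _ f [::] z) => //.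
- by rewrite divr_gt0.
- by apply: df; apply: near; rewrite subrr rnorm0 divr_ge0 // ltW.
- by move=> y /near hy; apply: cder_ccont (df _ hy).
- by move=> y /near hy _; exists (D y); exact: df.
- move=> t _; apply: fB; apply: near; rewrite addrAC subrr add0r rnormM rnorm_cis mulr1.
  by rewrite rnorm_pos // divr_ge0 // ltW.
- by apply: fB; apply: near; rewrite subrr rnorm0 divr_ge0 // ltW.
Qed.

Lemma segpt_ball c z w (s r : R) : 0 <= s <= 1 -> rnorm (z - c) <= r -> rnorm (w - c) <= r ->
  rnorm (segpt z w s - c) <= r.
Proof.
move=> /andP[s0 s1] hz hw.
have -> : segpt z w s - c = ofR (1 - s) * (z - c) + ofR s * (w - c).
  by rewrite /segpt ofRB ofR1; ring.
apply: le_trans (rnormD _ _) _; rewrite !rnormM !rnorm_pos ?subr_ge0 //.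
apply: le_trans (lerD (ler_wpM2l _ hz) (ler_wpM2l _ hw)) _; rewrite ?subr_ge0 //.
by rewrite le_eqVlt; apply/orP; left; apply/eqP; ring.
Qed.

Lemma bounded_lipschitz f D c (r B : R) : 0 < r ->
  (forall z, rnorm (z - c) < r -> cder f z (D z)) ->
  (forall z, rnorm (z - c) < r -> rnorm (f z) <= B) ->
  forall z w, rnorm (z - c) <= r / 2 -> rnorm (w - c) <= r / 2 ->
  rnorm (f w - f z) <= 8 * B / r * rnorm (w - z).
Proof.
move=> r0 df fB z w hz hw; apply: mean_value_ineq => s hs.
have k := segpt_ball hs hz hw.
exists (D (segpt z w s)); first by apply: df; apply: le_lt_trans k _; lra.
exact: cauchy_estimate df fB _ k.
Qed.

Lemma cder_shift f x y d : cder f (x + y) d -> cder (fun z => f (z + y)) x d.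
Proof.
move=> h; rewrite -[d]scale1r; apply: (cder_comp (a := fun z => z + y)) h.
by rewrite -[1]addr0; apply: cderD (cder_id _) (cder_cst _ _).
Qed.

(** Second derivatives are avoided: Cauchy's estimate is applied, on the disc of radius r / 4, to
    the difference f (y + h) - f y, which is itself at most 8 B / r |h|. *)
Lemma derivative_lipschitz f D c (r B : R) : 0 < r ->
  (forall z, rnorm (z - c) < r -> cder f z (D z)) ->
  (forall z, rnorm (z - c) < r -> rnorm (f z) <= B) ->
  forall z, rnorm (z - c) <= r / 4 ->
  rnorm (D z - D c) <= 256 * B / r ^+ 2 * rnorm (z - c).
Proof.
move=> r0 df fB z hz; pose h := z - c.
have r40 : 0 < r / 4 by rewrite divr_gt0.
have := @cauchy_estimate (fun y => f (y + h) - f y) (fun y => D (y + h) - D y) c (r / 4)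
  (8 * B / r * rnorm h) r40.
have sh y : rnorm (y - c) < r / 4 -> rnorm (y + h - c) < r / 2.
  by move=> hy; rewrite addrAC; apply: le_lt_trans (rnormD _ _) _; rewrite /h; lra.
move=> /(_ _ _ c) H; apply: le_trans (_ : 8 * (8 * B / r * rnorm h) / (r / 4) <= _).
  have -> : D z = D (c + h) by rewrite /h addrC subrK.
  apply: H.
  - move=> y hy; apply: cderB.
      by apply: cder_shift; apply: df; apply: lt_trans (sh _ hy) _; lra.
    by apply: df; lra.
  - move=> y hy; rewrite -[X in _ * rnorm X](addKr y) [- y + _]addrC.
    by apply: (bounded_lipschitz r0 df fB); [lra|apply: ltW; exact: sh].
  - by rewrite subrr rnorm0; lra.
rewrite le_eqVlt; apply/orP; left; apply/eqP; rewrite /h; field; by rewrite gt_eqF.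
Qed.

End CauchyEstimates.

(** * Interchange of derivatives in two complex variables *)

Section TwoVariables.
Context {R : realType}.
Local Notation K := (Cplx R).
Context {W : normedModType K}.
Variables (F Fx Ft : K -> K -> W) (x0 : K) (r B : R).
Hypotheses (r0 : 0 < r)
  (dFx : forall x t : K, rnorm (x - x0) < r -> rnorm t < r -> cder (fun y => F y t) x (Fx x t))
  (dFt : forall x t : K, rnorm (x - x0) < r -> rnorm t < r -> cder (F x) t (Ft x t))
  (FB : forall x t : K, rnorm (x - x0) < r -> rnorm t < r -> rnorm (F x t) <= B).

(** Cauchy's estimate in t for F y t - F x t, which is O(|y - x|) uniformly in t; each of the two
    estimates contributes a factor 8 / r. *)
Lemma partial_lipschitz (x y : K) : rnorm (x - x0) <= r / 2 -> rnorm (y - x0) <= r / 2 ->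
  rnorm (Ft y 0 - Ft x 0) <= 64 * B / r ^+ 2 * rnorm (y - x).
Proof.
move=> hx hy; have r_gt0 := r0; have hx' : rnorm (x - x0) < r by lra.
have hy' : rnorm (y - x0) < r by lra.
apply: le_trans (_ : 8 * (8 * B / r * rnorm (y - x)) / r <= _); last first.
  rewrite le_eqVlt; apply/orP; left; apply/eqP; field; by rewrite gt_eqF.
apply: (@cauchy_estimate _ _ (fun t => F y t - F x t) (fun t => Ft y t - Ft x t) 0) => //.
- by move=> t; rewrite subr0 => ht; apply: cderB; apply: dFt.
- move=> t; rewrite subr0 => ht.
  apply: (@bounded_lipschitz _ _ (fun z => F z t) (fun z => Fx z t) x0) => //.
    by move=> z hz; exact: dFx.
  by move=> z hz; exact: FB.
- by rewrite subrr rnorm0; lra.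
Qed.

(** The remainder F x t - F x0 t - (x - x0) Fx x0 t is O(|x - x0|^2) uniformly in t. Cauchy's
    estimate in t gives its t-derivative at 0 the same order, and that derivative is the remainder
    of Ft in x. *)
Lemma mixed_derivative (Fxt : K -> W) :
  (forall t : K, rnorm t < r -> cder (Fx x0) t (Fxt t)) ->
  cder (fun x => Ft x 0) x0 (Fxt 0).
Proof.
move=> dFxt; have r_gt0 := r0.
pose C := 256 * B / r ^+ 2.
have B0 : 0 <= B.
  by apply: le_trans (rnorm_ge0 _) (FB (x := x0) (t := 0) _ _); rewrite ?subrr rnorm0.
have C0 : 0 <= C by apply: divr_ge0; rewrite ?exprn_ge0 ?(ltW r0) ?mulr_ge0 ?ler0n.
have main (x : K) : rnorm (x - x0) <= r / 4 ->
    rnorm (Ft x 0 - Ft x0 0 - (x - x0) *: Fxt 0) <= 8 * C / r * rnorm (x - x0) * rnorm (x - x0).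
  move=> hx.
  have x0r : rnorm (x0 - x0) <= r / 4 by rewrite subrr rnorm0; lra.
  apply: le_trans (_ : 8 * (C * rnorm (x - x0) * rnorm (x - x0)) / r <= _); last first.
    by rewrite le_eqVlt; apply/orP; left; apply/eqP; field; rewrite gt_eqF.
  apply: (@cauchy_estimate _ _ (fun t => F x t - F x0 t - (x - x0) *: Fx x0 t)
     (fun t => Ft x t - Ft x0 t - (x - x0) *: Fxt t) 0) => //.
  - move=> t; rewrite subr0 => ht; apply: cderB.
      by apply: cderB; apply: dFt => //; lra.
    have := cder_scale (cder_cst (x - x0) t) (dFxt _ ht).
    by rewrite scale0r add0r.
  - move=> t; rewrite subr0 => ht.
    have := @mean_value_ineq _ _ (fun y => F y t - y *: Fx x0 t) x0 x (C * rnorm (x - x0)).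
    have E : F x t - x *: Fx x0 t - (F x0 t - x0 *: Fx x0 t) = F x t - F x0 t - (x - x0) *: Fx x0 t.
      by rewrite scalerBl !(opprD, opprK) !addrA (ACl (1*3*2*4)).
    rewrite -E => H; apply: H.
    move=> s hs; have hseg := segpt_ball hs x0r hx.
    exists (Fx (segpt x0 x s) t - Fx x0 t).
      apply: cderB; first by apply: dFx => //; lra.
      have := cder_affine 0 (Fx x0 t) (segpt x0 x s).
      by apply: cder_eq; exists 1 => // y _; rewrite add0r.
    apply: le_trans (_ : C * rnorm (segpt x0 x s - x0) <= _).
      apply: (@derivative_lipschitz _ _ (fun z => F z t) (fun z => Fx z t)) => //.
        by move=> z hz; exact: dFx.
      by move=> z hz; exact: FB.
    rewrite ler_wpM2l //.
    have := segpt_dist x0 x 0 s; rewrite segpt0 subr0 => ->.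
    by case/andP: hs => s0 s1; rewrite ger0_norm // ler_piMl ?rnorm_ge0.
  - by rewrite subrr rnorm0; lra.
clearbody C; move=> e e0; pose C1 := 8 * C / r + 1.
have C10 : 0 < C1 by rewrite /C1 ltr_wpDl // divr_ge0 ?mulr_ge0 ?(ltW r0).
exists (Num.min (r / 4) (e / C1)); first by rewrite lt_min !divr_gt0.
move=> x; rewrite lt_min => /andP[/ltW /main h1 h2]; apply: le_trans h1 _.
rewrite ler_wpM2r ?rnorm_ge0 //.
move: h2; rewrite ltr_pdivlMr // /C1 => h2.
have := rnorm_ge0 (x - x0); lra.
Qed.

End TwoVariables.

Section DirectionalDerivatives.
Context {R : realType}.
Local Notation K := (Cplx R).
Context {V W : normedModType K}.
Implicit Types (F : V -> W) (p v : V).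

Lemma cder_of_is_derive F p v d : is_derive p v F d -> cder (fun t : K => F (p + t *: v)) 0 d.
Proof.
move=> [df dfd] e e0.
have e1 : 0 < ofR e by rewrite -ofR0 ltr_ofR.
have : h^-1 *: ((F \o shift p) (h *: v) - F p) @[h --> 0^'] --> d.
  by rewrite -dfd; exact: df.
move=> /cvgrPdist_le /(_ _ e1); rewrite near_withinE => /nbhs_normP[r /= r0 hr].
have [rE rr0] := pos_ofR r0.
exists (complex.Re r) => // h; rewrite !subr0 scale0r addr0 => hh.
have [->|h0] := eqVneq h 0.
  by rewrite !scale0r addr0 subrr subr0 !rnorm0 mulr0.
have := hr h; rewrite /= sub0r normrN rnormE rE ltr_ofR => /(_ hh h0).
rewrite rnormE ler_ofR => k; rewrite rnormC in k.
have -> : F (p + h *: v) - F p - h *: d = h *: (h^-1 *: (F (h *: v + p) - F p) - d).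
  by rewrite scalerBr scalerA mulfV // scale1r (addrC p).
by rewrite rnormZ mulrC ler_wpM2r ?rnorm_ge0.
Qed.

Lemma is_derive_of_cder F p v d : cder (fun t : K => F (p + t *: v)) 0 d -> is_derive p v F d.
Proof.
move=> H.
suff h : h^-1 *: ((F \o shift p) (h *: v) - F p) @[h --> 0^'] --> d.
  by apply: DeriveDef; [apply/cvg_ex; exists d|exact/cvg_lim].
apply/cvgrPdist_le => e e0; rewrite near_withinE; apply/nbhs_normP.
have [eE ee0] := pos_ofR e0.
have [r r0 hr] := H _ ee0; exists (ofR r); first by rewrite /= -ofR0 ltr_ofR.
move=> h /=; rewrite sub0r normrN rnormE ltr_ofR => hh h0.
have := hr h; rewrite !subr0 scale0r addr0 => /(_ hh) k.
rewrite eE rnormE ler_ofR rnormC.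
have -> : h^-1 *: (F (h *: v + p) - F p) - d = h^-1 *: (F (p + h *: v) - F p - h *: d).
  by rewrite [RHS]scalerBr scalerA mulVf // scale1r (addrC p).
rewrite rnormZ rnormV mulrC ler_pdivrMr //.
by rewrite rnorm_gt0.
Qed.

Lemma nbhs_rnorm (p : V) (P : set V) : (\forall q \near p, P q) ->
  exists2 r : R, 0 < r & forall q, rnorm (q - p) < r -> P q.
Proof.
move=> /nbhs_normP[r /= r0 hr].
have [rE rr0] := pos_ofR r0; exists (complex.Re r) => //.
by move=> q hq; apply: hr; rewrite /= rE distrC rnormE ltr_ofR.
Qed.

Lemma ccont_of_differentiable F p : differentiable F p -> ccont F p.
Proof.
move=> /differentiable_continuous /cvgrPdist_le h e e0.
have e1 : 0 < ofR e by rewrite -ofR0 ltr_ofR.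
have [r r0 hr] := nbhs_rnorm (h _ e1); exists r => // q /hr.
by rewrite rnormE ler_ofR rnormC.
Qed.

Lemma cder_of_differentiable F p v : differentiable F p ->
  cder (fun t : K => F (p + t *: v)) 0 ('d F p v).
Proof.
move=> h; apply: cder_of_is_derive; rewrite -deriveE //.
by apply: DeriveDef => //; exact: diff_derivable.
Qed.

End DirectionalDerivatives.

(** * Fuchsian systems off parallel cuts *)

Section LinearSystem.
Context {R : realType}.
Local Notation K := (Cplx R).
Context {W : normedModType K}.

Lemma convex_ge (m p q u : R) : 0 <= u <= 1 -> m <= p -> m <= q -> m <= p + u * (q - p).
Proof.
move=> /andP[u0 u1] mp mq; rewrite -subr_ge0.
rewrite (_ : _ - m = (1 - u) * (p - m) + u * (q - m)); last by ring.
by rewrite addr_ge0 // mulr_ge0 // subr_ge0.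
Qed.

Lemma convex_le (m p q u : R) : 0 <= u <= 1 -> p <= m -> q <= m -> p + u * (q - p) <= m.
Proof.
move=> hu pm qm; have := @convex_ge (- m) (- p) (- q) u hu.
by rewrite !lerN2 => /(_ pm qm); lra.
Qed.

Lemma convex_norm (m p q u : R) : 0 <= u <= 1 -> `|p| < m -> `|q| < m -> `|p + u * (q - p)| < m.
Proof.
move=> hu pm qm; apply: le_lt_trans (_ : Num.max `|p| `|q| < m); last by rewrite gt_max pm.
rewrite ler_norml; apply/andP; split.
  apply: convex_ge => //; rewrite lerNl le_max.
    by rewrite -(normrN p) ler_norm.
  by rewrite -(normrN q) ler_norm orbT.
by apply: convex_le => //; rewrite le_max ler_norm ?orbT.
Qed.

Lemma convex_neq0 (p q u : R) : 0 <= u <= 1 -> 0 < p * q -> p + u * (q - p) != 0.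
Proof.
move=> hu pq.
have [p0|p0|p0] := ltgtP p 0; last by move: pq; rewrite p0 mul0r ltxx.
  have q0 : q < 0 by rewrite -(nmulr_rgt0 _ p0).
  rewrite lt_eqF //; apply: le_lt_trans (_ : Num.max p q < 0); last by rewrite gt_max p0.
  by apply: convex_le => //; rewrite le_max lexx ?orbT.
have q0 : 0 < q by rewrite -(pmulr_rgt0 _ p0).
rewrite gt_eqF //; apply: lt_le_trans (_ : Num.min p q <= _); first by rewrite lt_min p0.
by apply: convex_ge => //; rewrite ge_min lexx ?orbT.
Qed.

Lemma fin_radius (n : nat) (P : 'I_n -> R -> Prop) :
  (forall i, exists2 d : R, 0 < d & forall d', 0 < d' <= d -> P i d') ->
  exists2 d : R, 0 < d & forall i d', 0 < d' <= d -> P i d'.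
Proof.
move=> h.
have /choice[f hf] : forall i, exists d : R, 0 < d /\ forall d', 0 < d' <= d -> P i d'.
  by move=> i; have [d d0 hd] := h i; exists d.
have f0 i : 0 < f i by have [] := hf i.
have fP i d' : 0 < d' <= f i -> P i d' by have [_] := hf i; exact.
suff [d d0 hd] : exists2 d : R, 0 < d & forall i, d <= f i.
  by exists d => // i d' /andP[h1 h2]; apply: fP; rewrite h1 (le_trans h2).
have : exists2 d : R, 0 < d & forall i, i \in enum 'I_n -> d <= f i.
  elim: (enum 'I_n) => [|i s [d d0 hd]]; first by exists 1.
  exists (Num.min d (f i)); first by rewrite lt_min d0 f0.
  by move=> k; rewrite inE => /predU1P[->|/hd k1]; rewrite ge_min ?lexx ?orbT ?k1.
by move=> [d d0 hd]; exists d => // i; apply: hd; rewrite mem_enum.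
Qed.

Variables (n : nat) (a : 'I_n -> K) (N : 'I_n -> W -> W) (kap : R).
Hypotheses (kap_gt0 : 0 < kap)
  (N_lip : forall i P Q, rnorm (N i P - N i Q) <= kap * rnorm (P - Q)).

Definition vfield (z : K) (P : W) : W := \sum_i (z - a i)^-1 *: N i P.

(** Makes kap c0 absorb the values of the N_i at 0, so that the field has the form k (|P| + c0)
    expected by [gronwall]; the 1 keeps it positive. *)
Let c0 : R := (\sum_i rnorm (N i 0)) / kap + 1.

Let c0_gt0 : 0 < c0.
Proof.
by rewrite ltr_wpDl // divr_ge0 ?(ltW kap_gt0) // sumr_ge0 // => i _; exact: rnorm_ge0.
Qed.

Let N_bound i P : rnorm (N i P) <= kap * (rnorm P + c0).
Proof.
have k0 := kap_gt0.
have h := N_lip i P 0; rewrite subr0 in h.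
have h1 : rnorm (N i 0) <= \sum_j rnorm (N j 0).
  by rewrite (bigD1 i) //= lerDl sumr_ge0 // => j _; exact: rnorm_ge0.
have h2 := rnorm_sub (N i P) (N i 0).
rewrite mulrDr /c0 mulrDr mulr1 [kap * (_ / _)]mulrC divfK ?gt_eqF //; lra.
Qed.

Lemma vfield_bound z P m : 0 < m -> (forall i, m <= rnorm (z - a i)) ->
  rnorm (vfield z P) <= n%:R / m * kap * (rnorm P + c0).
Proof.
move=> m0 hm; apply: le_trans (rnorm_sum _ _ _) _.
apply: le_trans (_ : \sum_(i < n) m^-1 * (kap * (rnorm P + c0)) <= _).
  apply: ler_sum => i _; rewrite rnormZ rnormV; apply: ler_pM; rewrite ?rnorm_ge0 ?invr_ge0 ?rnorm_ge0 //.
  by rewrite lef_pV2 ?posrE // (lt_le_trans m0).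
by rewrite sumr_const card_ord -[leLHS]mulr_natl !mulrA.
Qed.

(** With z and w facing each other across a cut, this is the differential inequality of the jump:
    the inhomogeneous term is proportional to the distance of z and w. *)
Lemma vfield_lip z w P Q m : 0 < m -> (forall i, m <= rnorm (z - a i)) ->
  (forall i, m <= rnorm (w - a i)) ->
  rnorm (vfield z P - vfield w Q) <=
    n%:R / m * kap * (rnorm (P - Q) + rnorm (z - w) / m * (rnorm Q + c0)).
Proof.
move=> m0 hz hw; rewrite /vfield -sumrB; apply: le_trans (rnorm_sum _ _ _) _.
have pz i : 0 < rnorm (z - a i) by rewrite (lt_le_trans m0).
have pw i : 0 < rnorm (w - a i) by rewrite (lt_le_trans m0).
apply: le_trans (_ : \sum_(i < n) m^-1 * (kap * (rnorm (P - Q) + rnorm (z - w) / m * (rnorm Q + c0))) <= _); last first.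
  by rewrite sumr_const card_ord -[leLHS]mulr_natl !mulrA.
apply: ler_sum => i _.
have -> : (z - a i)^-1 *: N i P - (w - a i)^-1 *: N i Q =
    (z - a i)^-1 *: (N i P - N i Q + ((w - z) / (w - a i)) *: N i Q).
  rewrite scalerDr scalerBr scalerA -addrA; congr (_ + _); rewrite -scaleNr -scaleNr -scalerDl.
  congr (_ *: _); field; by rewrite -!rnorm_eq0 !gt_eqF.
rewrite rnormZ rnormV; apply: ler_pM; rewrite ?rnorm_ge0 ?invr_ge0 ?rnorm_ge0 //.
  by rewrite lef_pV2 ?posrE.
apply: le_trans (rnormD _ _) _; rewrite mulrDr; apply: lerD => //.
rewrite rnormZ rnormM rnormV mulrCA; apply: ler_pM; rewrite ?mulr_ge0 ?rnorm_ge0 ?invr_ge0 ?rnorm_ge0 //.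
by rewrite rnormC ler_wpM2l ?rnorm_ge0 // lef_pV2 ?posrE.
Qed.

Variable Psi : K -> W.

(** The cuts are normalised to horizontal rays pointing to the right, endpoints included. *)
Definition off_cuts (z : K) : Prop :=
  forall i, ~ (complex.Im z = complex.Im (a i) /\ complex.Re (a i) <= complex.Re z).

Hypotheses
  (heights : forall i j, i != j -> complex.Im (a i) <> complex.Im (a j))
  (dPsi : forall z, off_cuts z -> cder Psi z (vfield z (Psi z)))
  (near_pole : forall j, exists (F : K -> W), exists2 r : R, 0 < r &
     forall z, rnorm (z - a j) < r -> ccont F z /\ (off_cuts z -> Psi z = F z))
  (near_infinity : forall e : R, 0 < e -> exists rho : R, forall z : K,
     complex.Re z < 0 -> rho < rnorm z -> rnorm (Psi z) <= e)
  (W_complete : forall u : nat -> W,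
     (forall e : R, 0 < e -> exists k, forall p q, (k <= p)%N -> (k <= q)%N -> rnorm (u p - u q) <= e) ->
     exists l, forall e : R, 0 < e -> exists k, forall p, (k <= p)%N -> rnorm (u p - l) <= e).

Definition limit_at (z : K) (v : W) : Prop :=
  forall e : R, 0 < e -> exists2 d : R, 0 < d &
    forall w, off_cuts w -> rnorm (w - z) < d -> rnorm (Psi w - v) <= e.

Lemma height_gap (y : R) : exists2 d : R, 0 < d &
  forall i, complex.Im (a i) <> y -> d <= `|complex.Im (a i) - y|.
Proof.
have [|d d0 hd] := @fin_radius n (fun i d => complex.Im (a i) <> y -> d <= `|complex.Im (a i) - y|).
  move=> i; have [->|/eqP h] := eqVneq (complex.Im (a i)) y; first by exists 1.
  exists `|complex.Im (a i) - y|; first by rewrite normr_gt0 subr_eq0; apply/eqP.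
  by move=> d' /andP[].
by exists d => // i; apply: hd; rewrite d0 lexx.
Qed.

Lemma off_height (y d : R) (z : K) :
  (forall i, complex.Im (a i) <> y -> d <= `|complex.Im (a i) - y|) ->
  complex.Im z != y -> `|complex.Im z - y| < d -> off_cuts z.
Proof.
move=> hd ty td i [/= E _]; move: ty td; rewrite E => /eqP ty.
by rewrite ltNge => /negP; apply; exact: hd.
Qed.

Lemma limit_off z v : off_cuts z -> limit_at z v -> v = Psi z.
Proof.
move=> oz h; apply/eqP; rewrite eq_sym -subr_eq0; apply/eqP; apply: rnorm_small0 => e /h[d d0 hd].
by apply: hd => //; rewrite subrr rnorm0.
Qed.

Lemma limit_of_cauchy z :
  (forall e : R, 0 < e -> exists2 d : R, 0 < d & forall w w', off_cuts w -> off_cuts w' ->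
     rnorm (w - z) < d -> rnorm (w' - z) < d -> rnorm (Psi w - Psi w') <= e) ->
  exists v, limit_at z v.
Proof.
move=> h.
have [g g0 hg] := height_gap (complex.Im z).
(* The points [u k] descend vertically to z. The offset 2 keeps [t k] strictly below the gap g, so
   that none of them meets a cut. *)
pose t (k : nat) : R := g / (k.+2)%:R.
have t0 k : 0 < t k by rewrite divr_gt0.
have tg k : t k < g by rewrite ltr_pdivrMr // ltr_pMr // ltr1n.
pose u k := pt (complex.Re z) (complex.Im z + t k).
have uz k : rnorm (u k - z) = t k.
  rewrite (_ : u k - z = pt 0 (t k)); last by apply: cplx_eq => /=; rewrite ?ReB ?ImB /=; ring.
  by rewrite rnorm_complex /= expr0n add0r sqrtr_sqr gtr0_norm.
have uo k : off_cuts (u k).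
  apply: (off_height hg) => /=; first by rewrite -subr_eq0 addrAC subrr add0r gt_eqF.
  by rewrite addrAC subrr add0r gtr0_norm.
have tsmall d : 0 < d -> exists k, forall p, (k <= p)%N -> t p < d.
  move=> d0; exists (Num.truncn (g / d)) => p hp.
  rewrite /t ltr_pdivrMr // mulrC -ltr_pdivrMr //.
  apply: lt_le_trans (truncnS_gt _) _; rewrite ler_nat; exact: leqW.
have [l hl] : exists l, forall e : R, 0 < e -> exists k, forall p, (k <= p)%N -> rnorm (Psi (u p) - l) <= e.
  apply: W_complete => e /h[d d0 hd]; have [k hk] := tsmall d d0.
  by exists k => p q hp hq; apply: hd; rewrite ?uz; auto.
exists l => e e0; have e20 : 0 < e / 2 by rewrite divr_gt0.
have [d d0 hd] := h _ e20; exists d => // w ow wz.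
have [k1 hk1] := hl _ e20; have [k2 hk2] := tsmall d d0.
apply: le_trans (rnorm_tri (Psi (u (maxn k1 k2))) _ _) _; rewrite [e]splitr lerD //.
  by apply: hd; rewrite ?uz //; apply: hk2; exact: leq_maxr.
by apply: hk1; exact: leq_maxl.
Qed.

(** Two points near c on the same side of the cut are compared by the Lipschitz bound; for points on
    opposite sides one is first reflected in the cut, at the cost of a small jump. Values near c are
    thus Cauchy. *)
Lemma limit_of_jump j c (rho y1 kB : R) (y0 := complex.Im (a j)) (x0 := complex.Re (a j))
    (s := complex.Re c - x0) :
  complex.Im c = y0 -> 0 < y1 -> 0 < rho -> rho < s -> 0 < kB ->
  (forall e : R, 0 < e -> exists2 y2 : R, 0 < y2 & y2 <= y1 /\
     forall x t, rho <= x -> x <= s + 1 -> 0 < t -> t < y2 ->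
       rnorm (Psi (pt (x0 + x) (y0 + t)) - Psi (pt (x0 + x) (y0 - t))) <= e) ->
  (forall x t x' t', rho <= x -> x <= s + 1 -> rho <= x' -> x' <= s + 1 ->
     `|t| < y1 -> `|t'| < y1 -> 0 < t' * t ->
     rnorm (Psi (pt (x0 + x) (y0 + t)) - Psi (pt (x0 + x') (y0 + t'))) <=
       kB * (`|x - x'| + `|t - t'|)) ->
  exists v, limit_at c v.
Proof.
move=> cj y10 rho0 rhos kB0 jump lip.
apply: limit_of_cauchy => e e0.
have e20 : 0 < e / 2 by rewrite divr_gt0.
have [y2 y20 [y21 hy2]] := jump _ e20.
(* Two points within d of c differ by at most 2 d in each coordinate, also after a reflection, so
   [lip] costs at most kB (4 d) <= e / 2. *)
have [d d0 [d1 d2 d3 d4]] : exists2 d : R, 0 < d & [/\ d <= y2, d <= s - rho, d <= 1 & kB * (8 * d) <= e].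
  exists (Num.min (Num.min y2 (s - rho)) (Num.min 1 (e / (8 * kB)))).
    by rewrite !lt_min y20 subr_gt0 rhos ltr01 divr_gt0 ?mulr_gt0.
  split; rewrite ?ge_min ?lexx ?orbT //.
  rewrite (_ : forall x, kB * (8 * x) = x * (8 * kB)); last by move=> x; ring.
  by rewrite -ler_pdivlMr ?mulr_gt0 // !ge_min !lexx !orbT.
exists d => // w w'.
pose xx (z : K) := complex.Re z - x0; pose tt (z : K) := complex.Im z - y0.
have ptE z : z = pt (x0 + xx z) (y0 + tt z) by apply: cplx_eq; rewrite /= addrC subrK.
have coord z : off_cuts z -> rnorm (z - c) < d ->
    [/\ rho <= xx z, xx z <= s + 1, `|tt z| < d, tt z != 0 & `|xx z - s| < d].
  move=> oz hz.
  have k1 := le_lt_trans (Re_rnorm _) hz; have k2 := le_lt_trans (Im_rnorm _) hz.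
  move: k1 k2; rewrite ReB ImB cj => k1 k2.
  have k3 : `|xx z - s| < d by rewrite /xx /s opprB addrA subrK.
  have [k4 k5] : rho <= xx z /\ xx z <= s + 1.
    by move: k3; rewrite ltr_norml => /andP[]; lra.
  split => //; apply/negP => /eqP t0; apply: (oz j); split.
    by apply/eqP; rewrite -subr_eq0 -/y0; apply/eqP.
  by move: k4; rewrite /xx -/x0; lra.
move=> ow ow' /(coord _ ow)[p1 p2 p3 p4 p5] /(coord _ ow')[q1 q2 q3 q4 q5].
have close : `|xx w - xx w'| <= 2 * d.
  by move: p5 q5; rewrite !ltr_norml ler_norml => /andP[? ?] /andP[? ?]; lra.
have tclose : `|tt w - tt w'| <= 2 * d /\ `|tt w + tt w'| <= 2 * d.
  by move: p3 q3; rewrite !ltr_norml !ler_norml => /andP[? ?] /andP[? ?]; lra.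
have kBd u v : u <= 2 * d -> v <= 2 * d -> kB * (u + v) <= e / 2.
  move=> hu hv; apply: le_trans (_ : kB * (4 * d) <= _); last by lra.
  by rewrite ler_wpM2l ?(ltW kB0) //; lra.
have y1w : `|tt w| < y1 by lra.
have y1w' : `|tt w'| < y1 by lra.
rewrite (ptE w) (ptE w').
have [ss|ss] := ltP 0 (tt w' * tt w).
  apply: le_trans (lip _ _ _ _ p1 p2 q1 q2 y1w y1w' ss) _.
  by apply: le_trans (kBd _ _ close tclose.1) _; lra.
have ns : 0 < - tt w' * tt w.
  by rewrite mulNr oppr_gt0 lt_neqAle ss mulf_neq0.
apply: le_trans (rnorm_tri (Psi (pt (x0 + xx w') (y0 - tt w'))) _ _) _.
rewrite [e]splitr; apply: lerD.
  apply: le_trans (lip _ _ _ (- tt w') p1 p2 q1 q2 y1w _ ns) _; first by rewrite normrN.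
  by rewrite opprK; exact: kBd close tclose.2.
have [t0|t0|t0] := ltgtP (tt w') 0; last by rewrite t0 eqxx in q4.
  have := hy2 (xx w') (- tt w') q1 q2; rewrite opprK; apply; first by lra.
  by move: q3; rewrite ltr0_norm //; lra.
rewrite rnormC; apply: hy2 => //.
by move: q3; rewrite gtr0_norm //; lra.
Qed.

(* Both sides of a cut are reached by horizontal segments starting near its
   endpoint, where Psi is continuous; Gronwall's inequality then carries the
   vanishing of the jump along the cut. *)
Lemma limit_on_cut j c : complex.Im c = complex.Im (a j) ->
  complex.Re (a j) < complex.Re c -> exists v, limit_at c v.
Proof.
move=> cj jc; have [F [r r0 hF]] := near_pole j.
set y0 := complex.Im (a j) in cj; set x0 := complex.Re (a j) in jc.
have kap0 := kap_gt0; have cc0 := c0_gt0.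
pose s := complex.Re c - x0; have s0 : 0 < s by rewrite /s; lra.
(* The horizontal segments start at distance rho from the endpoint: inside the disc where [F] is
   continuous, and to the left of c. *)
have [rho rho0 [rhor rhos]] : exists2 rho : R, 0 < rho & rho < r /\ rho < s.
  exists (Num.min r s / 2); first by rewrite divr_gt0 // lt_min r0.
  have h : 0 < Num.min r s by rewrite lt_min r0.
  have h1 : Num.min r s <= r by rewrite ge_min lexx.
  have h2 : Num.min r s <= s by rewrite ge_min lexx orbT.
  lra.
have [g g0 hg] := height_gap y0.
have [m m0 [mrho mg]] : exists2 m : R, 0 < m & m <= rho /\ m <= g / 2.
  exists (Num.min rho (g / 2)); first by rewrite lt_min rho0 divr_gt0.
  by rewrite !ge_min !lexx orbT.
have far (z : K) : x0 + rho <= complex.Re z -> `|complex.Im z - y0| < g / 2 ->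
    forall i, m <= rnorm (z - a i).
  move=> hx hy i; have [Ei|/eqP Ni] := eqVneq (complex.Im (a i)) y0.
    have -> : i = j by apply/eqP; apply/negPn/negP => /heights; apply.
    apply: le_trans (Re_rnorm _); rewrite ReB -/x0.
    by apply: le_trans (ler_norm _); lra.
  apply: le_trans (Im_rnorm _); rewrite ImB distrC.
  have := hg _ Ni; have := ler_distD (complex.Im z) (complex.Im (a i)) y0.
  lra.
have offz (z : K) : complex.Im z != y0 -> `|complex.Im z - y0| < g / 2 -> off_cuts z.
  by move=> h1 h2; apply: (off_height hg) => //; lra.
have sub0 t : y0 + t - y0 = t by rewrite addrAC subrr add0r.
have offt x t : t != 0 -> `|t| < g / 2 -> off_cuts (pt x (y0 + t)).
  move=> t0 tg; apply: (offz (pt x (y0 + t))); rewrite [complex.Im _]/(y0 + t).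
    by rewrite -subr_eq0 sub0.
  by rewrite sub0.
have fart x t : rho <= x -> `|t| < g / 2 -> forall i, m <= rnorm (pt (x0 + x) (y0 + t) - a i).
  move=> hx tg; apply: far; rewrite /= ?sub0 //; lra.
pose k := n%:R / m * kap.
have k0 : 0 < k.
  by rewrite !mulr_gt0 ?invr_gt0 // ltr0n (leq_ltn_trans _ (ltn_ord j)).
pose E := expR (2 * k * (s + 1)).
have E0 : 0 < E by exact: expR_gt0.
pose b : K := pt (x0 + rho) y0.
have bj : rnorm (b - a j) < r.
  apply: le_lt_trans (rnorm_ReIm _) _; rewrite ReB ImB /= -/x0 -/y0 subrr normr0 addr0.
  by rewrite addrAC subrr add0r gtr0_norm.
have [Fb _] := hF _ bj.
have near_b e : 0 < e -> exists2 d : R, 0 < d & forall t, `|t| < d -> t != 0 ->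
    rnorm (Psi (pt (x0 + rho) (y0 + t)) - F b) <= e.
  move=> e0; have [d d0 hd] := Fb _ e0.
  exists (Num.min d (Num.min (g / 2) (r - rho))).
    by rewrite !lt_min d0 divr_gt0 //= subr_gt0.
  move=> t; rewrite !lt_min => /and3P[td tg tr] tn0.
  have tb : rnorm (pt (x0 + rho) (y0 + t) - b) <= `|t|.
    apply: le_trans (rnorm_pt _ _ _ _) _.
    by rewrite subrr normr0 add0r addrAC subrr add0r.
  have near : rnorm (pt (x0 + rho) (y0 + t) - a j) < r.
    rewrite -(subrK b (pt _ _)) -addrA; apply: le_lt_trans (rnormD _ _) _.
    have bj' : rnorm (b - a j) <= rho.
      apply: le_trans (rnorm_ReIm _) _; rewrite ReB ImB /= -/x0 -/y0 subrr normr0 addr0.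
      by rewrite addrAC subrr add0r gtr0_norm.
    lra.
  have [_ ->] := hF _ near; last exact: offt.
  by apply: (hd); apply: le_lt_trans tb td.
have [d1 d10 hd1] := near_b _ ltr01.
(* Near the starting point b the norm of [Psi] is at most |F b| + 1; [E] is the growth over a length
   of at most s + 1. *)
pose Bd := (rnorm (F b) + 1 + c0) * E.
have Fb0 := rnorm_ge0 (F b).
have Bd0 : 0 < Bd by rewrite mulr_gt0 //; lra.
have [y1 y10 [y1g y1d]] : exists2 y1 : R, 0 < y1 & y1 <= g / 2 /\ y1 <= d1.
  exists (Num.min (g / 2) d1); first by rewrite lt_min d10 divr_gt0.
  by rewrite !ge_min !lexx orbT.
have seg x t u : segpt (pt (x0 + rho) t) (pt (x0 + x) t) u = pt (x0 + (rho + u * (x - rho))) t.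
  by rewrite /segpt; apply: cplx_eq; rewrite ?ReD ?ImD ?ReZ ?ImZ ?ReB ?ImB /=; ring.
have seglen x t : rho <= x -> x <= s + 1 -> 2 * k * rnorm (pt (x0 + x) t - pt (x0 + rho) t) <= 2 * k * (s + 1).
  move=> h1 h2; apply: ler_wpM2l; first by rewrite mulr_ge0 // ltW.
  apply: le_trans (rnorm_pt _ _ _ _) _; rewrite subrr normr0 addr0.
  rewrite ger0_norm; lra.
have ubd (x u : R) : rho <= x -> 0 <= u <= 1 -> rho <= rho + u * (x - rho) <= x.
  move=> h1 /andP[h2 h3].
  have q1 : 0 <= u * (x - rho) by apply: mulr_ge0 => //; lra.
  have q2 : u * (x - rho) <= x - rho by apply: ler_piMl => //; lra.
  lra.
have bound x t : rho <= x -> x <= s + 1 -> t != 0 -> `|t| < y1 ->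
    rnorm (Psi (pt (x0 + x) (y0 + t))) + c0 <= Bd.
  move=> h1 h2 h3 h4.
  have tg : `|t| < g / 2 by lra.
  have := @gronwall _ _ Psi (pt (x0 + rho) (y0 + t)) (pt (x0 + x) (y0 + t)) k c0 k0 cc0.
  move=> H; apply: le_trans (H _) _ => {H}.
    move=> u hu; rewrite seg; have /andP[q1 q2] := ubd x u h1 hu.
    exists (vfield (pt (x0 + (rho + u * (x - rho))) (y0 + t)) (Psi (pt (x0 + (rho + u * (x - rho))) (y0 + t)))).
      by apply: dPsi; exact: offt.
    by apply: vfield_bound => //; exact: fart.
  apply: ler_pM; rewrite ?expR_ge0 ?ler_expR ?seglen //.
    by have := rnorm_ge0 (Psi (pt (x0 + rho) (y0 + t))); lra.
  rewrite lerD2r; apply: le_trans (rnorm_sub _ (F b)) _; rewrite lerD2l.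
  by apply: hd1 => //; lra.
clearbody Bd; have jump e : 0 < e -> exists2 y2 : R, 0 < y2 & y2 <= y1 /\ forall x t, rho <= x -> x <= s + 1 ->
    0 < t -> t < y2 -> rnorm (Psi (pt (x0 + x) (y0 + t)) - Psi (pt (x0 + x) (y0 - t))) <= e.
  move=> e0; have e40 : 0 < e / 4 / E by rewrite !divr_gt0.
  have [d d0 hd] := near_b _ e40.
  have M0 : 0 < 4 * Bd * E / m by rewrite !divr_gt0 ?mulr_gt0.
  exists (Num.min y1 (Num.min d (e / (4 * Bd * E / m)))); first by rewrite !lt_min y10 d0 divr_gt0.
  split; first by rewrite ge_min lexx.
  move=> x t h1 h2 t0; rewrite !lt_min => /and3P[ty td]; rewrite ltr_pdivlMr // => te.
  pose q := pt 0 (2 * t).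
  have qE z : pt z (y0 - t) + q = pt z (y0 + t) by apply: cplx_eq => /=; ring.
  have t1 : t != 0 by rewrite gt_eqF.
  have t2 : - t != 0 by rewrite oppr_eq0.
  have tn1 : `|t| < g / 2 by rewrite gtr0_norm //; lra.
  have tn2 : `|- t| < g / 2 by rewrite normrN.
  (* The translation by [q] carries a point below the cut to its mirror image above it. [C] is what
     the moved coefficients add to the inequality for the jump; it is linear in t, so [C] times [E]
     stays below e / 2 for small t. *)
  pose C := 2 * t / m * Bd.
  have C0 : 0 < C by rewrite !mulr_gt0 ?invr_gt0.
  have := @gronwall _ _ (fun z => Psi (z + q) - Psi z) (pt (x0 + rho) (y0 - t)) (pt (x0 + x) (y0 - t)) k C k0 C0.
  rewrite !qE => H.
  have {}H : rnorm (Psi (pt (x0 + x) (y0 + t)) - Psi (pt (x0 + x) (y0 - t))) + C <=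
      (rnorm (Psi (pt (x0 + rho) (y0 + t)) - Psi (pt (x0 + rho) (y0 - t))) + C) * E.
    apply: le_trans (H _) _ => {H}; last first.
      by rewrite ler_wpM2l ?ler_expR ?seglen // addr_ge0 ?rnorm_ge0 // ltW.
    move=> u hu; rewrite seg; have /andP[q1 q2] := ubd x u h1 hu.
    set z := pt _ (y0 - t).
    exists (vfield (z + q) (Psi (z + q)) - vfield z (Psi z)).
      apply: cderB; last by apply: dPsi; exact: offt.
      by apply: cder_shift; rewrite /z qE; apply: dPsi; exact: offt.
    have zq : z + q - z = q by rewrite addrAC subrr add0r.
    have qn : rnorm q = 2 * t.
      by rewrite rnorm_complex /= expr0n add0r sqrtr_sqr gtr0_norm // mulr_gt0.
    have fz : forall i, m <= rnorm (z - a i) by exact: fart.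
    have fzq : forall i, m <= rnorm (z + q - a i) by rewrite /z qE; exact: fart.
    apply: le_trans (vfield_lip _ _ m0 fzq fz) _.
    rewrite zq qn /C ler_wpM2l ?(ltW k0) // lerD2l ler_wpM2l ?divr_ge0 ?mulr_ge0 ?(ltW t0) ?(ltW m0) //.
    by apply: bound => //; [exact: le_trans q2 h2|rewrite normrN gtr0_norm].
  have n1 : rnorm (Psi (pt (x0 + rho) (y0 + t)) - F b) <= e / 4 / E.
    by apply: hd; rewrite ?gt_eqF ?gtr0_norm.
  have n2 : rnorm (Psi (pt (x0 + rho) (y0 - t)) - F b) <= e / 4 / E.
    by apply: hd; rewrite ?oppr_eq0 ?gt_eqF ?normrN ?gtr0_norm.
  have n3 := rnorm_tri (F b) (Psi (pt (x0 + rho) (y0 + t))) (Psi (pt (x0 + rho) (y0 - t))).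
  rewrite [X in _ <= _ + X]rnormC in n3.
  have n4 : (rnorm (Psi (pt (x0 + rho) (y0 + t)) - Psi (pt (x0 + rho) (y0 - t))) + C) * E <=
     (e / 4 / E + e / 4 / E + C) * E.
    by rewrite ler_wpM2r ?(ltW E0) // lerD2r (le_trans n3) // lerD.
  have n5 : (e / 4 / E + e / 4 / E + C) * E = e / 2 + t * (4 * Bd * E / m) / 2.
    by rewrite /C; field; rewrite !gt_eqF.
  lra.
pose kB := k * Bd; have kB0 : 0 < kB by rewrite mulr_gt0.
have lip x t x' t' : rho <= x -> x <= s + 1 -> rho <= x' -> x' <= s + 1 ->
    `|t| < y1 -> `|t'| < y1 -> 0 < t' * t ->
    rnorm (Psi (pt (x0 + x) (y0 + t)) - Psi (pt (x0 + x') (y0 + t'))) <= kB * (`|x - x'| + `|t - t'|).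
  move=> h1 h2 h3 h4 h5 h6 h7.
  have := @mean_value_ineq _ _ Psi (pt (x0 + x') (y0 + t')) (pt (x0 + x) (y0 + t)) kB.
  move=> H; apply: le_trans (H _) _ => {H}; last first.
    rewrite ler_wpM2l ?(ltW kB0) //; apply: le_trans (rnorm_pt _ _ _ _) _.
    have -> : x0 + x - (x0 + x') = x - x' by ring.
    by have -> : y0 + t - (y0 + t') = t - t' by ring.
  move=> u hu.
  have -> : segpt (pt (x0 + x') (y0 + t')) (pt (x0 + x) (y0 + t)) u =
      pt (x0 + (x' + u * (x - x'))) (y0 + (t' + u * (t - t'))).
    by rewrite /segpt; apply: cplx_eq; rewrite ?ReD ?ImD ?ReZ ?ImZ ?ReB ?ImB /=; ring.
  have q1 := convex_ge hu h3 h1; have q2 := convex_le hu h4 h2.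
  have q3 := convex_norm hu h6 h5; have q4 := convex_neq0 hu h7.
  have q5 := lt_le_trans q3 y1g.
  eexists; first by apply: dPsi; exact: offt.
  apply: le_trans (vfield_bound _ m0 (fart _ _ q1 q5)) _.
  by rewrite ler_wpM2l ?(ltW k0) //; exact: bound.
exact: limit_of_jump cj y10 rho0 rhos kB0 jump lip.
Qed.

End LinearSystem.

(** * Extension across the cuts and Liouville's theorem *)

Section Liouville.
Context {R : realType}.
Local Notation K := (Cplx R).
Context {W : normedModType K}.
Variables (n : nat) (a : 'I_n -> K) (N : 'I_n -> W -> W) (kap : R) (Psi : K -> W).
Local Notation off := (off_cuts a).
Hypotheses (kap_gt0 : 0 < kap)
  (N_lip : forall i P Q, rnorm (N i P - N i Q) <= kap * rnorm (P - Q))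
  (heights : forall i j, i != j -> complex.Im (a i) <> complex.Im (a j))
  (dPsi : forall z, off z -> cder Psi z (vfield a N z (Psi z)))
  (near_pole : forall j, exists (F : K -> W), exists2 r : R, 0 < r &
     forall z, rnorm (z - a j) < r -> ccont F z /\ (off z -> Psi z = F z))
  (near_infinity : forall e : R, 0 < e -> exists rho : R, forall z : K,
     complex.Re z < 0 -> rho < rnorm z -> rnorm (Psi z) <= e)
  (W_complete : forall u : nat -> W,
     (forall e : R, 0 < e -> exists k, forall p q, (k <= p)%N -> (k <= q)%N -> rnorm (u p - u q) <= e) ->
     exists l, forall e : R, 0 < e -> exists k, forall p, (k <= p)%N -> rnorm (u p - l) <= e).

Lemma limit_exists z : exists v, limit_at a Psi z v.
Proof.
have [oz|noz] := pselect (off z).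
  exists (Psi z) => e e0; have [d d0 hd] := cder_ccont (dPsi oz) e0.
  by exists d => // w _; exact: hd.
have [j [jz]] : exists j, complex.Im z = complex.Im (a j) /\ complex.Re (a j) <= complex.Re z.
  by apply: contrapT => h; apply: noz => j hj; apply: h; exists j.
rewrite le_eqVlt => /predU1P[jx|jx]; last exact: (limit_on_cut kap_gt0 N_lip heights dPsi near_pole W_complete jz jx).
have -> : z = a j by apply: cplx_eq.
have [F [r r0 hF]] := near_pole j; exists (F (a j)) => e e0.
have [|Fa _] := hF (a j); first by rewrite subrr rnorm0.
have [d d0 hd] := Fa _ e0; exists (Num.min d r); first by rewrite lt_min d0.
by move=> w ow; rewrite lt_min => /andP[h1 h2]; have [_ ->] := hF _ h2; rewrite ?hd.
Qed.

Definition extension : K -> W := projT1 (choice limit_exists).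

Lemma extension_limit z : limit_at a Psi z (extension z).
Proof. exact: (projT2 (choice limit_exists)). Qed.

Lemma extension_off z : off z -> extension z = Psi z.
Proof. by move=> oz; apply: limit_off oz (extension_limit z). Qed.

Lemma vertical_shift z (t : R) : rnorm (z + pt 0 t - z) = `|t|.
Proof. by rewrite addrAC subrr add0r rnorm_complex /= expr0n add0r sqrtr_sqr. Qed.

Lemma off_dense z (d : R) : 0 < d -> exists2 w, off w & rnorm (w - z) < d.
Proof.
move=> d0; have [g g0 hg] := height_gap a (complex.Im z).
pose t := Num.min d g / 2.
have m0 : 0 < Num.min d g by rewrite lt_min d0.
have t0 : 0 < t by rewrite divr_gt0.
have mg : Num.min d g <= g by rewrite ge_min lexx orbT.
have md : Num.min d g <= d by rewrite ge_min lexx.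
exists (z + pt 0 t); last by rewrite vertical_shift gtr0_norm // /t; lra.
have E : complex.Im (z + pt 0 t) - complex.Im z = t by rewrite ImD /= addrAC subrr add0r.
apply: (off_height hg); first by rewrite -subr_eq0 E gt_eqF.
by rewrite E gtr0_norm // /t; lra.
Qed.

Lemma extension_ccont z : ccont extension z.
Proof.
move=> e e0; have e20 : 0 < e / 2 by rewrite divr_gt0.
have [d d0 hd] := extension_limit z e20; exists d => // w wz.
have [d' d'0 hd'] := extension_limit w e20.
have [|v ov hv] := @off_dense w (Num.min d' (d - rnorm (w - z))).
  by rewrite lt_min d'0 subr_gt0.
move: hv; rewrite lt_min => /andP[h1 h2].
apply: le_trans (rnorm_tri (Psi v) _ _) _; rewrite [e]splitr lerD //.
  by rewrite rnormC; exact: hd'.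
apply: hd => //; apply: le_lt_trans (rnorm_tri w _ _) _.
by rewrite -ltrBrDr.
Qed.

Lemma N_ccont i P : ccont (N i) P.
Proof.
move=> e e0; exists (e / kap); first by rewrite divr_gt0.
move=> Q; rewrite ltr_pdivlMr // mulrC => h.
by apply: le_trans (N_lip _ _ _) (ltW h).
Qed.

(** The mean value inequality needs a path off the cuts, so the segment from z to w is lifted
    vertically by a small t. There Psi y - y D has derivative at most e, because the field is
    continuous at z; continuity of the extension then removes the lift. *)
Lemma extension_cder z : (forall i, z != a i) -> cder extension z (vfield a N z (extension z)).
Proof.
move=> za e e0; set D := vfield a N z (extension z).
have cV : ccont (fun w => vfield a N w (extension w)) z.
  apply: ccont_sum => i _; apply: ccont_scale.
    exact: cder_ccont (cder_pole (za i)).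
  by apply: ccont_comp (extension_ccont z) (N_ccont _ _).
have [d1 d10 hd1] := cV _ e0.
have [g g0 hg] := height_gap a (complex.Im z).
pose d := Num.min d1 g.
have d0 : 0 < d by rewrite lt_min d10.
have dd1 : d <= d1 by rewrite ge_min lexx.
have dg : d <= g by rewrite ge_min lexx orbT.
clearbody d; exists (d / 2); first by rewrite divr_gt0.
move=> w wz.
apply/ler_addgt0Pr => e' e'0.
have e'20 : 0 < e' / 2 by rewrite divr_gt0.
have [r1 r10 hr1] := extension_ccont w e'20.
have [r2 r20 hr2] := extension_ccont z e'20.
(* The lift goes to the side of z on which w lies, so the whole lifted segment stays strictly on one
   side of the height of z, the only height in reach at which there can be a cut. *)
have [t [t0 tr1 tr2 td tsign]] : exists t : R, [/\ t != 0, `|t| < r1, `|t| < r2, `|t| < d / 2 &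
    0 <= t * (complex.Im w - complex.Im z)].
  pose t := Num.min r1 (Num.min r2 (d / 2)) / 2.
  have m0 : 0 < Num.min r1 (Num.min r2 (d / 2)) by rewrite !lt_min r10 r20 divr_gt0.
  have t0 : 0 < t by rewrite divr_gt0.
  have tm : t < Num.min r1 (Num.min r2 (d / 2)) by rewrite /t; lra.
  move: tm; rewrite !lt_min => /and3P[q1 q2 q3].
  have [s|s] := leP (complex.Im z) (complex.Im w).
    exists t; rewrite gt_eqF // gtr0_norm //; split => //.
    by rewrite mulr_ge0 ?subr_ge0 // ltW.
  exists (- t); rewrite oppr_eq0 gt_eqF // normrN gtr0_norm //; split => //.
  by rewrite mulNr oppr_ge0 pmulr_rle0 // subr_le0 ltW.
have shift u : rnorm (u + pt 0 t - u) = `|t| by exact: vertical_shift.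
have near s : 0 <= s <= 1 -> rnorm (segpt (z + pt 0 t) (w + pt 0 t) s - z) < d /\
    off (segpt (z + pt 0 t) (w + pt 0 t) s).
  move=> hs.
  have E : segpt (z + pt 0 t) (w + pt 0 t) s - z = ofR s * (w - z) + pt 0 t.
    by rewrite /segpt; ring.
  have n1 : rnorm (segpt (z + pt 0 t) (w + pt 0 t) s - z) < d.
    rewrite E; apply: le_lt_trans (rnormD _ _) _.
    rewrite -[pt 0 t](addrK z) addrC [pt 0 t + z]addrC shift addrC rnormM.
    case/andP: hs => s0 s1; rewrite rnorm_pos //.
    have : s * rnorm (w - z) <= rnorm (w - z) by rewrite ler_piMl ?rnorm_ge0.
    lra.
  split => //; apply: (off_height hg); last first.
    apply: lt_le_trans dg; apply: le_lt_trans n1.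
    by rewrite -ImB; exact: Im_rnorm.
  rewrite -subr_eq0 -ImB E ImD ImZ ImB /=.
  case/andP: hs => s0 s1; apply/eqP => h.
  have : t * (s * (complex.Im w - complex.Im z) + t) = 0 by rewrite h mulr0.
  have q : 0 <= s * (t * (complex.Im w - complex.Im z)) by exact: mulr_ge0.
  rewrite mulrDr mulrCA -expr2 => /eqP; rewrite paddr_eq0 ?sqr_ge0 //.
  by rewrite sqrf_eq0 (negbTE t0) andbF.
have := @mean_value_ineq _ _ (fun y => Psi y - y *: D) (z + pt 0 t) (w + pt 0 t) e.
have E : w + pt 0 t - (z + pt 0 t) = w - z by rewrite opprD addrACA subrr addr0.
have E2 : Psi (w + pt 0 t) - (w + pt 0 t) *: D - (Psi (z + pt 0 t) - (z + pt 0 t) *: D) =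
    Psi (w + pt 0 t) - Psi (z + pt 0 t) - (w - z) *: D.
  rewrite -E scalerBl !(opprD, opprK) !addrA.
  by rewrite (ACl (1*3*2*4)).
rewrite E E2 => H.
have {}H : rnorm (Psi (w + pt 0 t) - Psi (z + pt 0 t) - (w - z) *: D) <= e * rnorm (w - z).
  apply: (H) => s hs; have [n1 os] := near s hs.
  exists (vfield a N (segpt (z + pt 0 t) (w + pt 0 t) s) (Psi (segpt (z + pt 0 t) (w + pt 0 t) s)) - D).
    apply: cderB; first exact: dPsi.
    by have := cder_affine 0 D (segpt (z + pt 0 t) (w + pt 0 t) s); apply: cder_eq; exists 1 => // y _; rewrite add0r.
  by rewrite -extension_off //; apply: hd1; apply: lt_le_trans n1 dd1.
have k1 : rnorm (extension (w + pt 0 t) - extension w) <= e' / 2 by apply: (hr1); rewrite shift.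
have k2 : rnorm (extension (z + pt 0 t) - extension z) <= e' / 2 by apply: (hr2); rewrite shift.
have [|_] := near 0; first by rewrite lexx ler01.
rewrite segpt0 => oz; have [|_] := near 1; first by rewrite lexx ler01.
rewrite segpt1 => ow; rewrite extension_off // in k1; rewrite extension_off // in k2.
rewrite (_ : _ - _ - _ = (Psi (w + pt 0 t) - Psi (z + pt 0 t) - (w - z) *: D) +
   ((Psi (z + pt 0 t) - extension z) - (Psi (w + pt 0 t) - extension w))); last first.
  by rewrite !(opprD, opprK) !addrA [RHS](ACl (7*5*3*1*6*2*4)) /= addrK subrK.
apply: le_trans (rnormD _ _) _; apply: lerD => //.
by apply: le_trans (rnormB _ _) _; rewrite [e']splitr lerD.
Qed.

Lemma poles_bounded c : exists2 M : R, 0 < M & forall i, rnorm (c - a i) <= M.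
Proof.
exists (\sum_i rnorm (c - a i) + 1).
  by rewrite ltr_wpDl // sumr_ge0 // => i _; exact: rnorm_ge0.
move=> i; rewrite (bigD1 i) //= -addrA lerDl addr_ge0 // sumr_ge0 // => j _.
exact: rnorm_ge0.
Qed.

(* In the coordinate u = log (z - c) the system is bounded by a constant vector
   field, so Gronwall's inequality carries the decay on the left half-plane
   around the large circles. *)
Lemma extension_bounded c : exists B r0 : R, 0 < r0 /\ forall r t, r0 <= r -> 0 <= t <= 2 * pi ->
  rnorm (extension (c + ofR r * cis t)) <= B.
Proof.
have kap0 := kap_gt0.
have [M M0 hM] := poles_bounded c.
have [M' M'0 hM'] := poles_bounded 0.
have [rho hrho] := near_infinity ltr01.
have nc := rnorm_ge0 c.
(* On a circle of radius r about c all poles are at distance at least r / 2, and dz = (z - c) du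
   brings a factor r, hence r n kap / (r / 2); the 1 keeps k positive. *)
pose k : R := 2 * n%:R * kap + 1.
have k0 : 0 < k by rewrite /k ltr_wpDl // !mulr_ge0 // ltW.
pose C := (\sum_i rnorm (N i 0)) / kap + 1.
have C0 : 0 < C.
  by rewrite ltr_wpDl // divr_ge0 ?(ltW kap0) // sumr_ge0 // => i _; exact: rnorm_ge0.
exists ((1 + C) * expR (2 * k * pi)), (2 * M + `|rho| + rnorm c + M' + 1).
split; first by rewrite ltr_wpDl // !addr_ge0 // ?mulr_ge0 // ltW.
move=> r t hr ht.
have rho_norm := ler_norm rho; have rn0 := normr_ge0 rho.
have r0 : 0 < r by lra.
have cexpE s : cexp (pt (ln r) s) = ofR r * cis s by rewrite cexp_pt lnK ?posrE.
have seg u : segpt (pt (ln r) pi) (pt (ln r) t) u = pt (ln r) (pi + u * (t - pi)).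
  by rewrite /segpt; apply: cplx_eq; rewrite ?ReD ?ImD ?ReZ ?ImZ ?ReB ?ImB /=; ring.
have circ s i : r / 2 <= rnorm (c + ofR r * cis s - a i).
  have n1 : rnorm (ofR r * cis s) = r by rewrite rnormM rnorm_cis mulr1 rnorm_pos // ltW.
  have -> : c + ofR r * cis s - a i = ofR r * cis s - - (c - a i) by ring.
  have := rnorm_sub (ofR r * cis s) (- (c - a i)); rewrite n1 rnormN.
  have := hM i; lra.
have := @gronwall _ _ (fun u => extension (c + cexp u)) (pt (ln r) pi) (pt (ln r) t) k C k0 C0.
rewrite !cexpE => H.
have {}H := H _; apply: le_trans (_ : rnorm (extension (c + ofR r * cis t)) + C <= _).
  by rewrite lerDl ltW.
apply: le_trans (H _) _ => {H}.
  move=> u _; rewrite seg cexpE.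
  set z := c + _; have cz i : r / 2 <= rnorm (z - a i) by exact: circ.
  exists (cexp (pt (ln r) (pi + u * (t - pi))) *: vfield a N z (extension z)).
    apply: (cder_comp (a := fun u => c + cexp u)).
      by rewrite -[cexp _]add0r; apply: cderD (cder_cst _ _) (cder_cexp _).
    rewrite cexpE; apply: extension_cder => i.
    by rewrite -subr_eq0 -rnorm_gt0; apply: lt_le_trans (cz i); rewrite divr_gt0.
  rewrite rnormZ cexpE rnormM rnorm_cis mulr1 rnorm_pos ?(ltW r0) //.
  have r20 : 0 < r / 2 by rewrite divr_gt0.
  have := vfield_bound kap_gt0 N_lip (extension z) r20 cz; rewrite -/C => h.
  apply: le_trans (ler_wpM2l (ltW r0) h) _.
  rewrite (_ : forall x, r * (n%:R / (r / 2) * kap * x) = 2 * n%:R * kap * x); last first.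
    by move=> x; field; rewrite gt_eqF.
  apply: ler_wpM2r; last by rewrite lerDl.
  by apply: addr_ge0; [exact: rnorm_ge0|exact: ltW].
apply: ler_pM; rewrite ?expR_ge0 //.
  by apply: addr_ge0; [exact: rnorm_ge0|exact: ltW].
  (* The angle pi gives the point c - r: left of every pole, hence off the cuts, and in the region
     of decay. Every other angle in [0, 2 pi] is at most pi away. *)
  have cispi : ofR r * cis pi = - ofR r.
    by rewrite /cis cospi sinpi; apply: cplx_eq => /=; ring.
  rewrite cispi lerD2r extension_off; last first.
    move=> i [_]; rewrite ReB /= => h.
    have := Re_rnorm (c - a i); rewrite ReB; have := hM i.
    have := ler_norm (complex.Re c - complex.Re (a i)).
    have := ler_norm (- (complex.Re c - complex.Re (a i))); rewrite normrN; lra.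
  apply: hrho.
    rewrite ReB /=; have := Re_rnorm c; have := ler_norm (complex.Re c); lra.
  have := rnorm_sub (ofR r) c; rewrite rnorm_pos ?(ltW r0) // rnormC; lra.
rewrite ler_expR ler_wpM2l ?mulr_ge0 ?(ltW k0) //.
apply: le_trans (rnorm_pt _ _ _ _) _; rewrite subrr normr0 add0r ler_norml.
by have := ltW (pi_gt0 R); lra.
Qed.

(** Cauchy's bound 2 B / r on circles about c, with B independent of r; the poles are the
    exceptional points of [derivative_bound]. *)
Lemma extension_derivative0 c : (forall i, c != a i) -> vfield a N c (extension c) = 0.
Proof.
move=> ca; apply: rnorm_small0 => e e0.
have [B [r0 [r00 hB]]] := extension_bounded c.
pose B' := Num.max B (rnorm (extension c)).
have B'0 : 0 <= B' by rewrite le_max rnorm_ge0 orbT.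
pose r := Num.max r0 (2 * B' / e + 1).
have rr0 : r0 <= r by rewrite le_max lexx.
have r_gt0 : 0 < r by lra.
have := @derivative_bound _ _ extension [seq a i | i <- enum 'I_n] c (vfield a N c (extension c)) r B' r_gt0.
move=> H; apply: le_trans (H _ _ _ _ _) _ => {H}.
- exact: extension_cder.
- by move=> z _; exact: extension_ccont.
- move=> z _ zE; exists (vfield a N z (extension z)); apply: extension_cder => i.
  by apply: contra zE => /eqP ->; apply/mapP; exists i; rewrite ?mem_enum.
- by move=> t ht; apply: le_trans (hB _ _ rr0 ht) _; rewrite le_max lexx.
- by rewrite le_max lexx orbT.
have h : 2 * B' / e + 1 <= r by rewrite le_max lexx orbT.
have : 2 * B' / e <= r by lra.
by rewrite !ler_pdivrMr // [r * e]mulrC.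
Qed.

(** The leftward half-line from a point off the cuts never meets a cut. [Psi] is constant along it,
    and it runs into the region of decay. *)
Theorem linear_system_zero z : off z -> Psi z = 0.
Proof.
move=> oz; apply: rnorm_small0 => e e0.
have [rho hrho] := near_infinity e0.
pose s := `|rho| + 2 * rnorm z + 1.
have nz := rnorm_ge0 z; have rn0 := normr_ge0 rho; have rl := ler_norm rho.
have s0 : 0 < s by rewrite /s; lra.
have left_off u : 0 <= u -> off (z - ofR u).
  move=> u0 i [h1 h2]; apply: (oz i); split.
    by rewrite -h1 ImB /= subr0.
  by apply: le_trans h2 _; rewrite ReB /= lerBlDr lerDl.
have := @mean_value_ineq _ _ Psi z (z - ofR s) 0.
rewrite mul0r => H.
have /rnorm_le0/eqP : rnorm (Psi (z - ofR s) - Psi z) <= 0.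
  apply: H => u /andP[u0 u1].
  have -> : segpt z (z - ofR s) u = z - ofR (u * s) by rewrite /segpt ofRM; ring.
  have ou : off (z - ofR (u * s)) by apply: left_off; rewrite mulr_ge0 // ltW.
  exists (vfield a N (z - ofR (u * s)) (Psi (z - ofR (u * s)))); first exact: dPsi.
  rewrite -(extension_off ou) extension_derivative0 ?rnorm0 // => i.
  by apply/eqP => E; apply: (ou i); rewrite E.
rewrite subr_eq0 => /eqP <-; apply: hrho.
  rewrite ReB /=; have := Re_rnorm z; have := ler_norm (complex.Re z); rewrite /s; lra.
have := rnorm_sub (ofR s) z; rewrite rnorm_pos ?(ltW s0) // rnormC /s; lra.
Qed.

End Liouville.

(** * Matrix norms and the matrix exponential *)

Section Caratheodory.
Context {R : realType}.
Local Notation K := (Cplx R).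
Context {W : normedModType K}.

(** Caratheodory's form of differentiability. It reduces the derivative of the matrix inverse to the
    continuity of the inverse. *)
Lemma cder_slope_function (f : K -> W) x d : cder f x d ->
  exists phi : K -> W, [/\ ccont phi x, phi x = d & forall y, f y - f x = (y - x) *: phi y].
Proof.
move=> h; exists (fun y => if y == x then d else (y - x)^-1 *: (f y - f x)).
split; last 2 first.
- by rewrite eqxx.
- move=> y; case: eqVneq => [->|yx]; first by rewrite !subrr scale0r.
  by rewrite scalerA mulfV ?subr_eq0 // scale1r.
move=> e e0; have [r r0 hr] := h _ e0; exists r => // y /hr; rewrite eqxx.
case: eqVneq => [_ _|yx k]; first by rewrite subrr rnorm0 ltW.
have yx0 : y - x != 0 by rewrite subr_eq0.
have -> : (y - x)^-1 *: (f y - f x) - d = (y - x)^-1 *: (f y - f x - (y - x) *: d).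
  by rewrite [RHS]scalerBr scalerA mulVf // scale1r.
by rewrite rnormZ rnormV mulrC ler_pdivrMr ?rnorm_gt0.
Qed.

Lemma cder_of_slope (f phi : K -> W) x : ccont phi x ->
  (exists2 r : R, 0 < r & forall y, rnorm (y - x) < r -> f y - f x = (y - x) *: phi y) ->
  cder f x (phi x).
Proof.
move=> cphi [r r0 hr] e e0; have [s s0 hs] := cphi _ e0.
exists (Num.min r s); first by rewrite lt_min r0.
move=> y; rewrite lt_min => /andP[/hr -> /hs k].
by rewrite -scalerBr rnormZ mulrC ler_wpM2r ?rnorm_ge0.
Qed.

End Caratheodory.

Section MatrixNorm.
Context {R : realType}.
Local Notation K := (Cplx R).

Lemma rnorm_entry (p q : nat) (A : 'M[K]_(p, q)) i j : rnorm (A i j) <= rnorm A.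
Proof.
rewrite -ler_ofR -!rnormE [leRHS]/Num.norm /= mx_normE.
rewrite -[leLHS]nngE num_le.
exact: (le_bigmax _ (fun ij : 'I_p * 'I_q => `|A ij.1 ij.2|%:nng) (i, j)).
Qed.

Lemma rnorm_mx_le (p q : nat) (A : 'M[K]_(p, q)) (B : R) :
  0 <= B -> (forall i j, rnorm (A i j) <= B) -> rnorm A <= B.
Proof.
move=> B0 h; rewrite -ler_ofR -rnormE [leLHS]/Num.norm /=.
have [->|/mx_norm_neq0 [[i j] ->]] := eqVneq (mx_norm A) 0; first by rewrite -ofR0 ler_ofR.
by rewrite rnormE ler_ofR; exact: h.
Qed.

(** The norm of a matrix is the largest norm of an entry, which is not submultiplicative. The inner
    dimension enters here, and with it the factors [m%:R] in the estimates of the exponential. *)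
Lemma rnorm_mulmx (p q r : nat) (A : 'M[K]_(p, q)) (B : 'M[K]_(q, r)) :
  rnorm (A *m B) <= q%:R * rnorm A * rnorm B.
Proof.
apply: rnorm_mx_le => [|i j]; first by rewrite !mulr_ge0 ?rnorm_ge0.
rewrite mxE; apply: le_trans (rnorm_sum _ _ _) _.
apply: le_trans (_ : \sum_(k < q) rnorm A * rnorm B <= _).
  apply: ler_sum => k _; rewrite rnormM.
  by apply: ler_pM; rewrite ?rnorm_ge0 ?rnorm_entry.
by rewrite sumr_const card_ord -[leLHS]mulr_natl mulrA.
Qed.

Lemma rnorm_scalar_mx (p : nat) (c : K) : rnorm (c%:M : 'M[K]_p) <= rnorm c.
Proof.
apply: rnorm_mx_le => [|i j]; first exact: rnorm_ge0.
by rewrite mxE; case: eqP => _; rewrite ?mulr1n ?mulr0n ?rnorm0 ?rnorm_ge0.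
Qed.

Lemma cder_mulmx (p q r : nat) (F : K -> 'M[K]_(p, q)) (G : K -> 'M[K]_(q, r)) x dF dG :
  cder F x dF -> cder G x dG ->
  cder (fun y => F y *m G y) x (dF *m G x + F x *m dG).
Proof.
apply: (cder_bilinear (B := fun (A : 'M[K]_(p, q)) (B : 'M[K]_(q, r)) => A *m B) (c := q%:R)).
- by [].
- exact: rnorm_mulmx.
- by move=> *; rewrite mulmxBr.
- by move=> *; rewrite mulmxBl.
- by move=> *; rewrite -scalemxAl.
- by move=> *; rewrite -scalemxAr.
Qed.

Lemma ccont_mulmx (V : normedModType K) (p q r : nat)
    (F : V -> 'M[K]_(p, q)) (G : V -> 'M[K]_(q, r)) x :
  ccont F x -> ccont G x -> ccont (fun y => F y *m G y) x.
Proof.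
apply: (ccont_bilinear (B := fun (A : 'M[K]_(p, q)) (B : 'M[K]_(q, r)) => A *m B) (c := q%:R)).
- by [].
- exact: rnorm_mulmx.
- by move=> *; rewrite mulmxBr.
- by move=> *; rewrite mulmxBl.
Qed.

Lemma invmx_sub (p : nat) (A B : 'M[K]_p) : A \in unitmx -> B \in unitmx ->
  invmx B - invmx A = - (invmx B *m (B - A) *m invmx A).
Proof.
move=> uA uB; rewrite mulmxBr mulVmx // mulmxBl mul1mx opprB.
by rewrite -mulmxA mulmxV // mulmx1.
Qed.

(* If v B = 0 then v = v (A - B) A^-1, which is shorter than v when B is near A. *)
Lemma invmx_near (p : nat) (A : 'M[K]_p) : A \in unitmx -> exists2 d : R, 0 < d &
  forall B, rnorm (B - A) < d -> B \in unitmx /\ rnorm (invmx B) <= 2 * rnorm (invmx A).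
Proof.
move=> uA; pose c : R := p%:R * p%:R * rnorm (invmx A) + 1.
have c0 : 0 < c by rewrite ltr_wpDl // !mulr_ge0 ?rnorm_ge0.
exists (c^-1 / 2) => [|B hB]; first by rewrite divr_gt0 ?invr_gt0.
have q0 := rnorm_ge0 (invmx A).
have cB : p%:R * p%:R * rnorm (invmx A) * rnorm (B - A) <= 1 / 2.
  apply: le_trans (_ : c * (c^-1 / 2) <= _); last by rewrite mulrA mulfV ?gt_eqF.
  apply: ler_pM; rewrite ?mulr_ge0 ?rnorm_ge0 ?(ltW hB) //.
  by rewrite /c lerDl.
have uB : B \in unitmx.
  rewrite -row_free_unit -kermx_eq0; apply/eqP.
  set v := kermx B; have vB : v *m B = 0 by exact: mulmx_ker.
  have vE : v = v *m (A - B) *m invmx A by rewrite mulmxBr vB subr0 mulmxK.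
  apply: rnorm_le0.
  have h : rnorm v <= rnorm v * (1 / 2).
    rewrite {1}vE; apply: le_trans (rnorm_mulmx _ _) _.
    apply: le_trans (_ : p%:R * (p%:R * rnorm v * rnorm (A - B)) * rnorm (invmx A) <= _).
      by rewrite ler_wpM2r // ler_wpM2l // rnorm_mulmx.
    rewrite rnormC; apply: le_trans (ler_wpM2l (rnorm_ge0 v) cB).
    by rewrite le_eqVlt; apply/orP; left; apply/eqP; ring.
  lra.
split => //.
have := rnorm_sub (invmx B) (invmx A); rewrite invmx_sub // rnormN => h.
have h2 : rnorm (invmx B *m (B - A) *m invmx A) <= rnorm (invmx B) * (1 / 2).
  apply: le_trans (rnorm_mulmx _ _) _.
  apply: le_trans (_ : p%:R * (p%:R * rnorm (invmx B) * rnorm (B - A)) * rnorm (invmx A) <= _).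
    by rewrite ler_wpM2r // ler_wpM2l // rnorm_mulmx.
  apply: le_trans (ler_wpM2l (rnorm_ge0 (invmx B)) cB).
  by rewrite le_eqVlt; apply/orP; left; apply/eqP; ring.
lra.
Qed.

Lemma ccont_invmx (V : normedModType K) (p : nat) (F : V -> 'M[K]_p) x :
  ccont F x -> F x \in unitmx -> ccont (fun y => invmx (F y)) x.
Proof.
move=> cF uF e e0; have [d d0 hd] := invmx_near uF.
pose c : R := p%:R * p%:R * (2 * rnorm (invmx (F x))) * rnorm (invmx (F x)) + 1.
have c0 : 0 < c by rewrite ltr_wpDl // !mulr_ge0 ?rnorm_ge0.
have m0 : 0 < Num.min (d / 2) (e / c) by rewrite lt_min !divr_gt0.
have [r r0 hr] := cF _ m0; exists r => // y /hr; rewrite le_min => /andP[h1 h2].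
have [|uy ny] := hd (F y); first by lra.
rewrite invmx_sub // rnormN; apply: le_trans (rnorm_mulmx _ _) _.
apply: le_trans (_ : p%:R * (p%:R * (2 * rnorm (invmx (F x))) * (e / c)) * rnorm (invmx (F x)) <= _).
  rewrite ler_wpM2r ?rnorm_ge0 // ler_wpM2l //.
  apply: le_trans (rnorm_mulmx _ _) _; apply: ler_pM; rewrite ?mulr_ge0 ?rnorm_ge0 //.
  exact: ler_wpM2l.
rewrite (_ : _ * rnorm (invmx (F x)) = e / c * (c - 1)); last by rewrite /c; ring.
rewrite -[leRHS](divfK (lt0r_neq0 c0)) ler_wpM2l ?divr_ge0 ?(ltW e0) ?(ltW c0) //; lra.
Qed.

Lemma cder_invmx (p : nat) (F : K -> 'M[K]_p) x dF : cder F x dF -> F x \in unitmx ->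
  cder (fun y => invmx (F y)) x (- (invmx (F x) *m dF *m invmx (F x))).
Proof.
move=> hF uF.
have cI := ccont_invmx (cder_ccont hF) uF.
have [phi [cphi <- hphi]] := cder_slope_function hF.
apply: (cder_of_slope (phi := fun y => - (invmx (F y) *m phi y *m invmx (F x)))).
  exact: ccontN (ccont_mulmx (ccont_mulmx cI cphi) (ccont_cst _ _)).
have [d d0 hd] := invmx_near uF.
have d20 : 0 < d / 2 by rewrite divr_gt0.
have [r r0 hr] := cder_ccont hF d20; exists r => // y /hr h.
have [|uy _] := hd (F y); first by apply: le_lt_trans h _; rewrite ltr_pdivrMr // ltr_pMr // ltr1n.
by rewrite invmx_sub // hphi -scalemxAr -scalemxAl scalerN.
Qed.

Lemma cauchy_cvg (u : nat -> R) : (forall e : R, 0 < e -> exists k, forall p q,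
   (k <= p)%N -> (k <= q)%N -> `|u p - u q| <= e) ->
  exists l, forall e : R, 0 < e -> exists k, forall p, (k <= p)%N -> `|u p - l| <= e.
Proof.
move=> h; have /cvg_ex[l /cvgrPdist_le hl] : cvgn u.
  apply/cauchy_cvgP/cauchy_exP => e e0.
  have e20 : 0 < e / 2 by rewrite divr_gt0.
  have [k hk] := h _ e20; exists (u k); exists k => // p /= kp.
  rewrite /ball /= (le_lt_trans (hk _ _ _ kp)) // ltr_pdivrMr // ltr_pMr //.
  by rewrite ltr1n.
exists l => e /hl[k _ hk]; exists k => p kp; rewrite distrC; exact: hk.
Qed.

Lemma matrix_complete (p q : nat) (u : nat -> 'M[K]_(p, q)) :
  (forall e : R, 0 < e -> exists k, forall i j, (k <= i)%N -> (k <= j)%N -> rnorm (u i - u j) <= e) ->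
  exists l, forall e : R, 0 < e -> exists k, forall i, (k <= i)%N -> rnorm (u i - l) <= e.
Proof.
move=> h.
have entry i j k l : rnorm (u k i j - u l i j) <= rnorm (u k - u l).
  by have := rnorm_entry (u k - u l) i j; rewrite !mxE.
have /choice[re hre] : forall ij : 'I_p * 'I_q, exists l, forall e : R, 0 < e -> exists k, forall i,
    (k <= i)%N -> `|complex.Re (u i ij.1 ij.2) - l| <= e.
  move=> [i j]; apply: cauchy_cvg => e /h[k hk]; exists k => k1 k2 h1 h2 /=.
  rewrite -ReB; apply: le_trans (Re_rnorm _) _; apply: le_trans (entry _ _ _ _) _; exact: hk.
have /choice[im him] : forall ij : 'I_p * 'I_q, exists l, forall e : R, 0 < e -> exists k, forall i,
    (k <= i)%N -> `|complex.Im (u i ij.1 ij.2) - l| <= e.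
  move=> [i j]; apply: cauchy_cvg => e /h[k hk]; exists k => k1 k2 h1 h2 /=.
  rewrite -ImB; apply: le_trans (Im_rnorm _) _; apply: le_trans (entry _ _ _ _) _; exact: hk.
exists (\matrix_(i, j) pt (re (i, j)) (im (i, j))) => e e0.
have e20 : 0 < e / 2 by rewrite divr_gt0.
have /choice[N hN] : forall ij : 'I_p * 'I_q, exists k : nat, forall i, (k <= i)%N ->
    rnorm (u i ij.1 ij.2 - pt (re ij) (im ij)) <= e.
  move=> ij; have [k1 hk1] := hre ij _ e20; have [k2 hk2] := him ij _ e20.
  exists (maxn k1 k2) => i; rewrite geq_max => /andP[/hk1 h1 /hk2 h2].
  apply: le_trans (rnorm_ReIm _) _; rewrite ReB ImB /= [e]splitr; exact: lerD.
exists (\max_ij N ij) => k hk; apply: rnorm_mx_le => [|i j]; first exact: ltW.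
by rewrite !mxE; apply: (hN (i, j)); apply: leq_trans hk; exact: leq_bigmax.
Qed.

End MatrixNorm.

(** * The matrix exponential: convergence and derivative *)

Section MatrixExponential.
Context {R : realType}.
Local Notation K := (Cplx R).
Context {m : nat}.
Implicit Types (M H : 'M[K]_m).

Definition expmx_partial (n : nat) M : 'M[K]_m := \sum_(k < n) (k`!%:R : K)^-1 *: M ^+ k.

Definition expR_partial (n : nat) (x : R) : R := \sum_(k < n) k`!%:R^-1 * x ^+ k.

Lemma expR_partial_cvg (x : R) : forall e : R, 0 < e -> exists k, forall p, (k <= p)%N ->
  `|expR_partial p x - expR x| <= e.
Proof.
move=> e e0; have /cvgrPdist_le/(_ _ e0)[k _ hk] := @is_cvg_series_exp_coeff _ x.
exists k => p kp; have := hk p kp; rewrite distrC; congr (`| _ - _| <= _).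
rewrite seriesEnat /= big_mkord /expR_partial; apply: eq_bigr => i _.
by rewrite /exp_coeff /= mulrC.
Qed.

Lemma rnorm_expmx_power M k : rnorm (M ^+ k) <= (m%:R * rnorm M) ^+ k.
Proof.
elim: k => [|k ih].
  by rewrite !expr0; apply: le_trans (rnorm_scalar_mx _ _) _; rewrite rnorm1.
rewrite !exprS; apply: le_trans (rnorm_mulmx _ _) _.
by rewrite ler_wpM2l // mulr_ge0 // rnorm_ge0.
Qed.

(** Term by term, the series is majorised by the real exponential series at m |M|. *)
Lemma expmx_cauchy M p q : (p <= q)%N ->
  rnorm (expmx_partial q M - expmx_partial p M) <=
    expR_partial q (m%:R * rnorm M) - expR_partial p (m%:R * rnorm M).
Proof.
elim: q => [|q ih]; first by rewrite leqn0 => /eqP ->; rewrite !subrr rnorm0.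
rewrite leq_eqVlt => /predU1P[->|]; first by rewrite !subrr rnorm0.
rewrite ltnS => /ih {}ih.
rewrite /expmx_partial /expR_partial !big_ord_recr /= !(addrAC _ _ (- _)).
apply: le_trans (rnormD _ _) _; apply: lerD => //.
rewrite rnormZ rnormV -ofR_nat rnorm_pos // ler_wpM2l ?invr_ge0 //.
exact: rnorm_expmx_power.
Qed.

Lemma expmx_cvg M : forall e : R, 0 < e -> exists k, forall p, (k <= p)%N ->
  rnorm (expmx_partial p M - expmx M) <= e.
Proof.
set x := m%:R * rnorm M.
have [l hl] : exists l, forall e : R, 0 < e -> exists k, forall p, (k <= p)%N ->
    rnorm (expmx_partial p M - l) <= e.
  apply: matrix_complete => e e0; have e20 : 0 < e / 2 by rewrite divr_gt0.
  have [k hk] := expR_partial_cvg x e20; exists k.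
  have main i j : (k <= i)%N -> (k <= j)%N -> (i <= j)%N ->
      rnorm (expmx_partial j M - expmx_partial i M) <= e.
    move=> /hk h1 /hk h2 ij; apply: le_trans (expmx_cauchy M ij) _; rewrite -/x.
    apply: le_trans (ler_norm _) _; apply: le_trans (ler_distD (expR x) _ _) _.
    by rewrite [e]splitr lerD // distrC.
  move=> i j ki kj; have [ij|/ltnW ji] := leqP i j; last exact: main.
  by rewrite rnormC; exact: main.
suff -> : expmx M = l by [].
apply: cvg_lim => //; apply/cvgrPdist_le => e e0.
have [eE ee0] := pos_ofR e0.
have [k hk] := hl _ ee0; exists k => // p /= /hk.
rewrite eE rnormE ler_ofR rnormC; congr (rnorm (_ - _) <= _).
by rewrite seriesEnat /= big_mkord.
Qed.

End MatrixExponential.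

Section ExponentialDerivative.
Context {R : realType}.
Local Notation K := (Cplx R).
Context {m : nat}.
Implicit Types (M H : 'M[K]_m).

(** The second-order remainder R_k of (M + H)^(k+1) satisfies R_(k+1) = (M + H) R_k + (k+1) M^k H^2
    when M and H commute. The coefficients are nonnegative, so the same recursion in the real
    numbers m |M| and m |H| majorises it. *)
Lemma power_defect M H k : GRing.comm M H ->
  rnorm ((M + H) ^+ k.+1 - M ^+ k.+1 - (M ^+ k * H) *+ k.+1) <=
    (m%:R * rnorm M + m%:R * rnorm H) ^+ k.+1 - (m%:R * rnorm M) ^+ k.+1
    - k.+1%:R * ((m%:R * rnorm M) ^+ k * (m%:R * rnorm H)).
Proof.
move=> cMH; set X := m%:R * rnorm M; set h := m%:R * rnorm H.
have X0 : 0 <= X by rewrite mulr_ge0 // rnorm_ge0.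
have h0 : 0 <= h by rewrite mulr_ge0 // rnorm_ge0.
elim: k => [|k ih].
  rewrite !expr1 !expr0 !mul1r mulr1n -addrA -opprD subrr rnorm0.
  by have -> : X + h - X - h = 0 by ring.
set A := M ^+ k; set P := (M + H) ^+ k.+1.
have cA : H * A = A * H by apply: commrX; exact: commr_sym.
have -> : (M + H) ^+ k.+2 - M ^+ k.+2 - (M ^+ k.+1 * H) *+ k.+2 =
    (M + H) * (P - M ^+ k.+1 - (A * H) *+ k.+1) + (A * H * H) *+ k.+1.
  rewrite (exprS _ k.+1) (exprS M k.+1) !(exprS M k) -/A -/P.
  have E1 : (M + H) * (M * A) = M * (M * A) + M * A * H.
    by rewrite mulrDl [H * _]mulrA -cMH -[M * H * A]mulrA cA !mulrA.
  have E2 : (M + H) * (A * H) = M * A * H + A * H * H by rewrite mulrDl !mulrA cA.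
  rewrite !mulrBr mulrnAr E1 E2 mulrnDl [(M * A * H) *+ k.+2]mulrS.
  have E (V : zmodType) (p a b c : V) n :
      p - a - (b + b *+ n) = p - (a + b) - (b *+ n + c *+ n) + c *+ n.
    by rewrite !opprD !addrA subrK.
  exact: E.
apply: le_trans (rnormD _ _) _.
have n1 : rnorm (A * H * H) <= X ^+ k * h * h.
  apply: le_trans (rnorm_mulmx _ _) _; rewrite mulrAC mulrC -/h ler_wpM2r //.
  apply: le_trans (rnorm_mulmx _ _) _; rewrite mulrAC mulrC -/h ler_wpM2r //.
  exact: rnorm_expmx_power.
have n2 : m%:R * rnorm (M + H) <= X + h by rewrite -mulrDr ler_wpM2l // rnormD.
apply: le_trans (lerD (rnorm_mulmx _ _) (lexx _)) _.
rewrite -[(A * H * H) *+ _]scaler_nat rnormZ -ofR_nat rnorm_pos //.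
apply: le_trans (lerD (ler_pM _ _ n2 ih) (ler_wpM2l _ n1)) _; rewrite ?mulr_ge0 ?rnorm_ge0 //.
rewrite le_eqVlt; apply/orP; left; apply/eqP.
rewrite [(X + h) ^+ k.+2]exprS [X ^+ k.+2]exprS [X ^+ k.+1]exprS -[k.+2]addn1 natrD.
by move: ((X + h) ^+ k.+1) (X ^+ k) => u v; ring.
Qed.

Lemma expmx_partialS n M :
  expmx_partial n.+1 M = 1 + \sum_(k < n) (k.+1`!%:R : K)^-1 *: M ^+ k.+1.
Proof. by rewrite /expmx_partial big_ord_recl fact0 invr1 scale1r. Qed.

Lemma expR_partialS n (x : R) :
  expR_partial n.+1 x = 1 + \sum_(k < n) k.+1`!%:R^-1 * x ^+ k.+1.
Proof. by rewrite /expR_partial big_ord_recl fact0 invr1 mul1r. Qed.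

Lemma expmx_defect M H : GRing.comm M H ->
  rnorm (expmx (M + H) - expmx M - expmx M *m H) <=
    expR (m%:R * rnorm M) * (expR (m%:R * rnorm H) - 1 - m%:R * rnorm H).
Proof.
move=> cMH; set X := m%:R * rnorm M; set h := m%:R * rnorm H.
have h0 : 0 <= h by rewrite mulr_ge0 // rnorm_ge0.
have part n : rnorm (expmx_partial n.+1 (M + H) - expmx_partial n.+1 M - expmx_partial n M *m H) <=
    expR_partial n.+1 (X + h) - expR_partial n.+1 X - expR_partial n X * h.
  have E (V : zmodType) (o p q t : V) : o + p - (o + q) - t = p - q - t.
    by rewrite opprD addrACA subrr add0r.
  rewrite !expmx_partialS !expR_partialS !E.
  rewrite /expmx_partial /expR_partial mulmx_suml mulr_suml -!sumrB.
  apply: le_trans (rnorm_sum _ _ _) _; apply: ler_sum => i _.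
  have fact_neq0 : (i.+1)%:R != 0 :> K by rewrite pnatr_eq0.
  have -> : (i`!%:R : K)^-1 *: M ^+ i *m H = (i.+1`!%:R : K)^-1 *: ((M ^+ i * H) *+ i.+1).
    rewrite -scalemxAl -[(M ^+ i * H) *+ i.+1]scaler_nat scalerA; congr (_ *: _).
    by rewrite factS natrM invfM mulrAC mulVf // mul1r.
  have -> : i`!%:R^-1 * X ^+ i * h = i.+1`!%:R^-1 * (i.+1%:R * (X ^+ i * h)).
    by rewrite factS natrM invfM [RHS]mulrACA mulVf ?pnatr_eq0 // mul1r -[LHS]mulrA.
  rewrite -2![in leRHS]mulrBr -2![in leLHS]scalerBr rnormZ rnormV -ofR_nat rnorm_pos //.
  by rewrite ler_wpM2l ?invr_ge0 //; exact: power_defect.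
apply/ler_addgt0Pr => e e0.
(* Passing from partial sums to limits costs four errors of size d and two of size d h. *)
pose c : R := m%:R * rnorm H + h + 5.
have c0 : 0 < c by rewrite /c -/h; lra.
pose d := e / c; have d0 : 0 < d by rewrite divr_gt0.
have [k1 hk1] := expmx_cvg (M + H) d0; have [k2 hk2] := expmx_cvg M d0.
have [k3 hk3] := expR_partial_cvg (X + h) d0; have [k4 hk4] := expR_partial_cvg X d0.
pose n := maxn (maxn k1 k2) (maxn k3 k4).
have [n1 n2 n3 n4] : [/\ (k1 <= n)%N, (k2 <= n)%N, (k3 <= n)%N & (k4 <= n)%N].
  by rewrite /n; split; rewrite !leq_max leqnn ?orbT.
have {}part := part n.
have q1 := hk1 n.+1 (leqW n1); have q2 := hk2 n.+1 (leqW n2); have q3 := hk2 n n2.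
have := hk3 n.+1 (leqW n3); have := hk4 n.+1 (leqW n4); have := hk4 n n4.
rewrite !ler_norml expRD => /andP[r3 _] /andP[r2 _] /andP[_ r1].
set P := expmx_partial n.+1 (M + H) in part q1.
set Q := expmx_partial n.+1 M in part q2.
set S := expmx_partial n M in part q3.
have q4 : rnorm ((S - expmx M) *m H) <= d * h.
  apply: le_trans (rnorm_mulmx _ _) _; rewrite mulrAC mulrC -/h.
  by rewrite ler_wpM2r.
have r4 : expR X * h - expR_partial n X * h <= d * h.
  by rewrite -mulrBl ler_wpM2r // -opprB lerNl.
have -> : expmx (M + H) - expmx M - expmx M *m H =
    (P - Q - S *m H) + ((S - expmx M) *m H + (Q - expmx M)) - (P - expmx (M + H)).
  rewrite mulmxBl.
  have E (V : zmodType) (p q t u v w : V) : u - v - w = p - q - t + (t - w + (q - v)) - (p - u).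
    by rewrite !(opprD, opprK) !addrA [RHS](ACl (9*7*5*1*8*6*2*4*3)) /= !addrK.
  exact: E.
apply: le_trans (rnormB _ _) _; apply: le_trans (lerD (rnormD _ _) (lexx _)) _.
apply: le_trans (lerD (lerD part (rnormD _ _)) q1) _.
have eE : e = d * c by rewrite /d divfK // gt_eqF.
have dh : 0 <= d * h by rewrite mulr_ge0 // ltW.
have -> : e = d * h + d * h + 5 * d by rewrite eE /c -/h; ring.
clear - r1 r2 r4 q2 q4 dh d0; lra.
Qed.

(** As nearby values commute with F x, [expmx_defect] applies to H = F y - F x and no Duhamel
    integral arises. Its bound e^h - 1 - h, with h = m |H|, is o(h) by the derivative of the real
    exponential at 0. *)
Lemma cder_expmx (F : K -> 'M[K]_m) x dF : cder F x dF ->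
  (exists2 r : R, 0 < r & forall y, rnorm (y - x) < r -> GRing.comm (F x) (F y)) ->
  cder (fun y => expmx (F y)) x (expmx (F x) *m dF).
Proof.
move=> hF [r0 r00 hcomm] e e0.
pose E := expR (m%:R * rnorm (F x)).
have E0 : 0 < E by exact: expR_gt0.
pose nE := m%:R * rnorm (expmx (F x)) + 1.
have nE0 : 0 < nE by rewrite ltr_wpDl // mulr_ge0 // rnorm_ge0.
pose s := m%:R * (rnorm dF + 1) + 1.
have s0 : 0 < s by rewrite ltr_wpDl // mulr_ge0 // addr_ge0 // rnorm_ge0.
have e10 : 0 < e / 2 / nE by rewrite !divr_gt0.
have e20 : 0 < e / 2 / (E * s) by rewrite !divr_gt0 // mulr_gt0.
have [r1 r10 h1] := hF _ e10.
have [r2 r20 h2] := cder_slope hF ltr01.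
have [r3 r30 h3] := real_slope (is_derive_expR (0 : R)) e20.
exists (Num.min (Num.min r0 r1) (Num.min r2 (r3 / s))).
  by rewrite !lt_min r00 r10 r20 divr_gt0.
move=> y; rewrite !lt_min => /andP[/andP[/hcomm ch /h1 k1] /andP[/h2 k2]].
rewrite ltr_pdivlMr // mulrC => k3.
set H := F y - F x in k1 k2.
have cH : GRing.comm (F x) H by apply: commrB => //.
have FH : F x + H = F y by rewrite /H subrKC.
have := expmx_defect cH; rewrite FH => dh.
set h := m%:R * rnorm H in dh.
have h0 : 0 <= h by rewrite mulr_ge0 // rnorm_ge0.
have hs : h <= s * rnorm (y - x).
  apply: le_trans (_ : m%:R * ((rnorm dF + 1) * rnorm (y - x)) <= _).
    by rewrite ler_wpM2l.
  by rewrite mulrA ler_wpM2r ?rnorm_ge0 // /s lerDl.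
have := h3 h; rewrite (ger0_norm h0) => /(_ (le_lt_trans hs k3)).
rewrite add0r expR0 mulr1 => /(le_trans (ler_norm _)) k4.
have -> : expmx (F y) - expmx (F x) - (y - x) *: (expmx (F x) *m dF) =
   (expmx (F y) - expmx (F x) - expmx (F x) *m H) + expmx (F x) *m (H - (y - x) *: dF).
  by rewrite (mulmxBr (expmx (F x)) H) -scalemxAr addrA subrK.
apply: le_trans (rnormD _ _) _.
rewrite [e]splitr mulrDl; apply: lerD.
  apply: le_trans dh _; apply: le_trans (ler_wpM2l (ltW E0) k4) _.
  apply: le_trans (_ : E * (e / 2 / (E * s) * (s * rnorm (y - x))) <= _).
    by rewrite !ler_wpM2l ?(ltW E0) ?(ltW e20).
  by rewrite le_eqVlt; apply/orP; left; apply/eqP; field; rewrite !gt_eqF.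
apply: le_trans (rnorm_mulmx _ _) _.
apply: le_trans (_ : nE * (e / 2 / nE * rnorm (y - x)) <= _).
  apply: ler_pM; rewrite ?mulr_ge0 ?rnorm_ge0 //; by rewrite /nE lerDl.
by rewrite le_eqVlt; apply/orP; left; apply/eqP; field; rewrite gt_eqF.
Qed.

End ExponentialDerivative.

(** * Directional derivatives *)

Section DirectionalCalculus.
Context {R : realType}.
Local Notation K := (Cplx R).
Context {V W : normedModType K}.
Implicit Types (F : V -> W) (p u v : V).

Definition dirderiv F v p : W := 'd F p v.

Lemma cder_unique (f : K -> W) x d d' : cder f x d -> cder f x d' -> d = d'.
Proof.
move=> h h'; apply/eqP; rewrite -subr_eq0; apply/eqP; apply: rnorm_small0 => e e0.
have e20 : 0 < e / 2 by rewrite divr_gt0.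
have [r r0 hr] := h _ e20; have [s s0 hs] := h' _ e20.
pose q := Num.min r s / 2.
have m0 : 0 < Num.min r s by rewrite lt_min r0.
have q0 : 0 < q by rewrite divr_gt0.
have [qr qs] : q < r /\ q < s.
  by apply/andP; rewrite -lt_min /q ltr_pdivrMr // ltr_pMr // ltr1n.
have xq : x + ofR q - x = ofR q by rewrite addrAC subrr add0r.
have := hr (x + ofR q); have := hs (x + ofR q).
rewrite xq rnorm_pos ?(ltW q0) // => /(_ qs) k1 /(_ qr) k2.
have : rnorm (ofR q *: (d - d')) <= e * q.
  have -> : ofR q *: (d - d') = (f (x + ofR q) - f x - ofR q *: d') - (f (x + ofR q) - f x - ofR q *: d).
    by rewrite scalerBr opprB [RHS]addrC addrA subrK.
  apply: le_trans (rnormB _ _) _; apply: le_trans (lerD k1 k2) _.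
  by rewrite -mulrDl -splitr.
by rewrite rnormZ rnorm_pos ?(ltW q0) // mulrC ler_pM2r.
Qed.

Lemma cder_translate (f : K -> W) x d : cder (fun z => f (x + z)) 0 d <-> cder f x d.
Proof.
split=> h e /h[r r0 hr]; exists r => // y hy.
  by have := hr (y - x); rewrite !subr0 addr0 !subrKC => /(_ hy).
rewrite !subr0 addr0 in hy *; have := hr (x + y).
by rewrite (addrAC x) subrr add0r => /(_ hy).
Qed.

Lemma cder_ext (f g : K -> W) x d : f =1 g -> cder f x d -> cder g x d.
Proof. by move=> /funext ->. Qed.

Lemma cder_line F p v s : differentiable F (p + s *: v) ->
  cder (fun z : K => F (p + z *: v)) s (dirderiv F v (p + s *: v)).
Proof.
move=> /(cder_of_differentiable v) h; apply/cder_translate.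
by move: h; congr cder; apply/funext => z; rewrite scalerDl addrA.
Qed.

Lemma plane_near p u v (P : set V) : (\forall q \near p, P q) ->
  exists2 r : R, 0 < r & forall x z : K, rnorm x < r -> rnorm z < r -> P (p + x *: u + z *: v).
Proof.
move=> /nbhs_rnorm[d d0 hd].
have n1 := rnorm_ge0 u; have n2 := rnorm_ge0 v.
have c0 : 0 < rnorm u + rnorm v + 1 by lra.
exists (d / (rnorm u + rnorm v + 1)); first by rewrite divr_gt0.
move=> x z; rewrite !ltr_pdivlMr // => hx hz; apply: hd.
rewrite (addrAC _ _ (- p)) (addrAC p) subrr add0r; apply: le_lt_trans (rnormD _ _) _.
rewrite !rnormZ; set M := Num.max (rnorm x) (rnorm z).
have xM : rnorm x <= M by rewrite le_max lexx.
have zM : rnorm z <= M by rewrite le_max lexx orbT.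
have Md : M * (rnorm u + rnorm v + 1) < d by rewrite /M; case: (leP (rnorm x) (rnorm z)).
have M0 : 0 <= M by apply: le_trans (rnorm_ge0 x) xM.
have k1 : rnorm x * rnorm u <= M * rnorm u by rewrite ler_wpM2r.
have k2 : rnorm z * rnorm v <= M * rnorm v by rewrite ler_wpM2r.
lra.
Qed.

(** Restricts F to the complex plane through p spanned by u and v, on a bidisc with a bound: the
    input of the two-variable estimates. *)
Lemma holomorphic_plane F p u v : holomorphic_near p F ->
  exists r B : R, 0 < r /\ forall x z : K, rnorm x < r -> rnorm z < r ->
    differentiable F (p + x *: u + z *: v) /\ rnorm (F (p + x *: u + z *: v)) <= B.
Proof.
move=> hF; have [r1 r10 h1] := plane_near u v hF.
have [d d0 hd] := ccont_of_differentiable (nbhs_singleton hF) ltr01.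
have [r2 r20 h2] : exists2 r : R, 0 < r & forall x z : K, rnorm x < r -> rnorm z < r ->
    rnorm (p + x *: u + z *: v - p) < d.
  apply: (@plane_near p u v (fun q => rnorm (q - p) < d)); apply/nbhs_normP; exists (ofR d); first by rewrite /= -ofR0 ltr_ofR.
  by move=> q /=; rewrite distrC rnormE ltr_ofR.
exists (Num.min r1 r2), (rnorm (F p) + 1); split; first by rewrite lt_min r10.
move=> x z; rewrite !lt_min => /andP[x1 x2] /andP[z1 z2]; split; first exact: h1.
by apply: le_trans (rnorm_sub _ (F p)) _; rewrite lerD2l; apply: hd; apply: h2.
Qed.

(** Differentiability at every point does not by itself make the differential continuous in the
    point; Cauchy's estimates supply this. *)
Lemma differential_lipschitz F p u v : holomorphic_near p F ->
  exists r C : R, 0 < r /\ forall x y : K, rnorm x <= r -> rnorm y <= r ->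
    rnorm (dirderiv F v (p + y *: u) - dirderiv F v (p + x *: u)) <= C * rnorm (y - x).
Proof.
move=> /(holomorphic_plane u v)[r [B [r0 h]]].
exists (r / 2), (64 * B / r ^+ 2); split; first by rewrite divr_gt0.
move=> x y hx hy.
have := @partial_lipschitz _ _ (fun x z => F (p + x *: u + z *: v))
  (fun x z => dirderiv F u (p + x *: u + z *: v)) (fun x z => dirderiv F v (p + x *: u + z *: v)) 0 r B r0.
have E w : p + w *: u = p + w *: u + (0 : K) *: v by rewrite scale0r addr0.
move=> H; rewrite (E x) (E y); apply: (H); rewrite ?subr0 //.
- move=> x' z; rewrite subr0 => h1 h2; have [d _] := h _ _ h1 h2.
  move: d; rewrite addrAC => /cder_line; congr cder.
  by apply/funext => y'; rewrite addrAC.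
- by move=> x' z; rewrite subr0 => h1 h2; apply: cder_line; have [] := h _ _ h1 h2.
- by move=> x' z; rewrite subr0 => h1 h2; have [] := h _ _ h1 h2.
Qed.

Lemma mixed_differential F p u v (D : K -> W) : holomorphic_near p F ->
  (exists2 r : R, 0 < r & forall z : K, rnorm z < r -> cder (fun y => dirderiv F u (p + y *: v)) z (D z)) ->
  cder (fun x : K => dirderiv F v (p + x *: u)) 0 (D 0).
Proof.
move=> /(holomorphic_plane u v)[r [B [r0 h]]] [s s0 hs].
pose q := Num.min r s.
have q0 : 0 < q by rewrite lt_min r0.
have qr : q <= r by rewrite ge_min lexx.
have qs : q <= s by rewrite ge_min lexx orbT.
have := @mixed_derivative _ _ (fun x z => F (p + x *: u + z *: v))
  (fun x z => dirderiv F u (p + x *: u + z *: v)) (fun x z => dirderiv F v (p + x *: u + z *: v)) 0 q B q0.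
move=> H; have : cder (fun x => dirderiv F v (p + x *: u + 0 *: v)) 0 (D 0).
  apply: (H _ _ _ D).
  - move=> x' z; rewrite subr0 => h1 h2; have [d _] := h _ _ (lt_le_trans h1 qr) (lt_le_trans h2 qr).
    move: d; rewrite addrAC => /cder_line; congr cder.
    by apply/funext => y'; rewrite addrAC.
  - move=> x' z; rewrite subr0 => h1 h2; apply: cder_line.
    by have [] := h _ _ (lt_le_trans h1 qr) (lt_le_trans h2 qr).
  - move=> x' z; rewrite subr0 => h1 h2.
    by have [] := h _ _ (lt_le_trans h1 qr) (lt_le_trans h2 qr).
  - move=> z hz; have := hs _ (lt_le_trans hz qs).
    have E y : p + y *: v = p + 0 *: u + y *: v by rewrite scale0r addr0.
    by rewrite (_ : (fun y => dirderiv F u (p + y *: v)) = fun y => dirderiv F u (p + 0 *: u + y *: v)) //;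
      apply/funext => y; rewrite -(E y).
have E x : p + x *: u = p + x *: u + (0 : K) *: v by rewrite scale0r addr0.
rewrite (_ : (fun x => dirderiv F v (p + x *: u)) = fun x => dirderiv F v (p + x *: u + 0 *: v)) //.
by apply/funext => x; rewrite -(E x).
Qed.

End DirectionalCalculus.

Section Pairs.
Context {R : realType}.
Local Notation K := (Cplx R).
Context {V1 V2 : normedModType K}.

Lemma rnorm_pair_lt (p : V1 * V2) (r : R) : rnorm p.1 < r -> rnorm p.2 < r -> rnorm p < r.
Proof.
move=> h1 h2; rewrite -ltr_ofR -rnormE prod_normE !rnormE /=.
by rewrite /Order.max; case: ifP => _; rewrite ltr_ofR.
Qed.

End Pairs.

(** * Cut planes *)

Section Rays.
Context {R : realType}.
Local Notation K := (Cplx R).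
Implicit Types (theta : R) (a b x y : K).

Lemma cisN_mul theta : cis (- theta) * cis theta = 1 :> K.
Proof.
rewrite /cis cosN sinN; apply: cplx_eq => /=; last by ring.
by rewrite mulNr opprK -!expr2 cos2Dsin2.
Qed.

Lemma cis_mulK theta x : cis theta * (cis (- theta) * x) = x.
Proof. by rewrite mulrA [cis theta * _]mulrC cisN_mul mul1r. Qed.

Lemma cisN_mulK theta x : cis (- theta) * (cis theta * x) = x.
Proof. by rewrite mulrA cisN_mul mul1r. Qed.

Lemma rayP theta a x : ray theta a x <->
  complex.Im (cis (- theta) * (x - a)) = 0 /\ 0 <= complex.Re (cis (- theta) * (x - a)).
Proof.
split=> [[s s0 ->]|[h1 h2]].
  by rewrite -[s%:C]/(ofR s) [a + _]addrC addrK cisN_mulK.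
exists (complex.Re (cis (- theta) * (x - a))) => //.
rewrite -[X in cis theta * X]/(ofR _).
have -> : ofR (complex.Re (cis (- theta) * (x - a))) = cis (- theta) * (x - a).
  by apply: cplx_eq.
by rewrite cis_mulK subrKC.
Qed.

(** Lying on the ray depends on x - a alone, and it is a closed condition after rotation. The radius
    thus holds for point and endpoint moving together, as when the poles are parameters. *)
Lemma ray_stable theta a x : ~ ray theta a x ->
  exists2 r : R, 0 < r & forall b y, rnorm ((y - b) - (x - a)) < r -> ~ ray theta b y.
Proof.
move=> /rayP nr; set w := cis (- theta) * (x - a) in nr.
have close b y : rnorm (cis (- theta) * (y - b) - w) = rnorm ((y - b) - (x - a)).
  by rewrite -mulrBr rnormM rnorm_cis mul1r.
have [I0|/eqP I0] := eqVneq (complex.Im w) 0.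
  have R0 : complex.Re w < 0 by rewrite ltNge; apply/negP => h; apply: nr.
  exists (- complex.Re w); first by rewrite oppr_gt0.
  move=> b y; rewrite -close => h /rayP[_ h2].
  have := le_lt_trans (Re_rnorm _) h; rewrite ReB ltr_norml; lra.
exists `|complex.Im w|; first by rewrite normr_gt0; apply/eqP.
move=> b y; rewrite -close => h /rayP[h1 _].
by have := le_lt_trans (Im_rnorm _) h; rewrite ImB h1 sub0r normrN ltxx.
Qed.

Lemma ray_refl theta a : ray theta a a.
Proof. by exists 0 => //; rewrite mulr0 addr0. Qed.

End Rays.

Section CutPlanes.
Context {R : realType} {n : nat}.
Local Notation K := (Cplx R).
Local Notation P := (K * 'rV[K]_n)%type.
Variables (theta : R) (U : set 'rV[K]_n).
Hypothesis (U_open : open U).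
Implicit Types (p q v : P).

Lemma rnorm_fst p : rnorm p.1 <= rnorm p.
Proof.
rewrite -ler_ofR -[leRHS]rnormE prod_normE !rnormE /Order.max.
by case: ifP => //; rewrite ltr_ofR ler_ofR => /ltW.
Qed.

Lemma rnorm_snd p : rnorm p.2 <= rnorm p.
Proof.
rewrite -ler_ofR -[leRHS]rnormE prod_normE !rnormE /Order.max.
case: ifP => //; rewrite ltr_ofR => /negbT; rewrite -leNgt.
by rewrite ler_ofR.
Qed.

Lemma near_rnorm (V : normedModType K) (w : V) (Q : set V) (r : R) : 0 < r ->
  (forall w' : V, rnorm (w' - w) < r -> Q w') -> \forall w' \near w, Q w'.
Proof.
move=> r0 h; apply/nbhs_normP; exists (ofR r); first by rewrite /= -ofR0 ltr_ofR.
by move=> q /=; rewrite distrC rnormE ltr_ofR => /h.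
Qed.

Lemma cut_plane_j_near j p : cut_plane_j theta U j p -> \forall q \near p, cut_plane_j theta U j q.
Proof.
move=> [Up np]; have [r r0 hr] := ray_stable np.
have [d d0 hd] := nbhs_rnorm (open_nbhs_nbhs (conj U_open Up)).
apply: (@near_rnorm _ _ _ (Num.min (r / 2) d)); first by rewrite lt_min d0 divr_gt0.
move=> q; rewrite lt_min => /andP[h1 h2]; split.
  by apply: hd; apply: le_lt_trans (rnorm_snd (q - p)) h2.
apply: hr.
have -> : q.1 - q.2 ord0 j - (p.1 - p.2 ord0 j) = (q - p).1 - (q - p).2 ord0 j.
  by rewrite !mxE /=; ring.
apply: le_lt_trans (rnormB _ _) _.
have := rnorm_fst (q - p); have := rnorm_snd (q - p).
have := rnorm_entry (q - p).2 ord0 j; lra.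
Qed.

Lemma cut_plane_near p : cut_plane theta U p -> \forall q \near p, cut_plane theta U q.
Proof.
move=> [Up np].
have [|d d0 hd] := @fin_radius _ n (fun j d => forall q, rnorm (q - p) < d -> cut_plane_j theta U j q).
  move=> j; have [r r0 hr] := nbhs_rnorm (cut_plane_j_near (conj Up (np j))).
  by exists r => // r' /andP[_ h] q hq; apply: hr; exact: lt_le_trans hq h.
have [d2 d20 hd2] := nbhs_rnorm (open_nbhs_nbhs (conj U_open Up)).
apply: (@near_rnorm _ _ _ (Num.min d d2)); first by rewrite lt_min d0.
move=> q; rewrite lt_min => /andP[h1 h2]; split.
  by apply: hd2; apply: le_lt_trans (rnorm_snd (q - p)) h2.
by move=> j; have [] := hd j d _ q h1; rewrite ?d0 ?lexx.
Qed.

Lemma cut_plane_pole j p : cut_plane_j theta U j p -> p.1 != p.2 ord0 j.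
Proof. by move=> [_ np]; apply/eqP => h; apply: np; rewrite h; exact: ray_refl. Qed.

Lemma pair_dir (x z d : K) (t e : 'rV[K]_n) : (x, t) + z *: (d, e) = (x + z * d, t + z *: e) :> P.
Proof. by []. Qed.

End CutPlanes.

(** * The defect of the deformation equation *)

Section DeformationDefect.
Context {R : realType} {n m : nat}.
Local Notation K := (Cplx R).
Local Notation P := (K * 'rV[K]_n)%type.
Variables (U : set 'rV[K]_n) (theta : R).
Hypotheses (U_open : open U).
Variable (lg : 'I_n -> P -> K).
Hypotheses
  (lg_holo : forall j, holomorphic_on (cut_plane_j theta U j) (lg j))
  (lg_exp : forall j x t, cut_plane_j theta U j (x, t) ->
     cexp (lg j (x, t)) = x - t ord0 j).

Lemma line_near (V : normedModType K) (p v : V) (Q : set V) : (\forall q \near p, Q q) ->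
  exists2 r : R, 0 < r & forall z : K, rnorm z < r -> Q (p + z *: v).
Proof.
move=> /(plane_near 0 v)[r r0 h]; exists r => // z hz.
by have := h 0 z; rewrite scaler0 addr0 rnorm0; apply.
Qed.

(** Any holomorphic branch will do: exp (log (x - x_j)) = x - x_j is differentiated along v and
    divided by x - x_j. *)
Lemma cder_lg j p v : cut_plane_j theta U j p ->
  cder (fun z => lg j (p + z *: v)) 0 ((p.1 - p.2 ord0 j)^-1 * (v.1 - v.2 ord0 j)).
Proof.
move=> hp; have d := cder_of_differentiable v (lg_holo hp).
set d0 := ('d (lg j) p v : K) in d.
have [r r0 hr] := line_near v (cut_plane_j_near U_open hp).
have e1 := cder_comp d (cder_cexp (lg j (p + 0 *: v))).
have e2 : cder (fun z => cexp (lg j (p + z *: v))) 0 (v.1 - v.2 ord0 j).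
  apply: cder_eq (cder_affine (p.1 - p.2 ord0 j) (v.1 - v.2 ord0 j) 0).
  exists r => // z; rewrite subr0 => /hr hz.
  rewrite [p + _]surjective_pairing lg_exp -?surjective_pairing //.
  by rewrite !mxE /= /GRing.scale /=; ring.
have := cder_unique e1 e2; rewrite scale0r addr0.
rewrite [p in cexp (lg j p)]surjective_pairing lg_exp -?surjective_pairing // => E.
rewrite -E /GRing.scale /= mulrC mulfK //.
by rewrite subr_eq0 (cut_plane_pole hp).
Qed.

Variables (A : 'I_n -> 'rV[K]_n -> 'M[K]_m) (Y : P -> 'M[K]_m).
Hypotheses (A_holo : forall k, holomorphic_on U (A k))
  (Y_holo : holomorphic_on (cut_plane theta U) Y)
  (Y_unit : forall p, cut_plane theta U p -> Y p \in unitmx)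
  (Y_ode : forall x t, cut_plane theta U (x, t) ->
     is_derive x (1 : K) (fun z => Y (z, t))
       ((\sum_(k < n) (x - t ord0 k)^-1 *: A k t) *m Y (x, t))).

Definition system_matrix (x : K) (s : 'rV[K]_n) : 'M[K]_m :=
  \sum_(i < n) (x - s ord0 i)^-1 *: A i s.

(** The derivative of [system_matrix] in the parameters along e; the double poles come from the
    motion of the poles. *)
Definition system_dparam (e : 'rV[K]_n) (x : K) (s : 'rV[K]_n) : 'M[K]_m :=
  \sum_(i < n) ((e ord0 i * (x - s ord0 i) ^- 2) *: A i s +
    (x - s ord0 i)^-1 *: dirderiv (A i) e s).

Lemma cut_plane_U p : cut_plane theta U p -> U p.2. Proof. by case. Qed.

Lemma cut_plane_at j p : cut_plane theta U p -> cut_plane_j theta U j p.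
Proof. by move=> [h1 h2]; split => //. Qed.

Lemma cder_system_matrix e x t z : cut_plane theta U (x, t + z *: e) ->
  cder (fun y => system_matrix x (t + y *: e)) z (system_dparam e x (t + z *: e)).
Proof.
move=> hx; apply: cder_sum => i.
have hA : cder (fun y => A i (t + y *: e)) z (dirderiv (A i) e (t + z *: e)).
  by apply: cder_line; apply: A_holo; exact: cut_plane_U hx.
have xi : x - (t + z *: e) ord0 i != 0.
  by rewrite subr_eq0; exact: cut_plane_pole (cut_plane_at i hx).
have ha : cder (fun y => (x - (t + y *: e) ord0 i)^-1) z (e ord0 i * (x - (t + z *: e) ord0 i) ^- 2).
  have ha := cder_affine (x - t ord0 i) (- e ord0 i) z.
  have E y : x - t ord0 i + y *: (- e ord0 i) = x - (t + y *: e) ord0 i.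
    by rewrite !mxE /GRing.scale /=; ring.
  have := @cder_comp _ _ _ (fun y => y^-1) z _ _ ha; rewrite !E => /(_ _ (cderV xi)).
  rewrite /GRing.scale /= mulrNN.
  rewrite (_ : (fun y => (x - t ord0 i + y * (- e ord0 i))^-1) = fun y => (x - (t + y *: e) ord0 i)^-1) //.
  by apply/funext => y; rewrite -E.
by have := cder_scale ha hA.
Qed.

Lemma cder_Yx x t : cut_plane theta U (x, t) ->
  cder (fun y => Y (y, t)) x (system_matrix x t *m Y (x, t)).
Proof.
move=> hp; apply/cder_translate.
have h := @cder_of_is_derive R _ _ (fun z => Y (z, t)) x 1 _ (Y_ode hp).
rewrite (_ : (fun z => Y (x + z, t)) = fun z : K => Y (x + z *: 1, t)); first exact: h.
by apply/funext => y; rewrite /GRing.scale /= mulr1.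
Qed.

Lemma dirderiv_Yx p : cut_plane theta U p ->
  dirderiv Y ((1, 0) : P) p = system_matrix p.1 p.2 *m Y p.
Proof.
case: p => x t hp; have h := cder_of_differentiable ((1, 0) : P) (Y_holo hp).
have /cder_translate h2 := cder_Yx hp.
have E z : Y ((x, t) + z *: ((1, 0) : P)) = Y (x + z, t).
  by rewrite pair_dir scaler0 addr0 mulr1.
exact: cder_unique (cder_ext E h) h2.
Qed.

Lemma cder_Yt e x t : cut_plane theta U (x, t) ->
  cder (fun y => dirderiv Y ((0, e) : P) (y, t)) x
    (system_dparam e x t *m Y (x, t) + system_matrix x t *m dirderiv Y ((0, e) : P) (x, t)).
Proof.
move=> hx; have near := cut_plane_near U_open hx.
have [r r0 hr] := line_near ((0, e) : P) near.
have lineE (y z : K) (s : 'rV[K]_n) : (y, s) + z *: ((0, e) : P) = (y, s + z *: e).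
  by rewrite pair_dir mulr0 addr0.
have Hn : holomorphic_near (x, t) Y.
  by move: near; apply: filterS => q; exact: Y_holo.
have := @mixed_differential _ _ _ Y ((x, t) : P) (1, 0) (0, e)
  (fun z => system_dparam e x (t + z *: e) *m Y (x, t + z *: e) +
     system_matrix x (t + z *: e) *m dirderiv Y ((0, e) : P) (x, t + z *: e)) Hn.
rewrite !scale0r !addr0 => H; apply/cder_translate.
have -> : (fun z => dirderiv Y ((0, e) : P) (x + z, t)) = fun z => dirderiv Y ((0, e) : P) ((x, t) + z *: ((1, 0) : P)).
  by apply/funext => z; rewrite pair_dir scaler0 addr0 mulr1.
apply: H; exists r => // z hz.
have hz' := hr _ hz; rewrite lineE in hz'.
have := cder_mulmx (cder_system_matrix hz') (_ : cder (fun y => Y (x, t + y *: e)) z _).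
have hY : cder (fun y => Y (x, t + y *: e)) z (dirderiv Y ((0, e) : P) (x, t + z *: e)).
  have := @cder_line _ _ _ Y ((x, t) : P) (0, e) z; rewrite lineE => /(_ (Y_holo hz')).
  by apply: cder_ext => y; rewrite lineE.
move=> /(_ _ hY); apply: cder_eq.
exists (r - rnorm z); first by rewrite subr_gt0.
move=> y hy; rewrite dirderiv_Yx ?lineE //; rewrite -lineE; apply: hr.
by apply: le_lt_trans (rnorm_sub y z) _; lra.
Qed.

Hypothesis U_distinct : forall t : 'rV[K]_n, U t ->
  forall i j : 'I_n, i != j -> t ord0 i != t ord0 j.
Variables (f : 'I_n -> 'I_n -> 'rV[K]_n -> K) (k : 'I_n).

Local Notation ek := (delta_mx ord0 k : 'rV[K]_n).

(* The deformation equation says that the defect vanishes. *)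
Definition defect (x : K) (t : 'rV[K]_n) : 'M[K]_m :=
  dirderiv Y ((0, ek) : P) (x, t) *m invmx (Y (x, t)) + (x - t ord0 k)^-1 *: A k t
  - (\sum_(j < n) f j k t * lg j (x, t))%:M.

Definition bracket (M N : 'M[K]_m) : 'M[K]_m := M *m N - N *m M.

Let comm_term (t : 'rV[K]_n) i : 'M[K]_m := (t ord0 i - t ord0 k)^-1 *: bracket (A i t) (A k t).

(* The double poles of [B, A_k] / (x - x_k) are removed by partial fractions;
   for i = k the bracket vanishes, so 0^-1 = 0 does no harm in comm_term. *)
Definition defect_coef (t : 'rV[K]_n) i (M : 'M[K]_m) : 'M[K]_m :=
  dirderiv (A i) ek t - (f i k t)%:M + bracket (A i t) M - comm_term t i
  + (if i == k then \sum_l comm_term t l else 0).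

Lemma cder_lgx j x t : cut_plane_j theta U j (x, t) ->
  cder (fun y => lg j (y, t)) x (x - t ord0 j)^-1.
Proof.
move=> hx; apply/cder_translate.
have := cder_lg ((1, 0) : P) hx; rewrite /= mxE subr0 mulr1.
by apply: cder_ext => z; rewrite pair_dir scaler0 addr0 mulr1.
Qed.

Lemma cder_defect_raw x t : cut_plane theta U (x, t) ->
  cder (fun y => defect y t) x
    (system_dparam ek x t + bracket (system_matrix x t) (dirderiv Y ((0, ek) : P) (x, t) *m invmx (Y (x, t)))
     - (x - t ord0 k) ^- 2 *: A k t - (\sum_(j < n) f j k t * (x - t ord0 j)^-1)%:M).
Proof.
move=> hx; have uY := Y_unit hx.
have xk : x != t ord0 k by exact: cut_plane_pole (cut_plane_at k hx).
have h1 := cder_mulmx (cder_Yt ek hx) (cder_invmx (cder_Yx hx) uY).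
have h2 := cder_scale (cder_pole xk) (cder_cst (A k t) x).
have h3 : cder (fun y => \sum_(j < n) f j k t * lg j (y, t)) x (\sum_(j < n) f j k t * (x - t ord0 j)^-1).
  apply: cder_sum => j; have := cder_scale (cder_cst (f j k t) x) (cder_lgx (cut_plane_at j hx)).
  by rewrite scale0r add0r.
have h4 := cder_scale h3 (cder_cst (1%:M : 'M[K]_m) x).
have := cderB (cderD h1 h2) h4.
set W := dirderiv Y _ (x, t); set V := invmx (Y (x, t)).
rewrite !scaler0 !addr0.
have -> : (system_dparam ek x t *m Y (x, t) + system_matrix x t *m W) *m V +
    W *m - (V *m (system_matrix x t *m Y (x, t)) *m V) =
    system_dparam ek x t + bracket (system_matrix x t) (W *m V).
  by rewrite mulmxDl /bracket addrA -!mulmxA mulmxV // !mulmx1 mulmxN.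
rewrite scaleNr scalemx1; apply: cder_ext => y.
by rewrite scalemx1.
Qed.

Lemma bracketZl (c : K) M N : bracket (c *: M) N = c *: bracket M N.
Proof. by rewrite /bracket -scalemxAl -scalemxAr -scalerBr. Qed.

Lemma bracket_suml (F : 'I_n -> 'M[K]_m) N : bracket (\sum_i F i) N = \sum_i bracket (F i) N.
Proof. by rewrite /bracket mulmx_suml mulmx_sumr -sumrB. Qed.

Lemma bracketD M N N' : bracket M (N + N') = bracket M N + bracket M N'.
Proof. by rewrite /bracket mulmxDl mulmxDr opprD addrACA. Qed.

Lemma bracketZr (c : K) M N : bracket M (c *: N) = c *: bracket M N.
Proof. by rewrite /bracket -scalemxAl -scalemxAr -scalerBr. Qed.

Lemma bracket_scalar M (c : K) : bracket M c%:M = 0.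
Proof. by rewrite /bracket mul_mx_scalar mul_scalar_mx subrr. Qed.

(** The logarithms form a scalar matrix and drop out of the bracket. The double pole A_k / (x -
    x_k)^2 caused by the motion of x_k cancels against the derivative of A_k / (x - x_k). The
    products 1 / ((x - x_i) (x - x_k)) left by the bracket are split into partial fractions. *)
Lemma cder_defect x t : cut_plane theta U (x, t) ->
  cder (fun y => defect y t) x (\sum_i (x - t ord0 i)^-1 *: defect_coef t i (defect x t)).
Proof.
move=> hx; have := cder_defect_raw hx.
set Z := _ *m invmx _; set D := defect x t.
pose a i := (x - t ord0 i)^-1; pose g := \sum_(j < n) f j k t * lg j (x, t).
have aE i : (x - t ord0 i)^-1 = a i by [].
have ZE : Z = D + (- a k) *: A k t + g%:M.
  by rewrite /D /defect -/Z -/(a k) -/g scaleNr addrAC subrK addrK.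
have brZ i : bracket (A i t) Z = bracket (A i t) D + (- a k) *: bracket (A i t) (A k t).
  by rewrite ZE bracketD bracketD bracketZr bracket_scalar addr0.
clearbody Z D.
have a0 i : x - t ord0 i != 0.
  by rewrite subr_eq0; exact: cut_plane_pole (cut_plane_at i hx).
suff -> : system_dparam ek x t + bracket (system_matrix x t) Z - (x - t ord0 k) ^- 2 *: A k t
     - (\sum_(j < n) f j k t * (x - t ord0 j)^-1)%:M =
     \sum_i (x - t ord0 i)^-1 *: defect_coef t i D by [].
have -> : bracket (system_matrix x t) Z = \sum_i a i *: bracket (A i t) D -
    \sum_i (a i * a k) *: bracket (A i t) (A k t).
  rewrite bracket_suml -sumrB; apply: eq_bigr => i _.
  by rewrite bracketZl brZ scalerDr scalerA mulrN scaleNr.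
have -> : system_dparam ek x t = a k ^+ 2 *: A k t + \sum_i a i *: dirderiv (A i) ek t.
  rewrite /system_dparam big_split /=; congr (_ + _).
  rewrite (bigD1 k) //= big1 ?addr0 => [|i ik]; rewrite mxE eqxx /=.
    by rewrite eqxx mul1r /a exprVn.
  by rewrite (negbTE ik) mul0r scale0r.
have -> : (\sum_(j < n) f j k t * (x - t ord0 j)^-1)%:M = \sum_i a i *: (f i k t)%:M :> 'M[K]_m.
  rewrite raddf_sum; apply: eq_bigr => i _.
  by rewrite scale_scalar_mx mulrC.
have -> : \sum_i (a i * a k) *: bracket (A i t) (A k t) =
    \sum_i a i *: comm_term t i - a k *: \sum_l comm_term t l.
  rewrite scaler_sumr -sumrB; apply: eq_bigr => i _.
  rewrite /comm_term !scalerA -scalerBl -mulrBl.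
  have [->|ik] := eqVneq i k; first by rewrite /bracket subrr !scaler0.
  congr (_ *: _); rewrite /a; field.
  by rewrite !a0 subr_eq0 (U_distinct (cut_plane_U hx) ik).
have -> : \sum_i (x - t ord0 i)^-1 *: defect_coef t i D =
   \sum_i a i *: dirderiv (A i) ek t - \sum_i a i *: (f i k t)%:M +
   \sum_i a i *: bracket (A i t) D - \sum_i a i *: comm_term t i + a k *: \sum_l comm_term t l.
  have pick (S : 'M[K]_m) : a k *: S = \sum_i a i *: (if i == k then S else 0).
    rewrite [RHS](bigD1 k) //= eqxx big1 ?addr0 // => i ik.
    by rewrite (negbTE ik) scaler0.
  rewrite pick -!(sumrB, big_split) /=; apply: eq_bigr => i _.
  by rewrite /defect_coef -/(a i) !(scalerDr, scalerN).
have E (p q r u v w : 'M[K]_m) : p + q + (r - (u - v)) - p - w = q - w + r - u + v.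
  by rewrite !(opprD, opprK) !addrA [LHS](ACl (2*7*3*4*5*1*6)) /= addrK.
by rewrite /a -exprVn; exact: E.
Qed.

Lemma defect_coef_lipschitz t : exists2 kap : R, 0 < kap & forall i M N,
  rnorm (defect_coef t i M - defect_coef t i N) <= kap * rnorm (M - N).
Proof.
have b0 i : 0 <= 2 * m%:R * rnorm (A i t) by rewrite !mulr_ge0 ?rnorm_ge0.
exists (\sum_i 2 * m%:R * rnorm (A i t) + 1).
  by rewrite ltr_wpDl // sumr_ge0 // => i _.
move=> i M N.
have -> : defect_coef t i M - defect_coef t i N = A i t *m (M - N) - (M - N) *m A i t.
  rewrite /defect_coef mulmxBl mulmxBr {1 2}/bracket.
  have E (p c q u v w z : 'M[K]_m) : p + (u - v) - c + q - (p + (w - z) - c + q) = u - w - (v - z).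
    by rewrite !(opprD, opprK) !addrA [LHS](ACl (2*7*3*8*1*6*5*10*9*4)) /= !addrK.
  exact: E.
apply: le_trans (rnormB _ _) _.
apply: le_trans (lerD (rnorm_mulmx _ _) (rnorm_mulmx _ _)) _.
apply: le_trans (_ : 2 * m%:R * rnorm (A i t) * rnorm (M - N) <= _).
  by rewrite le_eqVlt; apply/orP; left; apply/eqP; ring.
rewrite ler_wpM2r ?rnorm_ge0 // (bigD1 i) //= -addrA lerDl addr_ge0 //.
by rewrite sumr_ge0.
Qed.

End DeformationDefect.

(** * Exponents that evolve by scalar matrices *)

Section ScalarEvolution.
Context {R : realType} {n m : nat}.
Local Notation K := (Cplx R).
Variables (U : set 'rV[K]_n) (k : 'I_n).
Hypothesis U_open : open U.
Local Notation ek := (delta_mx ord0 k : 'rV[K]_n).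
Variables (G : 'rV[K]_n -> 'M[K]_m) (g : 'rV[K]_n -> K).
Hypothesis G_evol : forall t, U t -> is_partial k t G (g t)%:M.

Lemma cder_evolution t z : U (t + z *: ek) ->
  cder (fun y => G (t + y *: ek)) z (g (t + z *: ek))%:M.
Proof.
move=> /G_evol /cder_of_is_derive h; apply/cder_translate; move: h.
by apply: cder_ext => y; rewrite scalerDl addrA.
Qed.

(* The commutator with G t has derivative [g 1, G t] = 0. *)
Lemma evolution_comm t : U t -> exists2 r : R, 0 < r &
  forall z : K, rnorm z < r -> GRing.comm (G t) (G (t + z *: ek)).
Proof.
move=> Ut; have [r r0 hr] := line_near ek (open_nbhs_nbhs (conj U_open Ut)).
exists r => // z hz.
pose c (y : K) := bracket (G t) (G (t + y *: ek)).
have c0 : c 0 = 0 by rewrite /c scale0r addr0 /bracket subrr.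
have H : rnorm (c z - c 0) <= 0 * rnorm (z - 0).
  apply: mean_value_ineq => s /andP[s0 s1]; exists 0; last by rewrite rnorm0.
  have Us : U (t + segpt 0 z s *: ek).
    apply: hr; rewrite /segpt add0r subr0 rnormM rnorm_pos //.
    by apply: le_lt_trans hz; rewrite ler_piMl ?rnorm_ge0.
  have h := cder_evolution Us.
  have cG := cder_cst (G t) (segpt 0 z s).
  have := cderB (cder_mulmx cG h) (cder_mulmx h cG).
  by rewrite mul0mx add0r mulmx0 addr0 mul_mx_scalar mul_scalar_mx subrr.
move: H; rewrite c0 mul0r subr0 => /rnorm_le0/eqP.
by rewrite /c /bracket subr_eq0 => /eqP.
Qed.

(** With the logarithm l stationary, the exponent moves by a scalar matrix, so the exponential only
    acquires the scalar factor l g. It serves along the moving direction at a pole, and at fixed x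
    near infinity. *)
Lemma cder_expmx_evolution (l : K -> K) t : U t -> cder l 0 0 ->
  cder (fun z => expmx (l z *: G (t + z *: ek))) 0 ((l 0 * g t) *: expmx (l 0 *: G t)).
Proof.
move=> Ut hl; have Ut0 : U (t + 0 *: ek) by rewrite scale0r addr0.
have h := cder_scale hl (cder_evolution Ut0).
have [r r0 hr] := evolution_comm Ut.
have hc : exists2 r' : R, 0 < r' & forall y : K, rnorm (y - 0) < r' ->
    GRing.comm (l 0 *: G (t + 0 *: ek)) (l y *: G (t + y *: ek)).
  exists r; first exact: r0.
  move=> y; rewrite subr0 => /hr c.
  rewrite scale0r addr0 /GRing.comm -[LHS]scalemxAl -[RHS]scalemxAl -!scalemxAr.
  by rewrite !scalerA [l 0 * _]mulrC; congr (_ *: _).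
have := cder_expmx h hc.
rewrite (_ : _ *m _ = (l 0 * g t) *: expmx (l 0 *: G t)) //.
by rewrite !scale0r addr0 add0r -scalemxAr mul_mx_scalar scalerA.
Qed.

End ScalarEvolution.

(** * The defect at a pole *)

Section LocalBehaviour.
Context {R : realType} {n m : nat}.
Local Notation K := (Cplx R).
Local Notation P := (K * 'rV[K]_n)%type.
Variables (U : set 'rV[K]_n) (theta : R).
Hypotheses (U_open : open U)
  (U_distinct : forall t : 'rV[K]_n, U t ->
     forall i j : 'I_n, i != j -> t ord0 i != t ord0 j)
  (rays_disjoint : forall t : 'rV[K]_n, U t -> forall i j : 'I_n, i != j ->
     ray theta (t ord0 i) `&` ray theta (t ord0 j) = set0).
Variables (lg : 'I_n -> P -> K) (A : 'I_n -> 'rV[K]_n -> 'M[K]_m) (Y : P -> 'M[K]_m).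
Hypotheses
  (lg_holo : forall j, holomorphic_on (cut_plane_j theta U j) (lg j))
  (lg_exp : forall j x t, cut_plane_j theta U j (x, t) ->
     cexp (lg j (x, t)) = x - t ord0 j)
  (A_holo : forall k, holomorphic_on U (A k))
  (Y_holo : holomorphic_on (cut_plane theta U) Y)
  (Y_unit : forall p, cut_plane theta U p -> Y p \in unitmx)
  (Y_ode : forall x t, cut_plane theta U (x, t) ->
     is_derive x (1 : K) (fun z => Y (z, t))
       ((\sum_(k < n) (x - t ord0 k)^-1 *: A k t) *m Y (x, t))).
Variables (f : 'I_n -> 'I_n -> 'rV[K]_n -> K) (k : 'I_n).
Local Notation ek := (delta_mx ord0 k : 'rV[K]_n).

Lemma dirderivD (V W : normedModType K) (F : V -> W) p u v :
  dirderiv F (u + v) p = dirderiv F u p + dirderiv F v p.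
Proof. exact: linearD. Qed.

Lemma dirderivZ (V W : normedModType K) (F : V -> W) p (c : K) v :
  dirderiv F (c *: v) p = c *: dirderiv F v p.
Proof. exact: linearZ. Qed.

(** Disjointness of the rays keeps the other logarithms regular near x_j. *)
Lemma pole_off_other t i j : U t -> i != j -> cut_plane_j theta U i (t ord0 j, t).
Proof.
move=> Ut ij; split => //= h.
have : set0 (t ord0 j) by rewrite -(rays_disjoint Ut ij); split => //; exact: ray_refl.
by [].
Qed.

Section AtPole.
Variables (j : 'I_n) (L : 'rV[K]_n -> 'M[K]_m) (Yloc : P -> 'M[K]_m) (t : 'rV[K]_n).
Hypotheses (Ut : U t)
  (L_evol : forall t, U t -> is_partial k t L (f j k t)%:M)
  (Yloc_holo : holomorphic_near (t ord0 j, t) Yloc)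
  (Yloc_unit : Yloc (t ord0 j, t) \in unitmx)
  (Y_near_pole : \forall p \near (t ord0 j, t), cut_plane_j theta U j p ->
     Y p = Yloc p *m expmx (lg j p *: L p.2)).

(** The k-th parameter moves x_j only if j = k. *)
Let delta : K := (j == k)%:R.
Let v : P := (delta, ek).

(* Along v the point x moves with x_j, so that log (x - x_j) is constant. *)
Lemma dirderiv_near_pole : exists2 r : R, 0 < r & forall x, rnorm (x - t ord0 j) < r ->
  cut_plane theta U (x, t) ->
  dirderiv Y v (x, t) = dirderiv Yloc v (x, t) *m expmx (lg j (x, t) *: L t)
    + (f j k t * lg j (x, t)) *: Y (x, t) /\
  Y (x, t) = Yloc (x, t) *m expmx (lg j (x, t) *: L t).
Proof.
have [r1 r10 h1] := nbhs_rnorm Yloc_holo; have [r2 r20 h2] := nbhs_rnorm Y_near_pole.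
pose r := Num.min r1 r2.
have rr1 : r <= r1 by rewrite ge_min lexx.
have rr2 : r <= r2 by rewrite ge_min lexx orbT.
have r0 : 0 < r by rewrite lt_min r10.
clearbody r; exists r => // x hx hc.
have ball_x : rnorm ((x, t) - (t ord0 j, t)) < r.
  by apply: rnorm_pair_lt; rewrite /= ?subrr ?rnorm0.
have hcj := cut_plane_at j hc.
have dl := cder_lg U_open lg_holo lg_exp v hcj.
have {}dl : cder (fun z => lg j ((x, t) + z *: v)) 0 0.
  by move: dl; rewrite /= mxE eqxx /= -/delta subrr mulr0.
have dE := cder_expmx_evolution U_open L_evol Ut dl.
have dF := cder_of_differentiable v (h1 _ (lt_le_trans ball_x rr1)).
have dY := cder_of_differentiable v (Y_holo hc).
have prod := cder_mulmx dF dE.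
rewrite -/(dirderiv Y v (x, t)) in dY; rewrite -/(dirderiv Yloc v (x, t)) in prod.
have Ex : Y (x, t) = Yloc (x, t) *m expmx (lg j (x, t) *: L t).
  by apply: h2 => //; exact: lt_le_trans ball_x rr2.
split => //; have -> : dirderiv Y v (x, t) = dirderiv Yloc v (x, t) *m expmx (lg j ((x, t) + 0 *: v) *: L (t + 0 *: ek))
    + Yloc ((x, t) + 0 *: v) *m ((lg j ((x, t) + 0 *: v) * f j k t) *: expmx (lg j ((x, t) + 0 *: v) *: L t)).
  apply: cder_unique dY (cder_eq _ prod).
  have [r3 r30 h3] := line_near v (cut_plane_j_near U_open hcj).
  have nv := rnorm_ge0 v.
  have s0 : 0 < (r - rnorm ((x, t) - (t ord0 j, t))) / (rnorm v + 1).
    by rewrite divr_gt0 ?subr_gt0 //; lra.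
  exists (Num.min r3 ((r - rnorm ((x, t) - (t ord0 j, t))) / (rnorm v + 1))).
    by rewrite lt_min r30.
  move=> z; rewrite subr0 lt_min => /andP[/h3 hz]; rewrite ltr_pdivlMr; last by lra.
  move=> hz2; apply/esym; apply: h2 => //; apply: lt_le_trans rr2.
  rewrite addrAC; apply: le_lt_trans (rnormD _ _) _; rewrite rnormZ.
  have := rnorm_ge0 z; nra.
by rewrite !scale0r !addr0 -scalemxAr -Ex mulrC.
Qed.

(** What the defect reduces to near x_j. Moving along v instead of x_k alone costs delta times the
    system matrix, which for j = k removes the pole A_k / (x - x_k); the term f_jk log (x - x_j)
    cancels against the evolution of L_j. The remaining terms make sense at x_j and on its cut. *)
Definition regular_part (x : K) : 'M[K]_m :=
  dirderiv Yloc v (x, t) *m invmx (Yloc (x, t))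
  + (if j == k then - \sum_(i | i != j) (x - t ord0 i)^-1 *: A i t
     else (x - t ord0 k)^-1 *: A k t)
  - (\sum_(i | i != j) f i k t * lg i (x, t))%:M.

Lemma defect_regular : exists2 r : R, 0 < r & forall x, rnorm (x - t ord0 j) < r ->
  cut_plane theta U (x, t) -> defect lg A Y f k x t = regular_part x.
Proof.
have [r1 r10 h1] := dirderiv_near_pole; exists r1 => // x hx hc.
have [h2 Ex] := h1 _ hx hc; have uY := Y_unit hc.
set E := expmx _ in h2 Ex.
have uYl : Yloc (x, t) \in unitmx by move: uY; rewrite Ex unitmx_mul => /andP[].
(* The multivalued exponential factor disappears from the logarithmic derivative. *)
have EV : E *m invmx (Y (x, t)) = invmx (Yloc (x, t)).
  by rewrite -[E](mulKmx uYl) -Ex -mulmxA mulmxV // mulmx1.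
have vE : v = ((0, ek) : P) + delta *: ((1, 0) : P).
  by congr pair => /=; rewrite ?scaler0 ?addr0 // add0r /GRing.scale /= mulr1.
have W : dirderiv Y ((0, ek) : P) (x, t) = dirderiv Yloc v (x, t) *m E
    + (f j k t * lg j (x, t)) *: Y (x, t) - delta *: (system_matrix A x t *m Y (x, t)).
  by rewrite -h2 vE dirderivD dirderivZ (dirderiv_Yx Y_holo Y_ode hc) addrK.
rewrite /defect W /regular_part !mulmxBl mulmxDl -mulmxA EV -!scalemxAl -mulmxA.
rewrite mulmxV // mulmx1 scalemx1 (bigD1 j) //= raddfD /=.
set p := _ *m invmx _; set q := _%:M; set r := (\sum_(i | _) _)%:M.
have C (a b c d : 'M[K]_m) : p + q - a + b - (q + r) = p + (b - a) - r.
  by rewrite opprD !addrA [LHS](ACl (1*4*3*6*2*5)) /= addrK.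
rewrite C //; congr (_ + _ - _).
have -> : system_matrix A x t = (x - t ord0 j)^-1 *: A j t +
    \sum_(i | i != j) (x - t ord0 i)^-1 *: A i t by rewrite /system_matrix (bigD1 j).
rewrite /delta; case: (eqVneq j k) => [<-|jk].
  by rewrite scale1r opprD addrA subrr add0r.
by rewrite scale0r subr0.
Qed.

Lemma ccont_regular_part : exists2 r : R, 0 < r &
  forall x, rnorm (x - t ord0 j) < r -> ccont regular_part x.
Proof.
have [r1 [C [r10 h1]]] := differential_lipschitz ((1, 0) : P) v Yloc_holo.
have [r2 r20 h2] := nbhs_rnorm Yloc_holo.
have [r3 r30 h3] := invmx_near Yloc_unit.
have [r4 r40 h4] : exists2 r : R, 0 < r & forall x, rnorm (x - t ord0 j) < r ->
    rnorm (Yloc (x, t) - Yloc (t ord0 j, t)) < r3.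
  have r320 : 0 < r3 / 2 by rewrite divr_gt0.
  have [r r0 hr] := ccont_of_differentiable (nbhs_singleton Yloc_holo) r320.
  exists r => // x hx; apply: le_lt_trans (hr (x, t) _) _; last by lra.
  by apply: rnorm_pair_lt; rewrite /= ?subrr ?rnorm0.
have [|r5 r50 h5] := @fin_radius _ n (fun i r => i != j -> forall x, rnorm (x - t ord0 j) < r ->
    cut_plane_j theta U i (x, t)).
  move=> i; have [->|ij] := eqVneq i j; first by exists 1.
  have [r r0 hr] := nbhs_rnorm (cut_plane_j_near U_open (pole_off_other Ut ij)).
  exists r => // r' /andP[r'0 r'r] _ x hx; apply: hr; apply: lt_le_trans r'r.
  by apply: rnorm_pair_lt; rewrite /= ?subrr ?rnorm0.
exists (Num.min (Num.min r1 r2) (Num.min r4 r5)); first by rewrite !lt_min r10 r20 r40.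
move=> x; rewrite !lt_min => /andP[/andP[x1 x2] /andP[x4 x5]].
have off i : i != j -> cut_plane_j theta U i (x, t).
  by move=> ij; apply: (h5 i r5) => //; rewrite r50 lexx.
have pairx y : (y, t) = (t ord0 j, t) + (y - t ord0 j) *: ((1, 0) : P).
  by rewrite pair_dir scaler0 addr0 mulr1 subrKC.
(* Cauchy's estimates enter here: the Lipschitz bound along x makes this parameter derivative
   continuous. *)
have c1 : ccont (fun y => dirderiv Yloc v (y, t)) x.
  move=> e e0; pose C' := Num.max C 1.
  have C0 : 0 < C' by rewrite lt_max ltr01 orbT.
  have CC : C <= C' by rewrite le_max lexx.
  clearbody C'; exists (Num.min (e / C') (r1 - rnorm (x - t ord0 j))).
    by rewrite lt_min divr_gt0 // subr_gt0.
  move=> y; rewrite lt_min ltr_pdivlMr // mulrC => /andP[hy1 hy2].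
  have yr : rnorm (y - t ord0 j) <= r1.
    by apply: le_trans (rnorm_tri x _ _) _; lra.
  rewrite (pairx y) (pairx x); apply: le_trans (h1 _ _ (ltW x1) yr) _.
  rewrite opprB addrA subrK; apply: le_trans (ltW hy1).
  by rewrite ler_wpM2r ?rnorm_ge0.
have c2 : ccont (fun y => Yloc (y, t)) x.
  have d : differentiable Yloc (x, t).
    by apply: h2; apply: rnorm_pair_lt; rewrite /= ?subrr ?rnorm0.
  apply: ccont_comp (ccont_of_differentiable d) => e e0.
  exists e => // y hy; apply: ltW; apply: rnorm_pair_lt => //=.
  by rewrite subrr rnorm0.
have [uYl _] := h3 _ (h4 _ x4).
apply: ccontB; first apply: ccontD.
- by apply: ccont_mulmx => //; exact: ccont_invmx.
- have [jk|jk] := eqVneq j k.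
    apply: ccontN; apply: ccont_sum => i ij; apply: ccont_scale (ccont_cst _ _).
    exact: cder_ccont (cder_pole (cut_plane_pole (off i ij))).
  apply: ccont_scale (ccont_cst _ _).
  by apply: cder_ccont (cder_pole (cut_plane_pole (off k _))); rewrite eq_sym.
have c3 : ccont (fun y => \sum_(i | i != j) f i k t * lg i (y, t)) x.
  apply: ccont_sum => i ij; apply: ccont_scale (ccont_cst _ _) _.
  exact: cder_ccont (cder_lgx U_open lg_holo lg_exp (off i ij)).
have := ccont_scale c3 (ccont_cst (1%:M : 'M[K]_m) x); apply: ccont_eq; exists 1 => // y _.
by rewrite scalemx1.
Qed.

End AtPole.

End LocalBehaviour.

(** * The defect at infinity *)

Section AtInfinity.
Context {R : realType} {n m : nat}.
Local Notation K := (Cplx R).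
Local Notation P := (K * 'rV[K]_n)%type.
Variables (U : set 'rV[K]_n) (theta : R).
Hypotheses (U_open : open U).
Variables (lg : 'I_n -> P -> K) (lginf : K -> K)
  (A : 'I_n -> 'rV[K]_n -> 'M[K]_m) (Y : P -> 'M[K]_m).
Hypotheses
  (Y_holo : holomorphic_on (cut_plane theta U) Y)
  (Y_unit : forall p, cut_plane theta U p -> Y p \in unitmx).
Variables (f : 'I_n -> 'I_n -> 'rV[K]_n -> K) (k : 'I_n).
Local Notation ek := (delta_mx ord0 k : 'rV[K]_n).
Variables (Linf : 'rV[K]_n -> 'M[K]_m) (Yinf : P -> 'M[K]_m) (t : 'rV[K]_n).
Hypotheses (Ut : U t)
  (lg_compat : forall j (e : R), 0 < e -> exists r : R, forall x : K,
     (r%:C : K) < `|x| -> back_half_plane theta x -> `|lg j (x, t) - lginf x| < (e%:C : K))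
  (Yinf_holo : holomorphic_at_infty Yinf t)
  (Yinf_normalized : forall s : 'rV[K]_n, U s -> exists r M : R,
     forall x : K, (r%:C : K) < `|x| -> `|Yinf (x, s) - 1%:M| <= (M%:C : K) * `|x^-1|)
  (Y_near_infty : exists r : R, \forall s \near t,
     forall x : K, (r%:C : K) < `|x| -> back_half_plane theta x ->
     Y (x, s) = Yinf (x, s) *m expmx (lginf x *: - Linf s))
  (Linf_evol : forall t : 'rV[K]_n, U t ->
     is_partial k t Linf (- (\sum_(j < n) f j k t)%:M)).

Definition far (Q : K -> Prop) : Prop :=
  exists rho : R, forall x, back_half_plane theta x -> rho < rnorm x -> Q x.

Lemma far_and (Q1 Q2 : K -> Prop) : far Q1 -> far Q2 -> far (fun x => Q1 x /\ Q2 x).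
Proof.
move=> [r1 h1] [r2 h2]; exists (Num.max r1 r2) => x bx.
by rewrite gt_max => /andP[/h1 k1 /h2 k2]; auto.
Qed.

Lemma far_imply (Q1 Q2 : K -> Prop) : (forall x, Q1 x -> Q2 x) -> far Q1 -> far Q2.
Proof. by move=> h [r hr]; exists r => x bx /hr hx; apply: h; exact: hx. Qed.

Lemma far_gt (r : R) : far (fun x => r < rnorm x).
Proof. by exists r. Qed.

Lemma far_inv (c e : R) : 0 < e -> far (fun x => c / rnorm x <= e).
Proof.
move=> e0; exists (`|c| / e) => x _ hx.
have x0 : 0 < rnorm x by apply: le_lt_trans hx; rewrite divr_ge0 // ltW.
rewrite ler_pdivrMr // mulrC -ler_pdivrMr //.
by apply: le_trans (ltW hx); rewrite ler_wpM2r ?invr_ge0 ?(ltW e0) // ler_norm.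
Qed.

(** If a point of the half-plane lies on the ray of t_j, then after rotation it has the height of
    t_j and Re t_j <= Re x < 0, so |x| <= |t_j|. *)
Lemma far_cut_plane : far (fun x => cut_plane theta U (x, t)).
Proof.
exists (rnorm t) => x bx hx; split => // j /rayP[].
rewrite mulrBr ReB ImB => /eqP; rewrite subr_eq0 => /eqP I0 R0.
have : rnorm x <= rnorm (t ord0 j).
  have E y : rnorm y = rnorm (cis (- theta) * y) by rewrite rnormM rnorm_cis mul1r.
  rewrite (E x) (E (t ord0 j)) !rnorm_complex I0; apply: ler_wsqrtr.
  rewrite lerD2r -ler_sqrt ?sqr_ge0 // !sqrtr_sqr.
  rewrite /back_half_plane /= in bx.
  rewrite !ler0_norm; lra.
have := rnorm_entry t ord0 j; lra.
Qed.

Lemma far_compat j (e : R) : 0 < e -> far (fun x => rnorm (lg j (x, t) - lginf x) <= e).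
Proof.
move=> /(lg_compat j)[r hr]; exists r => x bx hx.
have := hr x _ bx; rewrite !rnormE -![_%:C]/(ofR _) !ltr_ofR => h.
by apply: ltW; apply: h.
Qed.

Lemma far_all (Q : 'I_n -> K -> Prop) : (forall j, far (Q j)) -> far (fun x => forall j, Q j x).
Proof.
move=> /choice[r hr]; exists (\sum_j `|r j|) => x bx hx j; apply: hr => //.
apply: le_lt_trans hx; apply: le_trans (ler_norm _) _.
by rewrite (bigD1 j) //= lerDl sumr_ge0.
Qed.

(** In the chart w = 1/x the factor [G] equals 1 at w = 0 for every nearby parameter. Its parameter
    derivative thus vanishes at w = 0 and is O(|w|), and X is this derivative times the inverse of
    [G]. The logarithmic term is the evolution of the exponent, taken at fixed x. *)
Lemma expansion_at_infinity (e : R) : 0 < e -> far (fun x => exists2 X : 'M[K]_m, rnorm X <= e &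
  dirderiv Y ((0, ek) : P) (x, t) *m invmx (Y (x, t)) = X + (lginf x * \sum_(j < n) f j k t)%:M).
Proof.
move=> e0; have [G [G_holo G_eq]] := Yinf_holo.
have [r1 r10 h1] := nbhs_rnorm G_holo; have [r2 r20 h2] := nbhs_rnorm G_eq.
have [r3 r30 h3] := nbhs_rnorm (open_nbhs_nbhs (conj U_open Ut)).
have pair_near (w : K) (s : 'rV[K]_n) (r : R) : rnorm w < r -> rnorm (s - t) < r ->
    rnorm ((w, s) - ((0, t) : P)) < r.
  by move=> hw hs; apply: rnorm_pair_lt; rewrite //= subr0.
(* [G] is tied to [Yinf] for w != 0 only, so its value at w = 0 is reached as a limit along small
   positive w, where the normalisation applies. *)
have G1 s : rnorm (s - t) < r1 -> rnorm (s - t) < r2 -> rnorm (s - t) < r3 -> G (0, s) = 1%:M.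
  move=> s1 s2 s3; apply/eqP; rewrite -subr_eq0; apply/eqP; apply: rnorm_small0 => d d0.
  have [r [M hrM]] := Yinf_normalized (h3 _ s3).
  have d20 : 0 < d / 2 by rewrite divr_gt0.
  have ds : differentiable G (0, s) by apply: h1; apply: pair_near; rewrite ?rnorm0.
  have [q q0 hq] := ccont_of_differentiable ds d20.
  have m0 : 0 < Num.min (Num.min q r2) (Num.min (`|r| + 1)^-1 (d / 2 / (`|M| + 1))).
    by rewrite !lt_min q0 r20 invr_gt0 !divr_gt0 // ltr_wpDl.
  set u := Num.min (Num.min q r2) _ in m0; pose w := ofR (u / 2).
  have u20 : 0 < u / 2 by rewrite divr_gt0.
  have w0 : w != 0 by rewrite ofR_eq0 gt_eqF.
  have wn : rnorm w = u / 2 by rewrite rnorm_pos // ltW.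
  have wu : u / 2 < u by rewrite ltr_pdivrMr // ltr_pMr // ltr1n.
  move: wu; rewrite -wn /u !lt_min => /andP[/andP[wq wr2] /andP[wr wM]].
  have E := h2 _ (pair_near w s r2 wr2 s2) w0; rewrite /= in E.
  apply: le_trans (rnorm_tri (G (w, s)) _ _) _; rewrite [d]splitr; apply: lerD.
    rewrite rnormC; apply: hq; apply: rnorm_pair_lt; rewrite /= ?subr0 //.
    by rewrite subrr rnorm0.
  rewrite -E; have := hrM w^-1; rewrite !rnormE -![_%:C]/(ofR _) -ofRM ltr_ofR ler_ofR invrK.
  rewrite rnormV => k1; apply: le_trans (k1 _) _.
    apply: le_lt_trans (ler_norm r) _; apply: lt_trans (_ : `|r| < `|r| + 1) _.
      by rewrite ltrDl.
    by rewrite -[ltLHS]invrK ltf_pV2 ?posrE ?wn ?invr_gt0 // -?wn // ltr_wpDl.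
  have M0 : 0 < `|M| + 1 by rewrite ltr_wpDl.
  move: wM; rewrite ltr_pdivlMr // => wM; apply: le_trans (ltW wM).
  rewrite mulrC ler_wpM2l ?rnorm_ge0 //; have := ler_norm M; lra.
have sub_t z : t + z *: ek - t = z *: ek by rewrite addrAC subrr add0r.
have near_t (r : R) : 0 < r -> \forall s \near t, rnorm (s - t) < r.
  by move=> r0; apply: (near_rnorm r0).
have dG0 : dirderiv G ((0, ek) : P) (0, t) = 0.
  have d0 : differentiable G (0, t) by exact: nbhs_singleton G_holo.
  apply: cder_unique (cder_of_differentiable _ d0) _.
  have [q1 q10 hq1] := line_near ek (near_t _ r10).
  have [q2 q20 hq2] := line_near ek (near_t _ r20).
  have [q3 q30 hq3] := line_near ek (near_t _ r30).
  apply: cder_eq (cder_cst 1%:M 0); exists (Num.min q1 (Num.min q2 q3)).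
    by rewrite !lt_min q10 q20.
  move=> z; rewrite subr0 !lt_min => /and3P[/hq1 k1 /hq2 k2 /hq3 k3].
  by rewrite pair_dir mulr0 addr0 G1.
have [r4 [C [r40 h4]]] := differential_lipschitz ((1, 0) : P) ((0, ek) : P) G_holo.
have dG_bound w : rnorm w <= r4 -> rnorm (dirderiv G ((0, ek) : P) (w, t)) <= C * rnorm w.
  move=> wr; have := h4 0 w; rewrite rnorm0 => /(_ (ltW r40) wr).
  by rewrite scale0r addr0 pair_dir dG0 !subr0 add0r mulr1 scaler0 addr0.
have [r5 r50 h5] := invmx_near (unitmx1 K m).
have r520 : 0 < r5 / 2 by rewrite divr_gt0.
have [r6 r60 h6] := ccont_of_differentiable (nbhs_singleton G_holo) r520.
have G0t : G (0, t) = 1%:M by apply: G1; rewrite subrr rnorm0.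
have Gw w : rnorm w < r6 -> G (w, t) \in unitmx /\ rnorm (invmx (G (w, t))) <= 2 * rnorm (invmx (1%:M : 'M[K]_m)).
  move=> wr; apply: h5; rewrite -G0t; apply: le_lt_trans (h6 _ _) _; last by lra.
  by apply: pair_near; rewrite // subrr rnorm0.
pose c := m%:R * C * (2 * rnorm (invmx (1%:M : 'M[K]_m))).
have [rY hY] := Y_near_infty.
have Linf'_evol s : U s -> is_partial k s (fun s => - Linf s) (\sum_(j < n) f j k s)%:M.
  move=> /Linf_evol/cder_of_is_derive/cderN; rewrite opprK => h.
  exact: is_derive_of_cder h.
have inv_small (r : R) : 0 < r -> far (fun x => rnorm x^-1 < r).
  move=> r0; have r20' : 0 < r / 2 by rewrite divr_gt0.
  apply: far_imply (far_inv 1 r20') => x; rewrite div1r rnormV; lra.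
have := far_and (far_and (inv_small _ r10) (inv_small _ r20)) (far_and (inv_small _ r40) (inv_small _ r60)).
move=> /far_and /(_ (far_and far_cut_plane (far_inv c e0))).
move=> /far_and /(_ (far_and (far_gt rY) (far_gt 0))) [rho hrho].
exists rho => x bx hx.
have [[[[x1 x2] [x4 x6]] [hc hce]] [hxY x_gt0]] := hrho x bx hx.
have x0 : x != 0 by rewrite -rnorm_gt0.
have w0 : x^-1 != 0 by rewrite invr_eq0.
set w := x^-1 in x1 x2 x4 x6 w0.
have dGw : differentiable G (w, t).
  by apply: h1; apply: pair_near; rewrite ?subrr ?rnorm0.
have dE := cder_expmx_evolution U_open Linf'_evol Ut (cder_cst (lginf x) 0).
have prod := cder_mulmx (cder_of_differentiable ((0, ek) : P) dGw) dE.
have dY := cder_of_differentiable ((0, ek) : P) (Y_holo hc).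
have local s : rnorm (s - t) < r2 -> Y (x, s) = Yinf (x, s) *m expmx (lginf x *: - Linf s) ->
    Y (x, s) = G (w, s) *m expmx (lginf x *: - Linf s).
  by move=> s2 ->; rewrite -(h2 _ (pair_near _ _ _ x2 s2)) //= invrK.
have hYs : \forall s \near t, Y (x, s) = G (w, s) *m expmx (lginf x *: - Linf s).
  near=> s; apply: local; first by near: s; exact: near_t.
  by have := near hY s; apply => //; rewrite rnormE -[_%:C]/(ofR _) ltr_ofR.
have Ext := nbhs_singleton hYs.
have [q q0 hq] := line_near ek hYs.
have W : dirderiv Y ((0, ek) : P) (x, t) = dirderiv G ((0, ek) : P) (w, t) *m expmx (lginf x *: - Linf t)
    + (lginf x * \sum_(j < n) f j k t) *: Y (x, t).
  have -> : dirderiv Y ((0, ek) : P) (x, t) = dirderiv G ((0, ek) : P) (w, t) *m expmx (lginf x *: - Linf (t + 0 *: ek))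
      + G ((w, t) + 0 *: ((0, ek) : P)) *m ((lginf x * \sum_(j < n) f j k t) *: expmx (lginf x *: - Linf t)).
    apply: cder_unique dY (cder_eq _ prod); exists q; first exact: q0.
    move=> z; rewrite subr0 => hz.
    have dirE y : (y, t) + z *: ((0, ek) : P) = (y, t + z *: ek) by rewrite pair_dir mulr0 addr0.
    by rewrite (dirE x) (dirE w); apply/esym; exact: (hq _ hz).
  by rewrite !scale0r !addr0 -scalemxAr -Ext.
have uY := Y_unit hc; have uG : G (w, t) \in unitmx by have [] := Gw w x6.
set E := expmx _ in Ext W.
have EV : E *m invmx (Y (x, t)) = invmx (G (w, t)).
  by rewrite -[E](mulKmx uG) -Ext -mulmxA mulmxV // mulmx1.
exists (dirderiv G ((0, ek) : P) (w, t) *m invmx (G (w, t))); last first.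
  by rewrite W mulmxDl -mulmxA EV -scalemxAl mulmxV // scalemx1.
apply: le_trans (rnorm_mulmx _ _) _.
have [_ iG] := Gw w x6.
apply: le_trans (_ : m%:R * (C * rnorm w) * (2 * rnorm (invmx (1%:M : 'M[K]_m))) <= _).
  apply: ler_pM => //; rewrite ?mulr_ge0 ?rnorm_ge0 //.
  by rewrite ler_wpM2l // dG_bound // ltW.
move: hce; rewrite /c -rnormV -/w; congr (_ <= _); ring.
Unshelve. all: by end_near.
Qed.

(** The growth log x sum_j f_jk of the logarithmic derivative pairs with the logarithms of the
    defect; by compatibility of the branches each log (x - x_j) - log x tends to 0, as does A_k / (x
    - x_k). *)
Lemma defect_near_infinity (e : R) : 0 < e ->
  far (fun x => rnorm (defect lg A Y f k x t) <= e).
Proof.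
move=> e0; have e30 : 0 < e / 3 by rewrite divr_gt0.
pose F := \sum_(j < n) rnorm (f j k t) + 1.
have F0 : 0 < F by rewrite ltr_wpDl // sumr_ge0 // => j _; exact: rnorm_ge0.
have eF0 : 0 < e / 3 / F by rewrite divr_gt0.
have c1 := far_all (fun j => far_compat j eF0).
have c2 := far_inv (2 * rnorm (A k t)) e30.
have c3 := far_gt (2 * rnorm (t ord0 k)).
have := far_and (far_and (expansion_at_infinity e30) c1) (far_and (far_and c2 c3) (far_gt 0)).
apply: far_imply => x [[[X X_small EX] hlg] [[hA ht] x_gt0]].
have -> : defect lg A Y f k x t = X + (x - t ord0 k)^-1 *: A k t
    - (\sum_(j < n) f j k t * (lg j (x, t) - lginf x))%:M.
  rewrite /defect EX.
  have -> : \sum_(j < n) f j k t * (lg j (x, t) - lginf x) =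
      \sum_(j < n) f j k t * lg j (x, t) - lginf x * \sum_(j < n) f j k t.
    by rewrite mulr_sumr -sumrB; apply: eq_bigr => j _; rewrite mulrBr [lginf x * _]mulrC.
  rewrite raddfB /= opprB; set p := _%:M; set q := _%:M; set r := _ *: _.
  by rewrite !addrA [LHS](ACl (1*3*2*4)).
apply: le_trans (rnormB _ _) _; apply: le_trans (lerD (rnormD _ _) (lexx _)) _.
have n1 : rnorm ((x - t ord0 k)^-1 *: A k t) <= e / 3.
  apply: le_trans hA; rewrite rnormZ rnormV.
  have xt : rnorm x / 2 <= rnorm (x - t ord0 k).
    by have := rnorm_sub x (t ord0 k); lra.
  have xt0 : 0 < rnorm x / 2 by rewrite divr_gt0.
  rewrite (_ : 2 * rnorm (A k t) / rnorm x = (rnorm x / 2)^-1 * rnorm (A k t)); last first.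
    by field; rewrite gt_eqF.
  rewrite ler_wpM2r ?rnorm_ge0 // lef_pV2 ?posrE //.
  exact: lt_le_trans xt.
have n2 : rnorm ((\sum_(j < n) f j k t * (lg j (x, t) - lginf x))%:M : 'M[K]_m) <= e / 3.
  apply: le_trans (rnorm_scalar_mx _ _) _; apply: le_trans (rnorm_sum _ _ _) _.
  apply: le_trans (_ : \sum_(j < n) rnorm (f j k t) * (e / 3 / F) <= _).
    by apply: ler_sum => j _; rewrite rnormM ler_wpM2l ?rnorm_ge0.
  rewrite -mulr_suml mulrC mulrAC ler_pdivrMr // ler_wpM2l ?(ltW e30) //.
  by rewrite /F lerDl.
lra.
Qed.

End AtInfinity.

(** * Rotation to horizontal cuts, and the conclusion *)

Section Rotation.
Context {R : realType} {n m : nat}.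
Local Notation K := (Cplx R).

Lemma off_cuts_rotated (U : set 'rV[K]_n) theta t z : U t ->
  off_cuts (fun j => cis (- theta) * t ord0 j) z <->
  cut_plane theta U (cis theta * z, t).
Proof.
have E j : cis (- theta) * (cis theta * z - t ord0 j) = z - cis (- theta) * t ord0 j.
  by rewrite mulrBr cisN_mulK.
move=> Ut; split=> [h|[_ h] j [h1 h2]].
  split=> // j /rayP /=; rewrite E ReB ImB => -[/eqP]; rewrite subr_eq0 subr_ge0 => /eqP h1 h2.
  exact: (h j).
by apply: (h j); apply/rayP => /=; rewrite E ReB ImB h1 subrr subr_ge0.
Qed.

(** Of two rays at the same height, one contains the endpoint of the other. *)
Lemma heights_distinct theta (t : 'rV[K]_n) :
  (forall i j : 'I_n, i != j -> ray theta (t ord0 i) `&` ray theta (t ord0 j) = set0) ->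
  forall i j : 'I_n, i != j ->
  complex.Im (cis (- theta) * t ord0 i) <> complex.Im (cis (- theta) * t ord0 j).
Proof.
move=> disj; have main i j : i != j ->
    complex.Re (cis (- theta) * t ord0 i) <= complex.Re (cis (- theta) * t ord0 j) ->
    complex.Im (cis (- theta) * t ord0 i) <> complex.Im (cis (- theta) * t ord0 j).
  move=> ij hR hI; have : set0 (t ord0 j); last by [].
  rewrite -(disj i j ij); split; last exact: ray_refl.
  by apply/rayP; rewrite mulrBr ReB ImB hI subrr subr_ge0.
move=> i j ij.
have [h|/ltW h] := leP (complex.Re (cis (- theta) * t ord0 i)) (complex.Re (cis (- theta) * t ord0 j)).
  exact: main.
by move=> hI; apply: (main j i) => //; rewrite eq_sym.
Qed.

End Rotation.

Theorem theorem2 (R : realType) (n m : nat)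
  (n_gt0 : (0 < n)%N) (m_gt0 : (0 < m)%N)
  (* configurations, and the direction of the cuts *)
  (U : set 'rV[Cplx R]_n) (U_open : open U) (U_conn : connected U)
  (U_distinct : forall t : 'rV[Cplx R]_n, U t ->
     forall i j : 'I_n, i != j -> t ord0 i != t ord0 j)
  (theta : R)
  (rays_disjoint : forall t : 'rV[Cplx R]_n, U t -> forall i j : 'I_n, i != j ->
     ray theta (t ord0 i) `&` ray theta (t ord0 j) = set0)
  (* branches of log (x - x_j) and of log x *)
  (lg : 'I_n -> Cplx R * 'rV[Cplx R]_n -> Cplx R)
  (lg_holo : forall j, holomorphic_on (cut_plane_j theta U j) (lg j))
  (lg_exp : forall j x t, cut_plane_j theta U j (x, t) ->
     cexp (lg j (x, t)) = x - t ord0 j)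
  (lginf : Cplx R -> Cplx R)
  (lginf_holo : holomorphic_on (back_half_plane theta) lginf)
  (lginf_exp : forall x, back_half_plane theta x -> cexp (lginf x) = x)
  (lg_compat : forall t : 'rV[Cplx R]_n, U t -> forall j (e : R), 0 < e ->
     exists r : R, forall x : Cplx R,
       (r%:C : Cplx R) < `|x| -> back_half_plane theta x ->
       `|lg j (x, t) - lginf x| < (e%:C : Cplx R))
  (* the system *)
  (A : 'I_n -> 'rV[Cplx R]_n -> 'M[Cplx R]_m)
  (A_holo : forall k, holomorphic_on U (A k))
  (Y : Cplx R * 'rV[Cplx R]_n -> 'M[Cplx R]_m)
  (Y_holo : holomorphic_on (cut_plane theta U) Y)
  (Y_unit : forall p, cut_plane theta U p -> Y p \in unitmx)
  (Y_ode : forall x t, cut_plane theta U (x, t) ->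
     is_derive x (1 : Cplx R) (fun z => Y (z, t))
       ((\sum_(k < n) (x - t ord0 k)^-1 *: A k t) *m Y (x, t)))
  (* local exponents and local expansions *)
  (L : 'I_n -> 'rV[Cplx R]_n -> 'M[Cplx R]_m)
  (L_holo : forall j, holomorphic_on U (L j))
  (Linf : 'rV[Cplx R]_n -> 'M[Cplx R]_m)
  (Linf_holo : holomorphic_on U Linf)
  (Yloc : 'I_n -> Cplx R * 'rV[Cplx R]_n -> 'M[Cplx R]_m)
  (Yloc_holo : forall (j : 'I_n) (t : 'rV[Cplx R]_n), U t ->
     holomorphic_near (t ord0 j, t) (Yloc j))
  (Yloc_unit : forall (j : 'I_n) (t : 'rV[Cplx R]_n), U t ->
     Yloc j (t ord0 j, t) \in unitmx)
  (Y_near_pole : forall (j : 'I_n) (t : 'rV[Cplx R]_n), U t ->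
     \forall p \near (t ord0 j, t),
     cut_plane_j theta U j p ->
     Y p = Yloc j p *m expmx (lg j p *: L j p.2))
  (Yinf : Cplx R * 'rV[Cplx R]_n -> 'M[Cplx R]_m)
  (Yinf_holo : forall t : 'rV[Cplx R]_n, U t -> holomorphic_at_infty Yinf t)
  (Yinf_normalized : forall t : 'rV[Cplx R]_n, U t -> exists r M : R,
     forall x : Cplx R, (r%:C : Cplx R) < `|x| ->
       `|Yinf (x, t) - 1%:M| <= (M%:C : Cplx R) * `|x^-1|)
  (Y_near_infty : forall t : 'rV[Cplx R]_n, U t ->
     exists r : R, \forall s \near t,
     forall x : Cplx R, (r%:C : Cplx R) < `|x| -> back_half_plane theta x ->
     Y (x, s) = Yinf (x, s) *m expmx (lginf x *: - Linf s))
  (* evolution of the local exponents *)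
  (f : 'I_n -> 'I_n -> 'rV[Cplx R]_n -> Cplx R)
  (L_evol : forall (j k : 'I_n) (t : 'rV[Cplx R]_n), U t ->
     is_partial k t (L j) (f j k t)%:M)
  (Linf_evol : forall (k : 'I_n) (t : 'rV[Cplx R]_n), U t ->
     is_partial k t Linf (- (\sum_(j < n) f j k t)%:M)) :
  forall (k : 'I_n) (x : Cplx R) (t : 'rV[Cplx R]_n), cut_plane theta U (x, t) ->
    is_partial k t (fun s => Y (x, s))
      ((- ((x - t ord0 k)^-1 *: A k t)
        + (\sum_(j < n) f j k t * lg j (x, t))%:M) *m Y (x, t)).
Proof.
move=> k x t hx; have Ut : U t := cut_plane_U hx.
pose a j : Cplx R := cis (- theta) * t ord0 j.
pose Psi z := defect lg A Y f k (cis theta * z) t.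
have [kap kap0 N_lip] := defect_coef_lipschitz A f k t.
have offE z := off_cuts_rotated theta z Ut.
have rotE z j : cis theta * z - t ord0 j = cis theta * (z - a j).
  by rewrite mulrBr /a cis_mulK.
have dPsi z : off_cuts a z -> cder Psi z (vfield a (defect_coef A f k t) z (Psi z)).
  move=> /offE hz.
  have rot : cder (fun y : Cplx R => cis theta * y) z (cis theta).
    have := cder_affine (0 : Cplx R) (cis theta : Cplx R) z.
    by apply: cder_ext => y; rewrite add0r /GRing.scale /= mulrC.
  (* The factor cis theta of the chain rule cancels in 1 / (x - x_i) = 1 / (cis theta (z - a_i)), so
     the rotated defect obeys a system of the same form with the same coefficients. *)
  have := cder_comp rot (cder_defect U_open lg_holo lg_exp A_holo Y_holo Y_unit Y_ode U_distinct f k hz).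
  rewrite scaler_sumr /vfield.
  have c0 : cis theta != 0 :> Cplx R by rewrite -rnorm_gt0 rnorm_cis.
  rewrite (eq_bigr (fun i => (z - a i)^-1 *: defect_coef A f k t i (Psi z))) // => i _.
  by rewrite scalerA rotE invfM mulVKf.
have near_pole j : exists F : Cplx R -> 'M[Cplx R]_m, exists2 r : R, 0 < r &
    forall z : Cplx R, rnorm (z - a j) < r -> ccont F z /\ (off_cuts a z -> Psi z = F z).
  have [r1 r10 h1] := defect_regular U_open lg_holo lg_exp Y_holo Y_unit Y_ode Ut
    (fun s => L_evol j k s) (Yloc_holo j t Ut) (Y_near_pole j t Ut).
  have [r2 r20 h2] := ccont_regular_part U_open rays_disjoint A lg_holo lg_exp f k Ut
    (Yloc_holo j t Ut) (Yloc_unit j t Ut).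
  exists (fun z => regular_part lg A f k j (Yloc j) t (cis theta * z)), (Num.min r1 r2).
    by rewrite lt_min r10.
  move=> z; rewrite -[rnorm _]mul1r -[X in X * _](rnorm_cis theta) -rnormM -rotE lt_min.
  move=> /andP[/h1 k1 /h2 k2]; split; last by move=> /offE; exact: k1.
  apply: ccont_comp k2 => e e0; exists e => // y hy.
  by rewrite -mulrBr rnormM rnorm_cis mul1r ltW.
have near_infinity (e : R) : 0 < e -> exists rho : R, forall z : Cplx R,
    complex.Re z < 0 -> rho < rnorm z -> rnorm (Psi z) <= e.
  move=> e0; have [rho hrho] := defect_near_infinity U_open A Y_holo Y_unit Ut (lg_compat t Ut)
    (Yinf_holo t Ut) Yinf_normalized (Y_near_infty t Ut) (fun s => Linf_evol k s) e0.
  exists rho => z z0 hz; apply: hrho; first by rewrite /back_half_plane /= cisN_mulK.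
  by rewrite rnormM rnorm_cis mul1r.
(* The configuration t is fixed here; neighbouring configurations served only to differentiate. *)
have zero := linear_system_zero kap0 N_lip (heights_distinct (rays_disjoint t Ut)) dPsi
  near_pole near_infinity (@matrix_complete _ _ _).
have xE : cis theta * (cis (- theta) * x) = x by exact: cis_mulK.
have /zero : off_cuts a (cis (- theta) * x) by apply/offE; rewrite xE.
rewrite /Psi xE /defect => /eqP; rewrite subr_eq0 => /eqP D.
apply: is_derive_of_cder.
have W := cder_of_differentiable ((0, delta_mx ord0 k) : Cplx R * 'rV[Cplx R]_n) (Y_holo _ hx).
have -> : (- ((x - t ord0 k)^-1 *: A k t) + (\sum_(j < n) f j k t * lg j (x, t))%:M) *m Y (x, t) =
    dirderiv Y ((0, delta_mx ord0 k) : Cplx R * 'rV[Cplx R]_n) (x, t).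
  by rewrite -D addrC addrK mulmxKV // Y_unit.
by move: W; apply: cder_ext => z; rewrite pair_dir mulr0 addr0.
Qed.
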